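(* Let $\{\lambda_{nk},\alpha_{nk}\}_{(n,k)\in J}$ be a collection with $\lambda_{nk}\ge0$ satisfying conditions (i)–(iii) stated in the context. Then for each fixed $x\in[0,\pi]$ the operator $\mathcal I+\tilde R(x)\colon\mathfrak B\to\mathfrak B$ ($\mathcal I$ being the identity operator of $\mathfrak B$) has a bounded inverse, so the main equation $$\phi(x)(\mathcal I+\tilde R(x))=\tilde\phi(x)$$ has a unique solution $\phi(x)\in\mathfrak B$.
   Context: **Index set and constants.** $m\in\mathbb N$; $T_1,T_2\in\mathbb C^{m\times m}$ are fixed orthogonal projection matrices, $T_j^\perp=I-T_j$. $J:=\{(n,k):n\in\mathbb N,k=1,\dots,m\}\cup\{(0,k):k=p^\perp+1,\dots,m\}$, $p^\perp:=\dim(\operatorname{Ker}T_1\cap\operatorname{Ker}T_2)$, ordered lexicographically. $W^0(\rho):=(T_2T_1+T_2^\perp T_1^\perp)\sin\rho\pi+(T_2^\perp T_1-T_2T_1^\perp)\cos\rho\pi$, $U^0(\rho):=(T_2T_1+T_2^\perp T_1^\perp)\cos\rho\pi+(T_2T_1^\perp-T_2^\perp T_1)\sin\rho\pi$. $0\le r_1\le\dots\le r_m<1$ are the zeros of $\det W^0$ on $[0,1)$ counted with multiplicity; $\mathcal J:=\{1\}\cup\{k=2,\dots,m:r_k\ne r_{k-1}\}=:\{j_k\}_{k=1}^{|\mathcal J|}$; $J_k:=\{s=1,\dots,m:r_s=r_k\}$; $A_k:=\pi\operatorname{Res}_{\rho=r_k}(W^0(\rho))^{-1}U^0(\rho)$.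 **Conditions.** For each maximal group of equal values $\lambda_{n_1k_1}=\dots=\lambda_{n_rk_r}$, $(n_1,k_1)<\dots<(n_r,k_r)$, put $\alpha'_{n_1k_1}:=\alpha_{n_1k_1}$, $\alpha'_{n_jk_j}:=0$, $j=2,\dots,r$, and choose a basis $\{\chi_{n_jk_j}\}_{j=1}^r$ of $\operatorname{Ran}\alpha_{n_1k_1}$. Put $\rho_{nk}:=\sqrt{\lambda_{nk}}\ge0$. (i) $\lambda_{nk}\in\mathbb R$, $\alpha_{nk}\in\mathbb C^{m\times m}$, $\alpha_{nk}=\alpha_{nk}^\dagger\ge0$, $\operatorname{rank}\alpha_{nk}$ equals the number of times $\lambda_{nk}$ occurs in the sequence, and $\alpha_{nk}=\alpha_{ls}$ if $\lambda_{nk}=\lambda_{ls}$. (ii) $\rho_{nk}=n+r_k+\varkappa_{nk}$ with $\{\varkappa_{nk}\}\in l_2$, and $\sum_{s\in J_k}\alpha'_{ns}=\frac2\pi(T_1+nT_1^\perp)(A_k+K_{nk})(T_1+nT_1^\perp)$ for $n\ge1$, $k\in\mathcal J$, with $\{\|K_{nk}\|\}\in l_2$. (iii) $\{X_{nk}\}_{(n,k)\in J}$, $X_{nk}(x)=(\cos(\rho_{nk}x)T_1+\frac{\sin(\rho_{nk}x)}{\rho_{nk}}T_1^\perp)\chi_{nk}$ (with $\sin(\rho x)/\rho:=x$ for $\rho=0$), is complete in $L_2((0,\pi);\mathbb C^m)$. **Model problem.** $\tilde L$: $-Y''=\lambda Y$ on $(0,\pi)$, $T_1Y'(0)-T_1^\perp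 Y(0)=0$, $T_2Y'(\pi)-T_2^\perp Y(\pi)=0$. Its eigenvalues are $\tilde\lambda_{nk}=\tilde\rho_{nk}^2$, $\tilde\rho_{nk}=n+r_k$, $(n,k)\in J$; its weight matrices are $\tilde\alpha_{nk}:=\operatorname{Res}_{\lambda=\tilde\lambda_{nk}}\tilde M(\lambda)$, $\tilde M(\lambda)=T_1\tilde\Phi(0,\lambda)+T_1^\perp\tilde\Phi'(0,\lambda)$, where $\tilde\Phi$ is the matrix solution of $-\tilde\Phi''=\lambda\tilde\Phi$ with $T_1\tilde\Phi'(0)-T_1^\perp\tilde\Phi(0)=I$, $T_2\tilde\Phi'(\pi)-T_2^\perp\tilde\Phi(\pi)=0$. $\tilde\alpha'_{nk}$ is formed from $\{\tilde\lambda_{nk},\tilde\alpha_{nk}\}$ as $\alpha'_{nk}$ from $\{\lambda_{nk},\alpha_{nk}\}$. Put $\tilde\varphi(x,\lambda)=\cos\rho x\,T_1+\frac{\sin\rho x}{\rho}T_1^\perp$, $\rho=\sqrt\lambda$, and $\tilde D(x,\lambda,\mu):=\int_0^x\tilde\varphi(t,\lambda)\tilde\varphi(t,\mu)\,dt$. **Banach space.** $\lambda_{nk0}:=\lambda_{nk}$, $\lambda_{nk1}:=\tilde\lambda_{nk}$, $\rho_{nki}:=\sqrt{\lambda_{nki}}$, $\alpha'_{nk0}:=\alpha'_{nk}$, $\alpha'_{nk1}:=\tilde\alpha'_{nk}$. Multisets: $G_1:=\{\rho_{nki}:(n,k)\in J,\,n\le n_0,\,i=0,1\}$, $G_{|\mathcal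 J|q+s+1}:=\{\rho_{nki}:n=n_0+q+1,\,r_k=r_{j_s},\,i=0,1\}$ for $q\ge0$, $s=1,\dots,|\mathcal J|$, where $n_0$ is fixed so that $G_n\cap G_k=\varnothing$ for $n\ne k$. For a multiset $\mathcal G$ of real numbers, $B(\mathcal G)$ is the space of functions $f:\mathcal G\to\mathbb C^{m\times m}$ with $f(\rho)=f(\theta)$ if $\rho=\theta$, and norm $\|f\|_{B(\mathcal G)}=\max\{\max_{\rho\in\mathcal G}\|f(\rho)\|,\ \max_{\rho\ne\theta}|\rho-\theta|^{-1}\|f(\rho)-f(\theta)\|\}$. $\mathfrak B:=\{f=\{f_n\}_{n\ge1}:f_n\in B(G_n),\ \|f\|_{\mathfrak B}:=\sup_n\|f_n\|_{B(G_n)}<\infty\}$. **Main equation.** $T_{nki}:=T_1+\rho_{nki}T_1^\perp$ if $\rho_{nki}\ne0$, $T_{nki}:=I$ if $\rho_{nki}=0$. $\tilde\phi(x)=\{\tilde\phi_n(x)\}\in\mathfrak B$ is given by $\tilde\phi_n(x)(\rho_{lsj}):=\tilde\varphi(x,\lambda_{lsj})T_{lsj}$ for $\rho_{lsj}\in G_n$. The bounded linear operator $\tilde R(x):\mathfrak B\to\mathfrak B$ (written to the right of its argument) is $$(f\tilde R(x))_n=\sum_{k=1}^\infty f_k\tilde R_{k,n}(x),\quad (f_k\tilde R_{k,n}(x))(\rho_{\eta qi})=\sum_{\rho_{lsj}\in G_k}(-1)^jf_k(\rho_{lsj})T_{lsj}^{-1}\alpha'_{lsj}\tilde D(x,\lambda_{lsj},\lambda_{\eta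 qi})T_{\eta qi},\ \rho_{\eta qi}\in G_n.$$ *)

(* Defs.v *)
From HB Require Import structures.
From mathcomp Require Import all_boot all_order all_algebra.
From mathcomp Require Import all_classical all_reals all_analysis.
From mathcomp Require Import complex.

Set Implicit Arguments.
Unset Strict Implicit.
Unset Printing Implicit Defensive.

Import Order.TTheory GRing.Theory Num.Theory.
Import numFieldNormedType.Exports.

Local Open Scope classical_set_scope.
Local Open Scope ring_scope.
Local Open Scope complex_scope.

Section ComplexAnalysis.
Context {R : realType}.
Local Notation C := (R[i]).
Local Notation Re := (@complex.Re R).
Local Notation Im := (@complex.Im R).

Definition cmod (z : C) : R := ComplexField.Normc.normc z.

Definition cexp (z : C) : C := (expR (Re z))%:C * (cos (Im z) +i* sin (Im z)).
Definition ci : C := 0 +i* 1.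
Definition ccos (z : C) : C := (cexp (ci * z) + cexp (- (ci * z))) / 2.
Definition csin (z : C) : C := (cexp (ci * z) - cexp (- (ci * z))) / (2 * ci).

Definition vnorm n (v : 'cV[C]_n) : R := Num.sqrt (\sum_i cmod (v i ord0) ^+ 2).

(* operator norm induced by the Euclidean norm of C^n *)
Definition mxnorm n (A : 'M[C]_n) : R :=
  sup [set vnorm (A *m v) | v in [set v : 'cV[C]_n | vnorm v <= 1]].

Definition adjmx p q (A : 'M[C]_(p, q)) : 'M[C]_(q, p) :=
  (map_mx (@conjc R) A)^T.

Definition psd n (A : 'M[C]_n) : Prop :=
  adjmx A = A /\ forall v : 'cV[C]_n, 0 <= (adjmx v *m A *m v) ord0 ord0.

Definition orth_proj n (T : 'M[C]_n) : Prop := T *m T = T /\ adjmx T = T.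

Definition perp n (T : 'M[C]_n) : 'M[C]_n := 1%:M - T.

(* The topology of matrices over C is spelled out on the real and imaginary
   parts of the entries. *)
Definition mxcvg p q (u : nat -> 'M[C]_(p, q)) (l : 'M[C]_(p, q)) : Prop :=
  forall i j, ((fun n => Re (u n i j)) @ \oo --> Re (l i j)) /\
              ((fun n => Im (u n i j)) @ \oo --> Im (l i j)).

Definition mxlim p q (u : nat -> 'M[C]_(p, q)) : 'M[C]_(p, q) :=
  \matrix_(i, j) (limn (fun n => Re (u n i j)) +i* limn (fun n => Im (u n i j))).

Definition mx_is_derive p q (F : R -> 'M[C]_(p, q)) (x : R)
    (D : 'M[C]_(p, q)) : Prop :=
  forall i j, is_derive x 1 (fun t => Re (F t i j)) (Re (D i j)) /\
              is_derive x 1 (fun t => Im (F t i j)) (Im (D i j)).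

Definition mx_continuous_on p q (D : set R) (F : R -> 'M[C]_(p, q)) : Prop :=
  forall i j, {within D, continuous (fun t => Re (F t i j))} /\
              {within D, continuous (fun t => Im (F t i j))}.

Definition mxint p q (D : set R) (F : R -> 'M[C]_(p, q)) : 'M[C]_(p, q) :=
  \matrix_(i, j)
    ((\int[@lebesgue_measure R]_(t in D) Re (F t i j)) +i*
     (\int[@lebesgue_measure R]_(t in D) Im (F t i j))).

(* F(z) = \sum_k (z - z0)^(k - N - 1) c_k on a punctured disc: the Laurent
   series of F at a pole of order at most N + 1. *)
Definition is_residue n (F : C -> 'M[C]_n) (z0 : C) (A : 'M[C]_n) : Prop :=
  exists (N : nat) (c : nat -> 'M[C]_n) (e : R),
    [/\ 0 < e, c N = A &
      forall z, 0 < cmod (z - z0) < e ->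
        mxcvg (fun M => \sum_(k < M) (z - z0) ^+ k *: c k)
              ((z - z0) ^+ N.+1 *: F z)].

(* order of z0 as a zero of f, i.e. the index of the first nonzero Taylor
   coefficient; it is 0 if f z0 <> 0 *)
Definition zero_order (f : C -> C) (z0 : C) (d : nat) : Prop :=
  exists (c : nat -> C) (e : R),
    [/\ 0 < e, c d != 0, forall k, (k < d)%N -> c k = 0 &
      forall z, cmod (z - z0) < e ->
        mxcvg (fun M => (\sum_(k < M) (z - z0) ^+ k * c k)%:M : 'M[C]_1)
              (f z)%:M].

(* L_2((0,pi); C^n) *)
Definition sqnorm_L2 n (f : R -> 'cV[C]_n) : \bar R :=
  (\int[@lebesgue_measure R]_(t in `]0%R, pi[%classic) (vnorm (f t) ^+ 2)%:E)%E.

Definition in_L2 n (f : R -> 'cV[C]_n) : Prop :=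
  (forall i, measurable_fun `]0%R, pi[%classic (fun t => Re (f t i ord0)) /\
             measurable_fun `]0%R, pi[%classic (fun t => Im (f t i ord0))) /\
  (sqnorm_L2 f < +oo)%E.

Definition complete_in_L2 n (I : Type) (X : I -> R -> 'cV[C]_n) : Prop :=
  forall (f : R -> 'cV[C]_n) (e : R), in_L2 f -> 0 < e ->
    exists s : seq (C * I),
      (sqnorm_L2 (fun t => f t - \sum_(a <- s) a.1 *: X a.2 t)%R < e%:E)%E.

End ComplexAnalysis.

Section Data.
Context {R : realType} {m : nat}.
Local Notation C := (R[i]).
Local Notation M := 'M[C]_m.
Variables T1 T2 : M.

Definition mulop (T : M) : 'Hom('cV[C]_m, 'cV[C]_m) :=
  linfun (mulmx T : 'cV[C]_m -> 'cV[C]_m).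

Definition pperp : nat := \dim (lker (mulop T1) :&: lker (mulop T2))%VS.

(* The second index k = 1, ..., m is represented by the ordinal k - 1. *)
Definition in_J (a : nat * 'I_m) : bool := (0 < a.1)%N || (pperp <= a.2)%N.
Definition J := {a : nat * 'I_m | in_J a}.
Definition J1 (a : J) : nat := (val a).1.
Definition J2 (a : J) : 'I_m := (val a).2.
(* the index (n + 1, k) *)
Definition Jpos (n : nat) (k : 'I_m) : J :=
  exist (fun a => in_J a) (n.+1, k) (erefl true).

Definition J_lt (a b : J) : Prop :=
  (J1 a < J1 b)%N \/ J1 a = J1 b /\ (J2 a < J2 b)%N.

Definition W0 (z : C) : M :=
  csin (z * pi%:C) *: (T2 *m T1 + perp T2 *m perp T1) +
  ccos (z * pi%:C) *: (perp T2 *m T1 - T2 *m perp T1).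

Definition U0 (z : C) : M :=
  ccos (z * pi%:C) *: (T2 *m T1 + perp T2 *m perp T1) +
  csin (z * pi%:C) *: (T2 *m perp T1 - perp T2 *m T1).

Definition zeros_of_detW0 (r : 'I_m -> R) : Prop :=
  [/\ forall k, 0 <= r k < 1,
      forall j k : 'I_m, (j <= k)%N -> r j <= r k &
      forall t : R, 0 <= t < 1 ->
        zero_order (fun z => \det (W0 z)) t%:C #|[set k | r k == t]|].

Definition is_A (r : 'I_m -> R) (A : 'I_m -> M) : Prop :=
  forall k, exists2 B : M,
    is_residue (fun z => invmx (W0 z) *m U0 z) (r k)%:C B & A k = pi%:C *: B.

(* the set of the first indices k of the groups of equal values r_k *)
Definition calJ (r : 'I_m -> R) : {set 'I_m} :=
  [set k : 'I_m | [forall j : 'I_m, (j.+1 == k) ==> (r k != r j)]].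

(* s enumerates the indices b with lam b = lam a *)
Definition level_seq (lam : J -> R) (a : J) (s : seq J) : Prop :=
  uniq s /\ forall b, b \in s <-> lam b = lam a.

Definition prime_of (lam : J -> R) (alpha : J -> M) (a : J) : M :=
  if `[< exists b, J_lt b a /\ lam b = lam a >] then 0 else alpha a.

Definition cond_i (lam : J -> R) (alpha : J -> M) : Prop :=
  [/\ forall a, psd (alpha a),
      forall a, exists2 s, level_seq lam a s & \rank (alpha a) = size s &
      forall a b, lam a = lam b -> alpha a = alpha b].

Definition cond_ii (r : 'I_m -> R) (A : 'I_m -> M)
    (lam : J -> R) (alpha : J -> M) : Prop :=
  (\esum_(a in [set: J])
     ((Num.sqrt (lam a) - ((J1 a)%:R + r (J2 a)))%R ^+ 2)%:E < +oo)%E /\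
  exists K : nat -> 'I_m -> M,
    (forall (n : nat) (k : 'I_m), k \in calJ r ->
       \sum_(s | r s == r k) prime_of lam alpha (Jpos n s) =
       (2 / pi)%:C *: ((T1 + n.+1%:R *: perp T1) *m (A k + K n k) *m
                       (T1 + n.+1%:R *: perp T1))) /\
    (\esum_(a in [set a : nat * 'I_m | a.2 \in calJ r])
       (mxnorm (K a.1 a.2) ^+ 2)%:E < +oo)%E.

Definition sinc (rho x : R) : R :=
  if rho == 0 then x else sin (rho * x) / rho.

Definition phit (x lam : R) : M :=
  (cos (Num.sqrt lam * x))%:C *: T1 + (sinc (Num.sqrt lam) x)%:C *: perp T1.

Definition Dt (x lam mu : R) : M :=
  mxint `[0, x]%classic (fun t => phit t lam *m phit t mu).

Definition chi_basis (lam : J -> R) (alpha : J -> M)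
    (chi : J -> 'cV[C]_m) : Prop :=
  forall a, exists2 s, level_seq lam a s &
    basis_of (limg (mulop (alpha a))) [seq chi b | b <- s].

Definition cond_iii (lam : J -> R) (alpha : J -> M) : Prop :=
  exists2 chi : J -> 'cV[C]_m, chi_basis lam alpha chi &
    complete_in_L2 (fun (a : J) (x : R) => phit x (lam a) *m chi a).

Definition lamt (r : 'I_m -> R) (a : J) : R := ((J1 a)%:R + r (J2 a)) ^+ 2.

(* the value at lam of the Weyl matrix of the model problem *)
Definition is_weyl_value (lam : C) (M0 : M) : Prop :=
  exists Phi DPhi : R -> M,
    [/\ forall x, 0 < x < pi ->
          mx_is_derive Phi x (DPhi x) /\ mx_is_derive DPhi x (- lam *: Phi x),
        mx_continuous_on `[0, pi]%classic Phi /\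
        mx_continuous_on `[0, pi]%classic DPhi,
        T1 *m DPhi 0 - perp T1 *m Phi 0 = 1%:M,
        T2 *m DPhi pi - perp T2 *m Phi pi = 0 &
        M0 = T1 *m Phi 0 + perp T1 *m DPhi 0].

Definition is_model_weight (lam0 : C) (alpha0 : M) : Prop :=
  exists (Mt : C -> M) (e : R),
    [/\ 0 < e,
        forall lam, 0 < cmod (lam - lam0) < e -> is_weyl_value lam (Mt lam) &
        is_residue Mt lam0 alpha0].

(* the index (n, k, i): false stands for i = 0 (the given data) and true for
   i = 1 (the model data) *)
Definition JJ := (J * bool)%type.

Section BanachSpace.
Variables (r : 'I_m -> R) (n0 : nat).
Variables (lam : J -> R) (alpha alphat : J -> M).

Definition lamI (a : JJ) : R := if a.2 then lamt r a.1 else lam a.1.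
Definition rhoI (a : JJ) : R := Num.sqrt (lamI a).
Definition alphaI (a : JJ) : M :=
  if a.2 then prime_of (lamt r) alphat a.1 else prime_of lam alpha a.1.

(* The multiset G_(N+1) of values of rhoI, given by the set of its indices. *)
Definition G (N : nat) : set JJ :=
  [set a : JJ | (N = 0%N /\ (J1 a.1 <= n0)%N) \/
    exists (q : nat) (s : 'I_#|calJ r|),
      [/\ N = (#|calJ r| * q + s).+1, J1 a.1 = (n0 + q + 1)%N &
          r (J2 a.1) = r (enum_val s)]].

Definition G_disjoint : Prop :=
  forall N N' a b, N <> N' -> G N a -> G N' b -> rhoI a <> rhoI b.

(* A sequence {f_n} of functions on the G_n is identified with the function f
   on all the indices; f_n is the restriction of f to G n. *)
Definition normBG (f : JJ -> M) (N : nat) : \bar R :=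
  maxe (ereal_sup [set (mxnorm (f a))%:E | a in G N])
       (ereal_sup [set (`|rhoI ab.1 - rhoI ab.2|^-1 *
                        mxnorm (f ab.1 - f ab.2))%:E |
                   ab in [set ab : JJ * JJ |
                     [/\ G N ab.1, G N ab.2 & rhoI ab.1 <> rhoI ab.2]]]).

Definition normB (f : JJ -> M) : \bar R :=
  ereal_sup [set normBG f N | N in [set: nat]].

Definition frakB : set (JJ -> M) :=
  [set f | (forall N a b, G N a -> G N b -> rhoI a = rhoI b -> f a = f b) /\
           (normB f < +oo)%E].

Definition bounded_operator (S : (JJ -> M) -> JJ -> M) : Prop :=
  [/\ forall f, frakB f -> frakB (S f),
      forall (c : C) f g, frakB f -> frakB g ->
        S (c *: f + g) = c *: S f + S g &
      exists c : R, forall f, frakB f -> (normB (S f) <= c%:E * normB f)%E].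

Definition has_bounded_inverse (S : (JJ -> M) -> JJ -> M) : Prop :=
  exists2 S' : (JJ -> M) -> JJ -> M, bounded_operator S' &
    forall f, frakB f -> S' (S f) = f /\ S (S' f) = f.

Definition TI (a : JJ) : M :=
  if rhoI a == 0 then 1%:M else T1 + (rhoI a)%:C *: perp T1.

Definition phitB (x : R) (a : JJ) : M := phit x (lamI a) *m TI a.

(* value at a of f_k R~_(k,n)(x), where a is in G n *)
Definition Rblock (x : R) (f : JJ -> M) (k : nat) (a : JJ) : M :=
  \sum_(b \in G k) ((-1) ^+ b.2 *:
    (f b *m invmx (TI b) *m alphaI b *m Dt x (lamI b) (lamI a) *m TI a)).

Definition Rpartial (x : R) (f : JJ -> M) (a : JJ) (N : nat) : M :=
  \sum_(k < N) Rblock x f k a.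

Definition Rtilde (x : R) (f : JJ -> M) : JJ -> M :=
  fun a => mxlim (Rpartial x f a).

(* The series defining Rtilde converges and Rtilde is a bounded linear operator
   of frakB. *)
Definition Rtilde_well_defined (x : R) : Prop :=
  (forall f a, frakB f -> mxcvg (Rpartial x f a) (Rtilde x f a)) /\
  bounded_operator (Rtilde x).

Definition IRtilde (x : R) (f : JJ -> M) : JJ -> M := f + Rtilde x f.

Definition main_equation (x : R) (phi : JJ -> M) : Prop :=
  IRtilde x phi = phitB x.

End BanachSpace.
End Data.

(* Main.v *)
Require Import Defs.
From mathcomp Require Import all_boot all_order all_algebra.
From mathcomp Require Import all_classical all_reals all_analysis.
From mathcomp Require Import measurable_realfun complex ring lra.

(* Write g = f T^-1 and F_N(t) for the sum of (-1)^j g(rho) alpha' phi~(t, lambda)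
   over the indices of the first N blocks, so that the N-th partial sum of f R~(x) is
   the integral of F_N phi~ T over [0, x].  Comparing Laurent coefficients shows that
   A_k is the orthogonal projection onto the kernel of W^0(r_k), and that the model
   weights are (2/pi) T' A_k T' with T' = T_1 + rho T_1^perp.  Expanding each block to
   first order in the perturbation of the data, condition (ii) and the orthogonality
   of the trigonometric system make F_N a Cauchy sequence in L_2(0, pi), uniformly on
   bounded sets of f.  Hence R~(x) is a norm limit of finite-rank operators (over the
   ring of matrices), and I + R~(x) is boundedly invertible once it is injective.

   Let f + f R~(x) = 0.  The inner product of F_M and F_N over [0, x] tends, as M
   grows, to the sum over the first N blocks of (-1)^(1+j) tr(g alpha' g^dagger).
   Bessel's inequality for the model eigenfunctions bounds the j = 1 part by the
   squared norm of F_N, up to a small error; so the j = 0 part is arbitrarily small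
   and g alpha = 0 on the given data.  Then the limit of F_N is orthogonal to every
   X_nk, so by completeness F_N tends to 0, and f = - lim (integral of F_N phi~ T) = 0. *)

Set Implicit Arguments.
Unset Strict Implicit.
Unset Printing Implicit Defensive.

Import Order.TTheory GRing.Theory Num.Theory.
Import numFieldNormedType.Exports.

Local Open Scope ring_scope.
Local Open Scope complex_scope.

(** * The Frobenius inner product *)

Section RealForm.
Context {R : realType}.

(** Inside a block the single matrices alpha' need not converge; condition (ii) controls only their
    sum. The difference quotient in the norm of B compensates for this: on a block the values of f
    differ from a common value by at most a multiple of the shifts kappa of the frequencies, so up
    to a square summable error only the sums of the weights count, and these cancel between given
    and model data.

    Estimates are made on F_N in L_2 instead of on the operator, because phi~ T is bounded and
    Lipschitz in rho uniformly over all indices: one L_2 bound then yields the supremum and the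
    difference quotient at once.

    No boundary value problem with the given data is available, so injectivity cannot use its
    eigenfunction expansion. The model problem contributes only Bessel's inequality; the given data
    contribute the positivity of alpha and the completeness (iii). Since R~ acts on the right, it
    commutes with left multiplication by matrices, and its finite-rank approximation is inverted by
    a single scalar matrix. *)

Lemma discr_le (a b c : R) : 0 <= a -> 0 <= c ->
  (forall t, 0 <= a + 2 * t * b + t ^+ 2 * c) -> b ^+ 2 <= a * c.
Proof.
move=> a0 c0 h; have [c_eq0|cn0] := eqVneq c 0.
  rewrite c_eq0 mulr0; have [->|bn0] := eqVneq b 0; first by rewrite expr0n.
  have := h (- (a + 1) / (2 * b)); rewrite c_eq0 mulr0 addr0.
  have -> : 2 * (- (a + 1) / (2 * b)) * b = - (a + 1) by field.
  by lra.
have cp : 0 < c by rewrite lt_def cn0.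
have := h (- b / c).
have -> : a + 2 * (- b / c) * b + (- b / c) ^+ 2 * c = (a * c - b ^+ 2) / c.
  by field.
by rewrite pmulr_lge0 ?invr_gt0 // subr_ge0.
Qed.

Lemma normr_le_sqrtM (a b c : R) : 0 <= a -> 0 <= c -> b ^+ 2 <= a * c ->
  `|b| <= Num.sqrt a * Num.sqrt c.
Proof.
by move=> a0 c0 h; rewrite -sqrtrM // -sqrtr_sqr ler_sqrt // mulr_ge0.
Qed.

Lemma sqrt_form_triangle (a b c : R) : 0 <= a -> 0 <= c -> b ^+ 2 <= a * c ->
  Num.sqrt (a + 2 * b + c) <= Num.sqrt a + Num.sqrt c.
Proof.
move=> a0 c0 /(normr_le_sqrtM a0 c0) h.
have s0 : 0 <= Num.sqrt a + Num.sqrt c by rewrite addr_ge0 ?sqrtr_ge0.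
rewrite -(ger0_norm s0) -sqrtr_sqr ler_sqrt ?sqr_ge0 //.
rewrite sqrrD !sqr_sqrtr // lerD2r lerD2l mulr2n.
have := le_trans (ler_norm b) h; lra.
Qed.

End RealForm.

Section Complex.
Context {R : realType}.
Local Notation C := (R[i]).
Local Notation Re := (@complex.Re R).
Local Notation Im := (@complex.Im R).
Implicit Types z w : C.

Lemma ReD z w : Re (z + w) = Re z + Re w. Proof. by case: z; case: w. Qed.
Lemma ImD z w : Im (z + w) = Im z + Im w. Proof. by case: z; case: w. Qed.
Lemma ReN z : Re (- z) = - Re z. Proof. by case: z. Qed.
Lemma ImN z : Im (- z) = - Im z. Proof. by case: z. Qed.
Lemma ReM z w : Re (z * w) = Re z * Re w - Im z * Im w.
Proof. by case: z; case: w. Qed.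
Lemma ImM z w : Im (z * w) = Re z * Im w + Im z * Re w.
Proof. by case: z; case: w => a b c d /=; rewrite [c * b]mulrC [d * a]mulrC addrC [a * d]mulrC [b * c]mulrC addrC. Qed.
Lemma ReJ z : Re (conjc z) = Re z. Proof. by case: z. Qed.
Lemma ImJ z : Im (conjc z) = - Im z. Proof. by case: z. Qed.
Lemma ImR (x : R) : Im x%:C = 0. Proof. by []. Qed.
Lemma ReRM (x : R) z : Re (x%:C * z) = x * Re z.
Proof. by rewrite ReM ImR mul0r subr0. Qed.
Lemma ImRM (x : R) z : Im (x%:C * z) = x * Im z.
Proof. by rewrite ImM ImR mul0r addr0. Qed.
Lemma complex_eq z w : Re z = Re w -> Im z = Im w -> z = w.
Proof. by case: z; case: w => a b c d /= -> ->. Qed.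

Lemma Re_sum (I : Type) (s : seq I) (P : pred I) (F : I -> C) :
  Re (\sum_(i <- s | P i) F i) = \sum_(i <- s | P i) Re (F i).
Proof. by apply: (big_morph Re ReD). Qed.
Lemma Im_sum (I : Type) (s : seq I) (P : pred I) (F : I -> C) :
  Im (\sum_(i <- s | P i) F i) = \sum_(i <- s | P i) Im (F i).
Proof. by apply: (big_morph Im ImD). Qed.

Lemma cmodE z : cmod z = Num.sqrt (Re z ^+ 2 + Im z ^+ 2).
Proof. by case: z. Qed.
Lemma cmod_ge0 z : 0 <= cmod z. Proof. by rewrite cmodE sqrtr_ge0. Qed.
Lemma cmod_sqr z : cmod z ^+ 2 = Re z ^+ 2 + Im z ^+ 2.
Proof. by rewrite cmodE sqr_sqrtr // addr_ge0 ?sqr_ge0. Qed.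
Lemma cmodD z w : cmod (z + w) <= cmod z + cmod w.
Proof. exact: complex.le_normcD. Qed.
Lemma cmodM z w : cmod (z * w) = cmod z * cmod w.
Proof. exact: ComplexField.Normc.normcM. Qed.
Lemma cmodN z : cmod (- z) = cmod z.
Proof. exact: complex.normcN. Qed.
Lemma cmod0 : cmod (0 : C) = 0.
Proof. exact: ComplexField.Normc.normc0. Qed.
Lemma cmod_eq0 z : cmod z = 0 -> z = 0.
Proof. exact: ComplexField.Normc.eq0_normc. Qed.
Lemma cmodR (x : R) : cmod x%:C = `|x|.
Proof. by rewrite cmodE /= expr0n addr0 sqrtr_sqr. Qed.
Lemma normRe_le z : `|Re z| <= cmod z.
Proof. by rewrite cmodE -sqrtr_sqr ler_sqrt ?addr_ge0 ?sqr_ge0 // lerDl sqr_ge0. Qed.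
Lemma normIm_le z : `|Im z| <= cmod z.
Proof. by rewrite cmodE -sqrtr_sqr ler_sqrt ?addr_ge0 ?sqr_ge0 // lerDr sqr_ge0. Qed.
Lemma cmod_le z : cmod z <= `|Re z| + `|Im z|.
Proof.
rewrite cmodE -[leRHS]ger0_norm ?addr_ge0 // -sqrtr_sqr ler_sqrt ?sqr_ge0 //.
rewrite sqrrD !real_normK ?num_real // lerD2r lerDl mulrn_wge0 //.
Qed.
Lemma cmod_sum (I : Type) (s : seq I) (P : pred I) (F : I -> C) :
  cmod (\sum_(i <- s | P i) F i) <= \sum_(i <- s | P i) cmod (F i).
Proof.
elim/big_rec2: _ => [|i y x _ h]; first by rewrite cmod0.
by apply: le_trans (cmodD _ _) _; rewrite lerD2l.
Qed.

End Complex.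

Section MatrixForm.
Context {R : realType}.
Local Notation C := (R[i]).
Local Notation Re := (@complex.Re R).
Local Notation Im := (@complex.Im R).

Lemma adjmxD p q (A B : 'M[C]_(p, q)) : adjmx (A + B) = adjmx A + adjmx B.
Proof. by apply/matrixP => i j; rewrite !mxE rmorphD. Qed.
Lemma adjmxN p q (A : 'M[C]_(p, q)) : adjmx (- A) = - adjmx A.
Proof. by apply/matrixP => i j; rewrite !mxE rmorphN. Qed.
Lemma adjmxB p q (A B : 'M[C]_(p, q)) : adjmx (A - B) = adjmx A - adjmx B.
Proof. by rewrite adjmxD adjmxN. Qed.
Lemma adjmxZ p q (z : C) (A : 'M[C]_(p, q)) : adjmx (z *: A) = conjc z *: adjmx A.
Proof. by apply/matrixP => i j; rewrite !mxE rmorphM. Qed.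
Lemma adjmxZR p q (x : R) (A : 'M[C]_(p, q)) :
  adjmx (x%:C *: A) = x%:C *: adjmx A.
Proof. by rewrite adjmxZ conjc_real. Qed.
Lemma adjmxM p q s (A : 'M[C]_(p, q)) (B : 'M[C]_(q, s)) :
  adjmx (A *m B) = adjmx B *m adjmx A.
Proof.
apply/matrixP => i j; rewrite !mxE rmorph_sum; apply: eq_bigr => k _.
by rewrite !mxE rmorphM mulrC.
Qed.
Lemma adjmxK p q (A : 'M[C]_(p, q)) : adjmx (adjmx A) = A.
Proof. by apply/matrixP => i j; rewrite !mxE conjcK. Qed.
Lemma adjmx0 p q : adjmx (0 : 'M[C]_(p, q)) = 0.
Proof. by apply/matrixP => i j; rewrite !mxE rmorph0. Qed.
Lemma adjmx1 n : adjmx (1%:M : 'M[C]_n) = 1%:M.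
Proof. by apply/matrixP => i j; rewrite !mxE eq_sym rmorph_nat. Qed.
Lemma adjmx_sum p q (I : Type) (s : seq I) (P : pred I) (F : I -> 'M[C]_(p, q)) :
  adjmx (\sum_(i <- s | P i) F i) = \sum_(i <- s | P i) adjmx (F i).
Proof. exact: (big_morph _ (@adjmxD p q) (@adjmx0 p q)). Qed.

(** The real part of the Hermitian form: complex matrices are treated as a Euclidean space over R,
    so that all inequalities below are between real numbers. *)
Definition rdot p q (A B : 'M[C]_(p, q)) : R := Re (\tr (A *m adjmx B)).
Definition fro p q (A : 'M[C]_(p, q)) : R := Num.sqrt (rdot A A).

Section Rect.
Variables p q : nat.
Implicit Types A B D : 'M[C]_(p, q).

Lemma rdotE A B : rdot A B =
  \sum_i \sum_j (Re (A i j) * Re (B i j) + Im (A i j) * Im (B i j)).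
Proof.
rewrite /rdot Re_sum; apply: eq_bigr => i _; rewrite mxE Re_sum.
by apply: eq_bigr => j _; rewrite !mxE ReM ReJ ImJ mulrN opprK.
Qed.
Lemma rdotC A B : rdot A B = rdot B A.
Proof.
by rewrite !rdotE; do 2![apply: eq_bigr => ? _]; congr (_ + _); rewrite mulrC.
Qed.
Lemma rdotDl A B D : rdot (A + B) D = rdot A D + rdot B D.
Proof. by rewrite /rdot mulmxDl mxtraceD ReD. Qed.
Lemma rdotDr A B D : rdot D (A + B) = rdot D A + rdot D B.
Proof. by rewrite !(rdotC D) rdotDl. Qed.
Lemma rdotNl A B : rdot (- A) B = - rdot A B.
Proof. by rewrite /rdot mulNmx raddfN ReN. Qed.
Lemma rdotNr A B : rdot A (- B) = - rdot A B.
Proof. by rewrite !(rdotC A) rdotNl. Qed.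
Lemma rdotBl A B D : rdot (A - B) D = rdot A D - rdot B D.
Proof. by rewrite rdotDl rdotNl. Qed.
Lemma rdotZl (x : R) A B : rdot (x%:C *: A) B = x * rdot A B.
Proof. by rewrite /rdot -scalemxAl mxtraceZ ReRM. Qed.
Lemma rdotZr (x : R) A B : rdot A (x%:C *: B) = x * rdot A B.
Proof. by rewrite !(rdotC A) rdotZl. Qed.
Lemma rdot0l A : rdot 0 A = 0.
Proof. by rewrite /rdot mul0mx raddf0. Qed.
Lemma rdot_suml (I : Type) (s : seq I) (P : pred I) (F : I -> 'M[C]_(p, q)) B :
  rdot (\sum_(i <- s | P i) F i) B = \sum_(i <- s | P i) rdot (F i) B.
Proof. apply: (big_morph (fun A => rdot A B)) => [A D|]; [exact: rdotDl|exact: rdot0l]. Qed.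
Lemma rdot_cmod A : rdot A A = \sum_i \sum_j cmod (A i j) ^+ 2.
Proof. by rewrite rdotE; do 2![apply: eq_bigr => ? _]; rewrite cmod_sqr !expr2. Qed.
Lemma rdot_ge0 A : 0 <= rdot A A.
Proof. by rewrite rdot_cmod; do 2![apply: sumr_ge0 => ? _]; rewrite sqr_ge0. Qed.
Lemma rdot_CS A B : (rdot A B) ^+ 2 <= rdot A A * rdot B B.
Proof.
apply: discr_le; rewrite ?rdot_ge0 // => t.
have := rdot_ge0 (A + t%:C *: B).
rewrite rdotDl !rdotDr !rdotZl !rdotZr (rdotC B A); lra.
Qed.
Lemma fro_ge0 A : 0 <= fro A. Proof. exact: sqrtr_ge0. Qed.
Lemma fro_sqr A : fro A ^+ 2 = rdot A A.
Proof. by rewrite sqr_sqrtr ?rdot_ge0. Qed.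
Lemma rdot_le A B : `|rdot A B| <= fro A * fro B.
Proof. by apply: normr_le_sqrtM; rewrite ?rdot_ge0 ?rdot_CS. Qed.
Lemma froD A B : fro (A + B) <= fro A + fro B.
Proof.
rewrite /fro rdotDl !rdotDr (rdotC B A).
have -> : rdot A A + rdot A B + (rdot A B + rdot B B) =
  rdot A A + 2 * rdot A B + rdot B B by ring.
by apply: sqrt_form_triangle; rewrite ?rdot_ge0 ?rdot_CS.
Qed.
Lemma froN A : fro (- A) = fro A.
Proof. by rewrite /fro rdotNl rdotNr opprK. Qed.
Lemma froB A B : fro (A - B) <= fro A + fro B.
Proof. by rewrite -(froN B) froD. Qed.
Lemma fro0 : fro (0 : 'M[C]_(p, q)) = 0.
Proof. by rewrite /fro rdot0l sqrtr0. Qed.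
Lemma fro_sum (I : Type) (s : seq I) (P : pred I) (F : I -> 'M[C]_(p, q)) :
  fro (\sum_(i <- s | P i) F i) <= \sum_(i <- s | P i) fro (F i).
Proof.
elim/big_rec2: _ => [|i y x _ h]; first by rewrite fro0.
by apply: le_trans (froD _ _) _; rewrite lerD2l.
Qed.
Lemma cmod_le_fro A i j : cmod (A i j) <= fro A.
Proof.
rewrite -[leLHS]ger0_norm ?cmod_ge0 // -sqrtr_sqr ler_sqrt ?rdot_ge0 //.
rewrite rdot_cmod (bigD1 i) //= (bigD1 j) //= -addrA lerDl.
by rewrite addr_ge0 // ?sumr_ge0 // => *; rewrite ?sqr_ge0 ?sumr_ge0 // => *; rewrite sqr_ge0.
Qed.
Lemma fro_le_sum A : fro A <= \sum_i \sum_j cmod (A i j).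
Proof.
have s0 : 0 <= \sum_i \sum_j cmod (A i j).
  by do 2![apply: sumr_ge0 => ? _]; rewrite cmod_ge0.
rewrite -[leRHS]ger0_norm // -sqrtr_sqr ler_sqrt ?sqr_ge0 // rdot_cmod.
rewrite [leRHS]expr2 mulr_suml ler_sum // => i _; rewrite mulr_suml ler_sum // => j _.
rewrite expr2 ler_wpM2l ?cmod_ge0 // (bigD1 i) //= (bigD1 j) //= -addrA lerDl.
by rewrite addr_ge0 // ?sumr_ge0 // => *; rewrite ?cmod_ge0 ?sumr_ge0 // => *; rewrite cmod_ge0.
Qed.
Lemma fro_eq0 A : fro A = 0 -> A = 0.
Proof.
move=> h; apply/matrixP => i j; rewrite mxE; apply: cmod_eq0.
by apply/eqP; rewrite eq_le cmod_ge0 andbT -h cmod_le_fro.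
Qed.
Lemma fro_le0 A : fro A <= 0 -> A = 0.
Proof. by move=> h; apply: fro_eq0; apply/eqP; rewrite eq_le h fro_ge0. Qed.
Lemma froZR (x : R) A : fro (x%:C *: A) = `|x| * fro A.
Proof.
by rewrite /fro rdotZl rdotZr mulrA -expr2 sqrtrM ?sqr_ge0 // sqrtr_sqr.
Qed.
Lemma rdotZZ (z w : C) A : rdot (z *: A) (z *: A) = cmod z ^+ 2 * rdot A A.
Proof.
rewrite !rdot_cmod mulr_sumr; apply: eq_bigr => i _; rewrite mulr_sumr.
by apply: eq_bigr => j _; rewrite mxE cmodM exprMn.
Qed.
Lemma froZ (z : C) A : fro (z *: A) = cmod z * fro A.
Proof.
by rewrite /fro rdotZZ // sqrtrM ?sqr_ge0 // sqrtr_sqr ger0_norm // cmod_ge0.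
Qed.
End Rect.

Lemma fro_adjmx p q (A : 'M[C]_(p, q)) : fro (adjmx A) = fro A.
Proof.
rewrite /fro !rdot_cmod; congr (Num.sqrt _); rewrite [LHS]exchange_big /=.
apply: eq_bigr => i _; apply: eq_bigr => j _; by rewrite !mxE !cmod_sqr ReJ ImJ sqrrN.
Qed.

Lemma sum_sqr_CS n (a b : 'I_n -> R) :
  (\sum_i a i * b i) ^+ 2 <= (\sum_i a i ^+ 2) * (\sum_i b i ^+ 2).
Proof.
apply: discr_le => [||t]; try by apply: sumr_ge0 => ? _; rewrite sqr_ge0.
have -> : \sum_i a i ^+ 2 + 2 * t * (\sum_i a i * b i) +
    t ^+ 2 * (\sum_i b i ^+ 2) = \sum_i (a i + t * b i) ^+ 2.
  rewrite !mulr_sumr -!big_split /=; apply: eq_bigr => i _; ring.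
by apply: sumr_ge0 => ? _; rewrite sqr_ge0.
Qed.

Lemma froM p q s (A : 'M[C]_(p, q)) (B : 'M[C]_(q, s)) :
  fro (A *m B) <= fro A * fro B.
Proof.
rewrite /fro -sqrtrM ?rdot_ge0 // ler_sqrt ?mulr_ge0 ?rdot_ge0 // !rdot_cmod.
rewrite mulr_suml; apply: ler_sum => i _.
rewrite [X in _ * X]exchange_big mulr_sumr; apply: ler_sum => j _; rewrite mxE.
apply: le_trans (sum_sqr_CS _ _).
rewrite ler_sqr ?nnegrE ?cmod_ge0 ?sumr_ge0 //; last first.
  by move=> k _; rewrite mulr_ge0 ?cmod_ge0.
by apply: le_trans (cmod_sum _ _ _) _; apply: ler_sum => k _; rewrite cmodM.
Qed.

Lemma rdotMr p q s (X : 'M[C]_(p, q)) (A : 'M[C]_(q, s)) (Y : 'M[C]_(p, s)) :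
  rdot (X *m A) Y = rdot X (Y *m adjmx A).
Proof. by rewrite /rdot adjmxM adjmxK !mulmxA. Qed.

Lemma rdotMl p q s (A : 'M[C]_(p, q)) (X : 'M[C]_(q, s)) (Y : 'M[C]_(p, s)) :
  rdot (A *m X) Y = rdot X (adjmx A *m Y).
Proof. by rewrite /rdot adjmxM adjmxK mulmxA -mulmxA mxtrace_mulC. Qed.

Lemma vnorm_fro n (v : 'cV[C]_n) : vnorm v = fro v.
Proof.
by rewrite /fro rdot_cmod; congr (Num.sqrt _); apply: eq_bigr => i _; rewrite big_ord1.
Qed.

Lemma mxnorm_set_bound n (A : 'M[C]_n) : ubound
  [set vnorm (A *m v) | v in [set v : 'cV[C]_n | vnorm v <= 1]]%classic (fro A).
Proof.
move=> _ [v /= v1 <-]; rewrite !vnorm_fro in v1 *.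
by apply: le_trans (froM _ _) _; rewrite ler_piMr ?fro_ge0.
Qed.

Lemma mxnorm_has_sup n (A : 'M[C]_n) : has_sup
  [set vnorm (A *m v) | v in [set v : 'cV[C]_n | vnorm v <= 1]]%classic.
Proof.
split; last by exists (fro A); apply: mxnorm_set_bound.
by exists (vnorm (A *m 0)), 0 => //=; rewrite vnorm_fro fro0.
Qed.

Lemma mxnorm_le_fro n (A : 'M[C]_n) : mxnorm A <= fro A.
Proof. by apply: ge_sup; [case: (mxnorm_has_sup A)|apply: mxnorm_set_bound]. Qed.

Lemma mxnorm_ge0 n (A : 'M[C]_n) : 0 <= mxnorm A.
Proof.
apply: le_trans (_ : vnorm (A *m 0) <= _); first by rewrite vnorm_fro fro_ge0.
by apply: sup_upper_bound; [apply: mxnorm_has_sup|exists 0 => //=; rewrite vnorm_fro fro0].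
Qed.

Lemma cmod_le_mxnorm n (A : 'M[C]_n) i j : cmod (A i j) <= mxnorm A.
Proof.
apply: le_trans (_ : vnorm (A *m delta_mx j ord0) <= _).
  rewrite vnorm_fro -colE; have := cmod_le_fro (col j A) i ord0.
  by rewrite mxE.
apply: sup_upper_bound; first exact: mxnorm_has_sup.
exists (delta_mx j ord0) => //=; rewrite vnorm_fro /fro rdot_cmod.
rewrite (bigD1 j) //= [X in _ + X]big1 => [|k kj]; rewrite big_ord1.
  by rewrite addr0 mxE !eqxx cmodE /= expr0n expr1n !addr0 !sqrtr1 expr1n sqrtr1.
by rewrite mxE (negbTE kj) cmodE /= expr0n addr0 sqrtr0 expr0n.
Qed.

(** Each entry is bounded by the operator norm, so the two norms are equivalent. Only boundedness is
    at stake later, hence the crude factor. *)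
Lemma fro_le_mxnorm n (A : 'M[C]_n) : fro A <= (n ^ 2)%:R * mxnorm A.
Proof.
apply: le_trans (fro_le_sum _) _.
apply: le_trans (_ : \sum_(i < n) \sum_(j < n) mxnorm A <= _).
  by do 2![apply: ler_sum => ? _]; apply: cmod_le_mxnorm.
by rewrite !sumr_const !card_ord -mulrnA mulr_natl -mulnn.
Qed.

(** Positivity in the form in which it is applied: against rectangular [X], whose rows are tested
    separately, and through the real form [rdot]. *)
Definition rpsd n (A : 'M[C]_n) : Prop :=
  adjmx A = A /\ forall p (X : 'M[C]_(p, n)), 0 <= rdot (X *m A) X.

Lemma psd_rpsd n (A : 'M[C]_n) : psd A -> rpsd A.
Proof.
case=> hA pA; split=> // p X.
rewrite /rdot Re_sum sumr_ge0 // => i _.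
have := pA (adjmx (row i X)); rewrite adjmxK => /le_trans.
have -> : (row i X *m A *m adjmx (row i X)) ord0 ord0 = (X *m A *m adjmx X) i i.
  rewrite -row_mul !mxE; apply: eq_bigr => k _; by rewrite !mxE.
by move/(_ _ (lexx _)); rewrite lecE => /andP[].
Qed.

Lemma rpsd_conj n (A B : 'M[C]_n) : rpsd A -> adjmx B = B -> rpsd (B *m A *m B).
Proof.
case=> hA pA hB; split; first by rewrite !adjmxM hA hB mulmxA.
by move=> p X; rewrite !mulmxA rdotMr hB pA.
Qed.

Lemma rpsd0 n : rpsd (0 : 'M[C]_n).
Proof. by split=> [|p X]; rewrite ?adjmx0 // mulmx0 rdot0l. Qed.

Lemma rpsd_CS n p (A : 'M[C]_n) (X Y : 'M[C]_(p, n)) : rpsd A ->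
  rdot (X *m A) Y ^+ 2 <= rdot (X *m A) X * rdot (Y *m A) Y.
Proof.
case=> hA pA; apply: discr_le => [||t]; rewrite ?pA //.
have := pA p (X + t%:C *: Y).
rewrite mulmxDl -scalemxAl rdotDl !rdotDr !rdotZl !rdotZr.
rewrite (rdotMr Y A X) hA (rdotC Y); lra.
Qed.

(** A null vector of a semidefinite form lies in its radical: Cauchy-Schwarz against [X *m A] leaves
    the fourth power of [fro (X *m A)] bounded by 0. *)
Lemma rpsd_eq0 n p (A : 'M[C]_n) (X : 'M[C]_(p, n)) : rpsd A ->
  rdot (X *m A) X = 0 -> X *m A = 0.
Proof.
move=> pA h; apply: fro_eq0; apply/eqP; rewrite /fro sqrtr_eq0.
have := rpsd_CS X (X *m A) pA; rewrite h mul0r => h2.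
have /eqP : rdot (X *m A) (X *m A) ^+ 2 == 0 by rewrite eq_le h2 sqr_ge0.
by move/eqP; rewrite sqrf_eq0 => /eqP ->.
Qed.

(** Cauchy-Schwarz for the form of [A], taken at the identity and at [A] itself, bounds the fourth
    power of [fro A] by the trace times its third power. A bound on the trace of a sum of positive
    matrices thus bounds every summand. *)
Lemma rpsd_fro_le_tr n (A : 'M[C]_n) : rpsd A -> fro A <= Re (\tr A).
Proof.
move=> pA; have := rpsd_CS 1%:M A pA; rewrite !mul1mx -fro_sqr => h.
have trE : rdot A 1%:M = Re (\tr A) by rewrite /rdot adjmx1 mulmx1.
have tr0 : 0 <= Re (\tr A) by have := pA.2 n 1%:M; rewrite mul1mx trE.
have h2 : rdot (A *m A) A <= fro A ^+ 3.
  rewrite exprS; apply: le_trans (ler_norm _) _; apply: le_trans (rdot_le _ _) _.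
  by rewrite mulrC ler_wpM2l ?fro_ge0 // expr2 froM.
have [->|fn0] := eqVneq (fro A) 0; first by [].
have fp : 0 < fro A ^+ 3 by rewrite exprn_gt0 // lt_def fn0 fro_ge0.
rewrite -(ler_pM2r fp) -exprS; apply: le_trans (_ : Re (\tr A) * rdot (A *m A) A <= _).
  by rewrite -trE; rewrite -exprM in h.
by rewrite ler_wpM2l.
Qed.

Lemma Re_tr_le n (A : 'M[C]_n) : Re (\tr A) <= Num.sqrt n%:R * fro A.
Proof.
have -> : Re (\tr A) = rdot A 1%:M by rewrite /rdot adjmx1 mulmx1.
apply: le_trans (ler_norm _) _; apply: le_trans (rdot_le _ _) _.
rewrite mulrC ler_wpM2r ?fro_ge0 // /fro /rdot adjmx1 mulmx1 mxtrace1.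
have -> : Re (n%:R : C) = n%:R; last by [].
by elim: n {A} => // n IH; rewrite -!natr1 ReD IH.
Qed.

Lemma fro_approx0 p q (A : 'M[C]_(p, q)) :
  (forall e, 0 < e -> fro A <= e) -> A = 0.
Proof.
move=> h; apply: fro_le0; apply/ler_addgt0Pr => e e0.
by rewrite add0r h.
Qed.

End MatrixForm.

(** * Integrals of matrix functions *)

Section Integration.
Context {R : realType}.
Local Notation C := (R[i]).
Local Notation Re := (@complex.Re R).
Local Notation Im := (@complex.Im R).

Definition rint (x : R) (f : R -> R) : R :=
  \int[@lebesgue_measure R]_(t in `[0, x]%classic) f t.

Lemma rint_integrable x (f : R -> R) : continuous f ->
  (@lebesgue_measure R).-integrable `[0, x]%classic (EFin \o f).
Proof.
move=> cf; apply: continuous_compact_integrable; first exact: segment_compact.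
exact: continuous_subspaceT.
Qed.

Lemma rint_ext x (f g : R -> R) : (forall t, 0 <= t <= x -> f t = g t) ->
  rint x f = rint x g.
Proof.
by move=> h; apply: eq_Rintegral => t; rewrite inE /= in_itv /= => /h.
Qed.

Lemma rintD x (f g : R -> R) : continuous f -> continuous g ->
  rint x (fun t => f t + g t) = rint x f + rint x g.
Proof. by move=> cf cg; apply: RintegralD => //; apply: rint_integrable. Qed.

Lemma rintZ x c (f : R -> R) : continuous f ->
  rint x (fun t => c * f t) = c * rint x f.
Proof. by move=> cf; apply: RintegralZl => //; apply: rint_integrable. Qed.

Lemma rint_ge0 x (f : R -> R) : (forall t, 0 <= t <= x -> 0 <= f t) ->
  0 <= rint x f.
Proof. by move=> h; apply: Rintegral_ge0 => t; rewrite /= in_itv /= => /h. Qed.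

Lemma rint_le x (f g : R -> R) : continuous f -> continuous g ->
  (forall t, 0 <= t <= x -> f t <= g t) -> rint x f <= rint x g.
Proof.
move=> cf cg h; apply: le_Rintegral => //; exact: rint_integrable.
Qed.

Lemma rint_cst x c : 0 <= x -> rint x (fun=> c) = c * x.
Proof.
move=> x0; rewrite /rint Rintegral_cst //= lebesgue_measure_itv /= lte_fin.
case: ltP => h; first by rewrite -EFinD /= subr0.
have -> : x = 0 by apply/eqP; rewrite eq_le h x0.
by rewrite mulr0.
Qed.

Lemma rint_le_bound (x y : R) (f : R -> R) : continuous f ->
  (forall t, 0 <= t <= y -> 0 <= f t) -> 0 <= x <= y -> rint x f <= rint y f.
Proof.
move=> cf f0 /andP[x0 xy].
have i1 := @rint_integrable x _ cf; have i2 := @rint_integrable y _ cf.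
rewrite /rint /Rintegral fine_le //; try exact: integrable_fin_num.
apply: ge0_subset_integral => //=.
- by move/integrableP : i2 => [].
- by move=> t; rewrite /= !in_itv /= => /andP[-> /le_trans ->].
Qed.

Lemma continuous_sum (I : Type) (s : seq I) (P : pred I) (f : I -> R -> R) :
  (forall i, continuous (f i)) ->
  continuous (fun t => \sum_(i <- s | P i) f i t).
Proof.
move=> cf; elim: s => [|i s IH].
  have -> : (fun t => \sum_(i <- [::] | P i) f i t) = cst 0.
    by apply/funext => t; rewrite big_nil.
  by move=> t; apply: cst_continuous.
case Pi: (P i).
  have -> : (fun t => \sum_(j <- i :: s | P j) f j t) =
            (fun t => f i t + \sum_(j <- s | P j) f j t).
    by apply/funext => t; rewrite big_cons Pi.
  by move=> t; apply: continuousD; [apply: cf|apply: IH].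
have -> : (fun t => \sum_(j <- i :: s | P j) f j t) =
          (fun t => \sum_(j <- s | P j) f j t).
  by apply/funext => t; rewrite big_cons Pi.
exact: IH.
Qed.

Lemma continuousDr (f g : R -> R) : continuous f -> continuous g ->
  continuous (fun t => f t + g t).
Proof. by move=> cf cg t; apply: continuousD; [apply: cf|apply: cg]. Qed.
Lemma continuousMr (f g : R -> R) : continuous f -> continuous g ->
  continuous (fun t => f t * g t).
Proof. by move=> cf cg t; apply: continuousM; [apply: cf|apply: cg]. Qed.
Lemma continuousNr (f : R -> R) : continuous f -> continuous (fun t => - f t).
Proof. by move=> cf t; apply: continuousN; apply: cf. Qed.
Lemma continuous_cst (c : R) : continuous (fun _ : R => c).
Proof. by move=> t; apply: cst_continuous. Qed.
Lemma continuous_cosM (a : R) : continuous (fun t => cos (a * t)).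
Proof.
move=> t; apply: continuous_comp; last exact: continuous_cos.
by apply: continuousM; [apply: cst_continuous|].
Qed.
Lemma continuous_sinM (a : R) : continuous (fun t => sin (a * t)).
Proof.
move=> t; apply: continuous_comp; last exact: continuous_sin.
by apply: continuousM; [apply: cst_continuous|].
Qed.

Lemma rint_sum x (I : Type) (s : seq I) (P : pred I) (f : I -> R -> R) :
  (forall i, continuous (f i)) ->
  rint x (fun t => \sum_(i <- s | P i) f i t) = \sum_(i <- s | P i) rint x (f i).
Proof.
move=> cf; elim: s => [|i s IH].
  rewrite big_nil -[RHS](mul0r (rint x (cst 0))) -rintZ; last exact: continuous_cst.
  by apply: rint_ext => t _; rewrite big_nil mul0r.
rewrite big_cons; case Pi: (P i).
  rewrite -IH -rintD //; last exact: continuous_sum.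
  by apply: rint_ext => t _; rewrite big_cons Pi.
by rewrite -IH; apply: rint_ext => t _; rewrite big_cons Pi.
Qed.

Definition mcont p q (F : R -> 'M[C]_(p, q)) : Prop :=
  forall i j, continuous (fun t => Re (F t i j)) /\
              continuous (fun t => Im (F t i j)).

Section MatrixFun.
Variables p q : nat.
Implicit Types F H : R -> 'M[C]_(p, q).

Lemma mcontD F H : mcont F -> mcont H -> mcont (fun t => F t + H t).
Proof.
move=> cF cH i j; split.
  have -> : (fun t => Re ((F t + H t) i j)) =
    (fun t => Re (F t i j) + Re (H t i j)) by apply/funext => t; rewrite mxE ReD.
  by apply: continuousDr; [case: (cF i j)|case: (cH i j)].
have -> : (fun t => Im ((F t + H t) i j)) =
    (fun t => Im (F t i j) + Im (H t i j)) by apply/funext => t; rewrite mxE ImD.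
by apply: continuousDr; [case: (cF i j)|case: (cH i j)].
Qed.

Lemma mcontN F : mcont F -> mcont (fun t => - F t).
Proof.
move=> cF i j; split.
  have -> : (fun t => Re ((- F t) i j)) = (fun t => - Re (F t i j)).
    by apply/funext => t; rewrite mxE ReN.
  by apply: continuousNr; case: (cF i j).
have -> : (fun t => Im ((- F t) i j)) = (fun t => - Im (F t i j)).
  by apply/funext => t; rewrite mxE ImN.
by apply: continuousNr; case: (cF i j).
Qed.

Lemma mcontB F H : mcont F -> mcont H -> mcont (fun t => F t - H t).
Proof. by move=> cF cH; apply: mcontD => //; apply: mcontN. Qed.

Lemma mcont_cst (A : 'M[C]_(p, q)) : mcont (fun=> A).
Proof. by move=> i j; split; apply: continuous_cst. Qed.

Lemma mcontZR (f : R -> R) F : continuous f -> mcont F ->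
  mcont (fun t => (f t)%:C *: F t).
Proof.
move=> cf cF i j; split.
  have -> : (fun t => Re (((f t)%:C *: F t) i j)) =
    (fun t => f t * Re (F t i j)) by apply/funext => t; rewrite mxE ReRM.
  by apply: continuousMr => //; case: (cF i j).
have -> : (fun t => Im (((f t)%:C *: F t) i j)) =
  (fun t => f t * Im (F t i j)) by apply/funext => t; rewrite mxE ImRM.
by apply: continuousMr => //; case: (cF i j).
Qed.

Lemma mcont_sum (I : Type) (s : seq I) (P : pred I) (F : I -> R -> 'M[C]_(p, q)) :
  (forall i, mcont (F i)) -> mcont (fun t => \sum_(i <- s | P i) F i t).
Proof.
move=> cF i j; split.
  have -> : (fun t => Re ((\sum_(i <- s | P i) F i t) i j)) =
    (fun t => \sum_(k <- s | P k) Re (F k t i j)).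
    by apply/funext => t; rewrite summxE Re_sum.
  by apply: continuous_sum => k; case: (cF k i j).
have -> : (fun t => Im ((\sum_(i <- s | P i) F i t) i j)) =
  (fun t => \sum_(k <- s | P k) Im (F k t i j)).
  by apply/funext => t; rewrite summxE Im_sum.
by apply: continuous_sum => k; case: (cF k i j).
Qed.

Lemma continuous_rdot F H : mcont F -> mcont H ->
  continuous (fun t => rdot (F t) (H t)).
Proof.
move=> cF cH.
have -> : (fun t => rdot (F t) (H t)) = (fun t => \sum_i \sum_j
    (Re (F t i j) * Re (H t i j) + Im (F t i j) * Im (H t i j))).
  by apply/funext => t; rewrite rdotE.
apply: continuous_sum => i; apply: continuous_sum => j.
case: (cF i j) => c1 c2; case: (cH i j) => c3 c4.
by apply: continuousDr; apply: continuousMr.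
Qed.
End MatrixFun.

Lemma mcont_adj p q (F : R -> 'M[C]_(p, q)) : mcont F ->
  mcont (fun t => adjmx (F t)).
Proof.
move=> cF i j; split.
  have -> : (fun t => Re (adjmx (F t) i j)) = (fun t => Re (F t j i)).
    by apply/funext => t; rewrite !mxE ReJ.
  by case: (cF j i).
have -> : (fun t => Im (adjmx (F t) i j)) = (fun t => - Im (F t j i)).
  by apply/funext => t; rewrite !mxE ImJ.
by apply: continuousNr; case: (cF j i).
Qed.

Lemma mcontM p q s (F : R -> 'M[C]_(p, q)) (H : R -> 'M[C]_(q, s)) :
  mcont F -> mcont H -> mcont (fun t => F t *m H t).
Proof.
move=> cF cH i j; split.
  have -> : (fun t => Re ((F t *m H t) i j)) = (fun t => \sum_k
    (Re (F t i k) * Re (H t k j) - Im (F t i k) * Im (H t k j))).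
    by apply/funext => t; rewrite mxE Re_sum; apply: eq_bigr => k _; rewrite ReM.
  apply: continuous_sum => k; case: (cF i k) => ? ?; case: (cH k j) => ? ?.
  by apply: continuousDr; [|apply: continuousNr]; apply: continuousMr.
have -> : (fun t => Im ((F t *m H t) i j)) = (fun t => \sum_k
  (Re (F t i k) * Im (H t k j) + Im (F t i k) * Re (H t k j))).
  by apply/funext => t; rewrite mxE Im_sum; apply: eq_bigr => k _; rewrite ImM.
apply: continuous_sum => k; case: (cF i k) => ? ?; case: (cH k j) => ? ?.
by apply: continuousDr; apply: continuousMr.
Qed.

Definition mint (x : R) p q (F : R -> 'M[C]_(p, q)) : 'M[C]_(p, q) :=
  mxint `[0, x]%classic F.

Lemma Re_mint x p q (F : R -> 'M[C]_(p, q)) i j :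
  Re (mint x F i j) = rint x (fun t => Re (F t i j)).
Proof. by rewrite /mint /mxint mxE. Qed.
Lemma Im_mint x p q (F : R -> 'M[C]_(p, q)) i j :
  Im (mint x F i j) = rint x (fun t => Im (F t i j)).
Proof. by rewrite /mint /mxint mxE. Qed.

Lemma rdot_mint x p q (F : R -> 'M[C]_(p, q)) D : mcont F ->
  rdot (mint x F) D = rint x (fun t => rdot (F t) D).
Proof.
move=> cF; rewrite rdotE.
transitivity (rint x (fun t => \sum_i \sum_j
    (Re (F t i j) * Re (D i j) + Im (F t i j) * Im (D i j)))); last first.
  by apply: rint_ext => t _; rewrite rdotE.
have c1 i j : continuous (fun t => Re (F t i j) * Re (D i j)).
  by apply: continuousMr; [case: (cF i j)|apply: continuous_cst].
have c2 i j : continuous (fun t => Im (F t i j) * Im (D i j)).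
  by apply: continuousMr; [case: (cF i j)|apply: continuous_cst].
rewrite rint_sum; last by move=> i; apply: continuous_sum => j; apply: continuousDr.
apply: eq_bigr => i _; rewrite rint_sum; last by move=> j; apply: continuousDr.
apply: eq_bigr => j _; rewrite rintD //; case: (cF i j) => c3 c4.
rewrite Re_mint Im_mint; congr (_ + _); rewrite mulrC -rintZ //;
  by apply: rint_ext => t _; rewrite mulrC.
Qed.

(** Matrix integrals are identified by testing them against constant matrices, which turns each
    identity into one for scalar integrals. *)
Lemma rdot_inj p q (A B : 'M[C]_(p, q)) : (forall D, rdot A D = rdot B D) -> A = B.
Proof.
move=> h; apply/eqP; rewrite -subr_eq0; apply/eqP/fro_eq0.
by rewrite /fro rdotBl h subrr sqrtr0.
Qed.

Section Mint.
Variable x : R.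

Lemma mint_ext p q (F H : R -> 'M[C]_(p, q)) :
  (forall t, 0 <= t <= x -> F t = H t) -> mint x F = mint x H.
Proof.
move=> h; apply/matrixP => i j; apply: complex_eq; rewrite ?Re_mint ?Im_mint;
  by apply: rint_ext => t /h ->.
Qed.

Lemma mintD p q (F H : R -> 'M[C]_(p, q)) : mcont F -> mcont H ->
  mint x (fun t => F t + H t) = mint x F + mint x H.
Proof.
move=> cF cH; apply: rdot_inj => D; rewrite rdotDl !rdot_mint //; last exact: mcontD.
rewrite -rintD; try by apply: continuous_rdot => //; apply: mcont_cst.
by apply: rint_ext => t _; rewrite rdotDl.
Qed.

Lemma mint_mulmxl p q s (A : 'M[C]_(s, p)) (F : R -> 'M[C]_(p, q)) : mcont F ->
  mint x (fun t => A *m F t) = A *m mint x F.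
Proof.
move=> cF; apply: rdot_inj => D; rewrite rdotMl !rdot_mint //.
  by apply: rint_ext => t _; rewrite rdotMl.
by apply: mcontM => //; apply: mcont_cst.
Qed.

Lemma mint_mulmxr p q s (A : 'M[C]_(q, s)) (F : R -> 'M[C]_(p, q)) : mcont F ->
  mint x (fun t => F t *m A) = mint x F *m A.
Proof.
move=> cF; apply: rdot_inj => D; rewrite rdotMr !rdot_mint //.
  by apply: rint_ext => t _; rewrite rdotMr.
by apply: mcontM => //; apply: mcont_cst.
Qed.

Lemma mint_sum p q (I : Type) (s : seq I) (P : pred I) (F : I -> R -> 'M[C]_(p, q)) :
  (forall i, mcont (F i)) ->
  mint x (fun t => \sum_(i <- s | P i) F i t) = \sum_(i <- s | P i) mint x (F i).
Proof.
move=> cF; apply: rdot_inj => D; rewrite rdot_suml rdot_mint; last exact: mcont_sum.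
transitivity (rint x (fun t => \sum_(i <- s | P i) rdot (F i t) D)).
  by apply: rint_ext => t _; rewrite rdot_suml.
rewrite rint_sum => [|i]; last by apply: continuous_rdot => //; apply: mcont_cst.
by apply: eq_bigr => i _; rewrite rdot_mint.
Qed.

End Mint.

Lemma mintN x p q (F : R -> 'M[C]_(p, q)) : mcont F ->
  mint x (fun t => - F t) = - mint x F.
Proof.
move=> cF; have -> : - mint x F = (- 1%:M) *m mint x F by rewrite mulNmx mul1mx.
rewrite -mint_mulmxl //; by apply: mint_ext => t _; rewrite mulNmx mul1mx.
Qed.

Definition ip (x : R) p q (F H : R -> 'M[C]_(p, q)) : R :=
  rint x (fun t => rdot (F t) (H t)).
Definition nL (x : R) p q (F : R -> 'M[C]_(p, q)) : R := Num.sqrt (ip x F F).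

(** A constant left factor leaves the integral: the pairing with [D *m H t] depends on [F] only
    through the matrix coefficient of [F] along [H]. *)
Lemma ip_mint x p q s (F : R -> 'M[C]_(p, s)) (H : R -> 'M[C]_(q, s)) (D : 'M[C]_(p, q)) :
  mcont F -> mcont H ->
  ip x F (fun t => D *m H t) = rdot (mint x (fun t => F t *m adjmx (H t))) D.
Proof.
move=> cF cH; rewrite rdot_mint; last by apply: mcontM => //; apply: mcont_adj.
by apply: rint_ext => t _; rewrite rdotMr adjmxK.
Qed.

Section Ip.
Variables (x : R) (p q : nat).
Implicit Types F H K : R -> 'M[C]_(p, q).

Lemma ip_ext F F' H H' : (forall t, 0 <= t <= x -> F t = F' t) ->
  (forall t, 0 <= t <= x -> H t = H' t) -> ip x F H = ip x F' H'.
Proof. by move=> h1 h2; apply: rint_ext => t tx; rewrite h1 ?h2. Qed.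
Lemma ipC F H : ip x F H = ip x H F.
Proof. by apply: rint_ext => t _; rewrite rdotC. Qed.
Lemma ipDl F H K : mcont F -> mcont H -> mcont K ->
  ip x (fun t => F t + H t) K = ip x F K + ip x H K.
Proof.
move=> cF cH cK; rewrite -rintD; try exact: continuous_rdot.
by apply: rint_ext => t _; rewrite rdotDl.
Qed.
Lemma ipZl (c : R) F H : mcont F -> mcont H ->
  ip x (fun t => c%:C *: F t) H = c * ip x F H.
Proof.
move=> cF cH; rewrite -rintZ; last exact: continuous_rdot.
by apply: rint_ext => t _; rewrite rdotZl.
Qed.
Lemma ipNl F H : mcont F -> mcont H ->
  ip x (fun t => - F t) H = - ip x F H.
Proof.
move=> cF cH; rewrite -mulN1r -rintZ; last exact: continuous_rdot.
by apply: rint_ext => t _; rewrite rdotNl mulN1r.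
Qed.
Lemma ipDr F H K : mcont F -> mcont H -> mcont K ->
  ip x K (fun t => F t + H t) = ip x K F + ip x K H.
Proof. by move=> *; rewrite !(ipC K) ipDl. Qed.
Lemma ipZr (c : R) F H : mcont F -> mcont H ->
  ip x H (fun t => c%:C *: F t) = c * ip x H F.
Proof. by move=> *; rewrite !(ipC H) ipZl. Qed.
Lemma ipNr F H : mcont F -> mcont H ->
  ip x H (fun t => - F t) = - ip x H F.
Proof. by move=> *; rewrite !(ipC H) ipNl. Qed.
Lemma ip_suml (I : Type) (s : seq I) (P : pred I) (F : I -> R -> 'M[C]_(p, q)) H :
  (forall i, mcont (F i)) -> mcont H ->
  ip x (fun t => \sum_(i <- s | P i) F i t) H = \sum_(i <- s | P i) ip x (F i) H.
Proof.
move=> cF cH; rewrite -rint_sum => [|i]; last exact: continuous_rdot.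
by apply: rint_ext => t _; rewrite rdot_suml.
Qed.
Lemma ip_sumr (I : Type) (s : seq I) (P : pred I) (F : I -> R -> 'M[C]_(p, q)) H :
  (forall i, mcont (F i)) -> mcont H ->
  ip x H (fun t => \sum_(i <- s | P i) F i t) = \sum_(i <- s | P i) ip x H (F i).
Proof.
by move=> cF cH; rewrite ipC (@ip_suml _ s P F H cF cH); apply: eq_bigr => i _; apply: ipC.
Qed.
Lemma ip_ge0 F : 0 <= ip x F F.
Proof. by apply: rint_ge0 => t _; apply: rdot_ge0. Qed.
Lemma ip_CS F H : mcont F -> mcont H -> ip x F H ^+ 2 <= ip x F F * ip x H H.
Proof.
move=> cF cH; apply: discr_le; rewrite ?ip_ge0 // => t.
have cZ : mcont (fun u => t%:C *: H u).
  by apply: (@mcontZR _ _ (fun=> t)) => //; apply: continuous_cst.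
have := ip_ge0 (fun u => F u + t%:C *: H u).
rewrite (ipDl cF cZ (mcontD cF cZ)) (ipDr cF cZ cF) (ipDr cF cZ cZ).
rewrite (ipZl t cH cF) (ipZl t cH cZ) (ipZr t cH cF) (ipZr t cH cH) (ipC H F).
by move: (ip x F F) (ip x F H) (ip x H H) => a b c; lra.
Qed.
Lemma ip_le F H : mcont F -> mcont H -> `|ip x F H| <= nL x F * nL x H.
Proof. by move=> cF cH; apply: normr_le_sqrtM; rewrite ?ip_ge0 ?ip_CS. Qed.
Lemma nL_ge0 F : 0 <= nL x F. Proof. exact: sqrtr_ge0. Qed.
Lemma nL_sqr F : nL x F ^+ 2 = ip x F F.
Proof. by rewrite sqr_sqrtr ?ip_ge0. Qed.
Lemma nL_ext F H : (forall t, 0 <= t <= x -> F t = H t) -> nL x F = nL x H.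
Proof. by move=> h; rewrite /nL (ip_ext h h). Qed.
Lemma nLD F H : mcont F -> mcont H ->
  nL x (fun t => F t + H t) <= nL x F + nL x H.
Proof.
move=> cF cH; rewrite /nL (ipDl cF cH (mcontD cF cH)) (ipDr cF cH cF).
rewrite (ipDr cF cH cH) (ipC H F).
have := sqrt_form_triangle (ip_ge0 F) (ip_ge0 H) (ip_CS cF cH).
move: (ip x F F) (ip x F H) (ip x H H) => a b c; apply: le_trans.
by rewrite le_eqVlt; apply/orP; left; apply/eqP; congr Num.sqrt; ring.
Qed.
Lemma nLN F : mcont F -> nL x (fun t => - F t) = nL x F.
Proof. by move=> cF; rewrite /nL (ipNl cF (mcontN cF)) (ipNr cF cF) opprK. Qed.
Lemma nL0 : nL x (fun=> 0 : 'M[C]_(p, q)) = 0.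
Proof.
have := @ipNl (fun=> 0) (fun=> 0) (mcont_cst 0) (mcont_cst 0).
rewrite oppr0 /nL; move: (ip _ _ _) => a h.
by have -> : a = 0; [lra|rewrite sqrtr0].
Qed.
Lemma nL_sum (I : Type) (s : seq I) (P : pred I) (F : I -> R -> 'M[C]_(p, q)) :
  (forall i, mcont (F i)) ->
  nL x (fun t => \sum_(i <- s | P i) F i t) <= \sum_(i <- s | P i) nL x (F i).
Proof.
move=> cF; elim: s => [|i s IH].
  by rewrite big_nil (_ : nL _ _ = 0) // -nL0; apply: nL_ext => t _; rewrite big_nil.
rewrite big_cons; case Pi: (P i).
  apply: le_trans (_ : nL x (F i) + nL x (fun t => \sum_(i <- s | P i) F i t) <= _).
    apply: le_trans (nLD (cF i) _); last exact: mcont_sum.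
    by rewrite le_eqVlt; apply/orP; left; apply/eqP; apply: nL_ext => t _; rewrite big_cons Pi.
  by rewrite lerD2l.
apply: le_trans IH.
by rewrite le_eqVlt; apply/orP; left; apply/eqP; apply: nL_ext => t _; rewrite big_cons Pi.
Qed.
Lemma nL_bound F c : mcont F -> 0 <= x -> 0 <= c ->
  (forall t, 0 <= t <= x -> fro (F t) <= c) -> nL x F <= Num.sqrt x * c.
Proof.
move=> cF x0 c0 h; rewrite -[X in _ * X]ger0_norm // -sqrtr_sqr -sqrtrM //.
rewrite ler_sqrt ?mulr_ge0 ?sqr_ge0 // mulrC -rint_cst //.
apply: rint_le; [exact: continuous_rdot|exact: continuous_cst|move=> t /h ht].
by rewrite -fro_sqr ler_sqr ?nnegrE ?fro_ge0.
Qed.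
End Ip.

Lemma nL_mulr x p q s (F : R -> 'M[C]_(p, q)) (w : R -> 'M[C]_(q, s)) c :
  mcont F -> mcont w -> 0 <= c -> (forall t, 0 <= t <= x -> fro (w t) <= c) ->
  nL x (fun t => F t *m w t) <= c * nL x F.
Proof.
move=> cF cw c0 h; rewrite -[X in X * _]ger0_norm // -sqrtr_sqr -sqrtrM ?sqr_ge0 //.
rewrite ler_sqrt ?mulr_ge0 ?sqr_ge0 ?ip_ge0 // {2}/ip -rintZ; last exact: continuous_rdot.
apply: rint_le; first by apply: continuous_rdot; apply: mcontM.
  by apply: continuousMr; [apply: continuous_cst|apply: continuous_rdot].
move=> t /h ht; rewrite -!fro_sqr -exprMn ler_sqr ?nnegrE ?mulr_ge0 ?fro_ge0 //.
by apply: le_trans (froM _ _) _; rewrite mulrC ler_wpM2r ?fro_ge0.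
Qed.

Lemma nL_mull x p q s (F : R -> 'M[C]_(q, s)) (A : 'M[C]_(p, q)) :
  mcont F -> nL x (fun t => A *m F t) <= fro A * nL x F.
Proof.
move=> cF; have a0 := fro_ge0 A.
rewrite -[X in X * _]ger0_norm // -sqrtr_sqr -sqrtrM ?sqr_ge0 //.
rewrite ler_sqrt ?mulr_ge0 ?sqr_ge0 ?ip_ge0 // {2}/ip -rintZ; last exact: continuous_rdot.
have cAF : mcont (fun t => A *m F t) by apply: mcontM => //; apply: mcont_cst.
apply: rint_le; first exact: continuous_rdot.
  by apply: continuousMr; [apply: continuous_cst|apply: continuous_rdot].
move=> t _; rewrite -!fro_sqr -exprMn ler_sqr ?nnegrE ?mulr_ge0 ?fro_ge0 //.
exact: froM.
Qed.

Lemma nL_le_dom (x y : R) p q (F : R -> 'M[C]_(p, q)) : mcont F -> 0 <= x <= y ->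
  nL x F <= nL y F.
Proof.
move=> cF xy; rewrite ler_sqrt ?ip_ge0 //; apply: rint_le_bound => //.
  exact: continuous_rdot.
by move=> t _; apply: rdot_ge0.
Qed.

(** Duality: the squared norm of the integral D is the L_2 pairing of [F] with D times the adjoint
    of [w], hence at most [nL x F] times [fro D] times [Num.sqrt x * c]; one factor [fro D] is then
    divided out. *)
Lemma fro_mint_le x p q s (F : R -> 'M[C]_(p, q)) (w : R -> 'M[C]_(q, s)) c :
  mcont F -> mcont w -> 0 <= x -> 0 <= c ->
  (forall t, 0 <= t <= x -> fro (w t) <= c) ->
  fro (mint x (fun t => F t *m w t)) <= Num.sqrt x * c * nL x F.
Proof.
move=> cF cw x0 c0 h; set D := mint _ _.
have h2 : fro D ^+ 2 <= nL x F * (fro D * (Num.sqrt x * c)).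
  rewrite fro_sqr /D; have cw' := mcont_adj cw.
  have e1 : mint x (fun t => F t *m w t) = mint x (fun t => F t *m adjmx (adjmx (w t))).
    by apply: mint_ext => t _; rewrite adjmxK.
  rewrite [X in rdot X _]e1 -ip_mint // -/D; apply: le_trans (ler_norm _) _.
  apply: le_trans (ip_le _ cF (mcontM (mcont_cst D) cw')) _.
  rewrite ler_wpM2l ?nL_ge0 //; apply: le_trans (nL_mull _ _ cw') _.
  rewrite ler_wpM2l ?fro_ge0 //; apply: nL_bound => // t tx.
  by rewrite fro_adjmx h.
have [->|Dn0] := eqVneq (fro D) 0; first by rewrite !mulr_ge0 ?sqrtr_ge0 ?nL_ge0.
have Dp : 0 < fro D by rewrite lt_def Dn0 fro_ge0.
rewrite -(ler_pM2l Dp) -expr2; apply: le_trans h2 _; rewrite le_eqVlt; apply/orP; left.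
by move: (nL x F) (fro D) (Num.sqrt x) => a b d; apply/eqP; ring.
Qed.

End Integration.

(** * Elementary trigonometric integrals and Taylor bounds *)

Section Trigonometry.
Context {R : realType}.

Lemma rint_cosM (a x : R) : 0 <= x -> a != 0 ->
  rint x (fun t => cos (a * t)) = sin (a * x) / a.
Proof.
rewrite le_eqVlt => /orP[/eqP <-|x0] a0.
  rewrite mulr0 sin0 mul0r /rint set_itv1 /Rintegral integral_set1 //.
pose F := fun t : R => sin (a * t) / a.
have dF (t : R) : is_derive t (1 : R) F (cos (a * t)).
  have h1 : is_derive t (1 : R) (fun u : R => a * u) a.
    have := @is_deriveZ _ _ _ id a t 1 1 (is_derive_id _ _).
    by rewrite /GRing.scale /= mulr1.
  have h2 := @is_derive1_comp _ (@sin R) _ t _ _ (is_derive_sin (a * t)) h1.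
  have := @is_deriveZ _ _ _ _ a^-1 t 1 _ h2.
  rewrite /GRing.scale /= mulrCA mulVf // mulr1.
  by have -> : a^-1 \*: (sin \o (fun u => a * u)) = F; [apply/funext => u; rewrite /F mulrC|].
have cF : continuous F.
  by move=> t; apply/differentiable_continuous/derivable1_diffP; have [] := dF t.
rewrite /rint /Rintegral (@continuous_FTC2 _ _ F) //.
- by rewrite /F mulr0 sin0 mul0r /= subr0.
- exact/continuous_subspaceT/continuous_cosM.
- split=> [t _||]; first by have [] := dF t.
    by apply: cvg_at_right_filter; apply: cF.
  by apply: cvg_at_left_filter; apply: cF.
- by move=> t _; rewrite derive1E; apply: derive_val.
Qed.

Lemma cos_lip (a b : R) : `|cos a - cos b| <= `|a - b|.
Proof.
wlog ab : a b / b <= a => [h|].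
  by case: (leP b a) => [/h //|/ltW /h]; rewrite distrC (distrC a).
have [c _ ->] := @MVT_segment R (@cos R) (fun c => - sin c) b a ab
  (fun c _ => is_derive_cos c) (continuous_subspaceT (@continuous_cos R)).
by rewrite normrM normrN ler_piMl // sin_max.
Qed.

Lemma sin_lip (a b : R) : `|sin a - sin b| <= `|a - b|.
Proof.
wlog ab : a b / b <= a => [h|].
  by case: (leP b a) => [/h //|/ltW /h]; rewrite distrC (distrC a).
have [c _ ->] := @MVT_segment R (@sin R) (fun c => cos c) b a ab
  (fun c _ => is_derive_sin c) (continuous_subspaceT (@continuous_sin R)).
by rewrite normrM ler_piMl // cos_max.
Qed.

(** The mean value theorem is applied once, followed by the Lipschitz bound for the sine at the
    intermediate point; this gives the constant 1 instead of 1/2. *)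
Lemma cos_taylor (a h : R) : `|cos (a + h) - cos a + h * sin a| <= h ^+ 2.
Proof.
wlog h0 : a h / 0 <= h => [H|].
  have [/H //|/ltW h0] := leP 0 h.
  have := H (- a) (- h); rewrite oppr_ge0 => /(_ h0).
  by rewrite -opprD !cosN sinN mulrNN sqrrN.
have ah : a <= a + h by lra.
have [c ca ->] := @MVT_segment R (@cos R) (fun c => - sin c) a (a + h) ah
  (fun c _ => is_derive_cos c) (continuous_subspaceT (@continuous_cos R)).
have -> : - sin c * (a + h - a) + h * sin a = h * (sin a - sin c) by ring.
rewrite normrM ger0_norm // expr2 ler_wpM2l //; apply: le_trans (sin_lip _ _) _.
by move: ca; rewrite in_itv /= => /andP[c1 c2]; rewrite ler_norml; lra.
Qed.

Lemma sin_taylor (a h : R) : `|sin (a + h) - sin a - h * cos a| <= h ^+ 2.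
Proof.
have := cos_taylor (a - pi / 2) h.
have -> : a - pi / 2 + h = a + h - pi / 2 by ring.
by rewrite !cosBpihalf sinBpihalf mulrN.
Qed.

End Trigonometry.

(** * Matrix limits and Laurent series *)

Section Limits.
Context {R : realType}.
Local Notation C := (R[i]).
Local Notation Re := (@complex.Re R).
Local Notation Im := (@complex.Im R).
Local Open Scope classical_set_scope.

Lemma squeeze0 {T : Type} {F : set_system T} {FF : Filter F} (f g : T -> R) :
  g @ F --> (0 : R) -> (\forall a \near F, 0 <= f a <= g a) -> f @ F --> (0 : R).
Proof. by move=> h fg; apply: (squeeze_cvgr fg _ h); apply: cvg_cst. Qed.

Lemma cvg_sumr {T : Type} {F : set_system T} {FF : Filter F} (I : Type) (s : seq I)
    (f : I -> T -> R) (l : I -> R) : (forall i, f i @ F --> l i) ->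
  (fun t => \sum_(i <- s) f i t) @ F --> \sum_(i <- s) l i.
Proof.
move=> h; elim: s => [|i s IH].
  rewrite big_nil; have -> : (fun t => \sum_(i <- [::]) f i t) = cst 0.
    by apply/funext => t; rewrite big_nil.
  exact: cvg_cst.
rewrite big_cons; have -> : (fun t => \sum_(j <- i :: s) f j t) =
  (fun t => f i t + \sum_(j <- s) f j t) by apply/funext => t; rewrite big_cons.
exact: cvgD.
Qed.

Lemma mxcvgP p q (u : nat -> 'M[C]_(p, q)) l :
  mxcvg u l <-> fro (u n - l) @[n --> \oo] --> (0 : R).
Proof.
split => [h|h i j].
  have h2 : (fun n => \sum_i \sum_j (`|Re (u n i j) - Re (l i j)| + `|Im (u n i j) - Im (l i j)|))
      @ \oo --> (\sum_(i < p) \sum_(j < q) (`|Re (l i j) - Re (l i j)| + `|Im (l i j) - Im (l i j)|)).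
    apply: cvg_sumr => i; apply: cvg_sumr => j; have [h1 h2] := h i j.
    by apply: cvgD; apply: cvg_norm; apply: cvgB => //; apply: cvg_cst.
  have z : \sum_(i < p) \sum_(j < q) (`|Re (l i j) - Re (l i j)| + `|Im (l i j) - Im (l i j)|) = 0.
    by rewrite big1 // => i _; rewrite big1 // => j _; rewrite !subrr normr0 addr0.
  rewrite z in h2; apply: (squeeze0 h2); near=> n; rewrite fro_ge0 /=; apply: le_trans (fro_le_sum _) _.
  apply: ler_sum => i _; apply: ler_sum => j _; rewrite !mxE.
  by apply: le_trans (cmod_le _) _; rewrite ReD ImD ReN ImN.
split; apply/cvgrPdist_le => e e0.
  have /cvgrPdist_le /(_ e e0) := h; apply: filterS => n; rewrite sub0r normrN.
  apply: le_trans; rewrite (ger0_norm (fro_ge0 _)) distrC -ReN -ReD.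
  apply: le_trans (normRe_le _) _.
  by have := cmod_le_fro (u n - l) i j; rewrite !mxE.
have /cvgrPdist_le /(_ e e0) := h; apply: filterS => n; rewrite sub0r normrN.
apply: le_trans; rewrite (ger0_norm (fro_ge0 _)) distrC -ImN -ImD.
apply: le_trans (normIm_le _) _.
by have := cmod_le_fro (u n - l) i j; rewrite !mxE.
Unshelve. all: by end_near. Qed.

Lemma mxcvg_lim p q (u : nat -> 'M[C]_(p, q)) l : mxcvg u l -> mxlim u = l.
Proof.
move=> h; apply/matrixP => i j; rewrite mxE; have [h1 h2] := h i j.
by apply: complex_eq => /=; apply: cvg_lim.
Qed.

(** Limits are taken along real w > 0 only. This ray determines all Laurent coefficients, and on the
    real axis W^0 and U^0 are real trigonometric combinations of fixed matrices. *)
Definition lim0 p q (H : R -> 'M[C]_(p, q)) (L : 'M[C]_(p, q)) : Prop :=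
  fro (H w - L) @[w --> 0^'+] --> (0 : R).

Section Lim0.
Variables p q : nat.
Implicit Types H K : R -> 'M[C]_(p, q).

Lemma lim0_cst (A : 'M[C]_(p, q)) : lim0 (fun=> A) A.
Proof. by rewrite /lim0 subrr fro0; apply: cvg_cst. Qed.

Lemma lim0_near H K L : (\forall w \near 0^'+, H w = K w) -> lim0 H L -> lim0 K L.
Proof.
by move=> h; apply: cvg_trans; apply: near_eq_cvg; apply: filterS h => w ->.
Qed.

Lemma lim0_uniq H L L' : lim0 H L -> lim0 H L' -> L = L'.
Proof.
move=> h h'; apply/eqP; rewrite -subr_eq0; apply/eqP/fro_le0.
have h2 : fro (H w - L) + fro (H w - L') @[w --> 0^'+] --> (0 + 0 : R) by exact: cvgD h h'.
rewrite addr0 in h2.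
apply: (@cvgr_to_ge _ _ _ _ _ _ _ h2).
near=> w; have -> : L - L' = (H w - L') - (H w - L) by rewrite opprB [RHS]addrC addrA subrK.
by apply: le_trans (froB _ _) _; rewrite addrC.
Unshelve. all: by end_near. Qed.

Lemma lim0D H K L M : lim0 H L -> lim0 K M -> lim0 (fun w => H w + K w) (L + M).
Proof.
move=> h k.
have s : fro (H w - L) + fro (K w - M) @[w --> 0^'+] --> (0 + 0 : R) by exact: cvgD h k.
rewrite addr0 in s.
apply: (squeeze0 s); near=> w.
by rewrite fro_ge0 /= opprD addrACA froD.
Unshelve. all: by end_near. Qed.

Lemma lim0N H L : lim0 H L -> lim0 (fun w => - H w) (- L).
Proof.
by rewrite /lim0; apply: cvg_trans; apply: near_eq_cvg; near=> w; rewrite -opprD froN.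
Unshelve. all: by end_near. Qed.

Lemma lim0Z (f : R -> R) (l : R) H L : f w @[w --> 0^'+] --> l -> lim0 H L ->
  lim0 (fun w => (f w)%:C *: H w) (l%:C *: L).
Proof.
move=> hf h.
have s : `|f w| * fro (H w - L) + `|f w - l| * fro L @[w --> 0^'+] -->
    `|l| * 0 + `|l - l| * fro L.
  apply: cvgD; apply: cvgM => //; [exact: cvg_norm|apply: cvg_norm|exact: cvg_cst].
  by apply: cvgB => //; apply: cvg_cst.
rewrite mulr0 add0r subrr normr0 mul0r in s.
apply: (squeeze0 s); near=> w.
rewrite fro_ge0 /= -!froZR; apply: le_trans (froD _ _).
by rewrite scalerBr rmorphB scalerBl addrA subrK.
Unshelve. all: by end_near. Qed.
End Lim0.

Lemma lim0M p q s (H : R -> 'M[C]_(p, q)) (K : R -> 'M[C]_(q, s)) L M :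
  lim0 H L -> lim0 K M -> lim0 (fun w => H w *m K w) (L *m M).
Proof.
move=> h k.
have z : fro (H w - L) * (fro (K w - M) + fro M) + fro L * fro (K w - M)
   @[w --> 0^'+] --> 0 * (0 + fro M) + fro L * 0.
  by apply: cvgD; apply: cvgM => //; [apply: cvgD => //|]; apply: cvg_cst.
rewrite mul0r mulr0 addr0 in z.
apply: (squeeze0 z); near=> w.
rewrite fro_ge0 /=.
have -> : H w *m K w - L *m M = (H w - L) *m K w + L *m (K w - M).
  by rewrite mulmxBl mulmxBr addrA subrK.
apply: le_trans (froD _ _) _; apply: lerD; apply: le_trans (froM _ _) _ => //.
rewrite ler_wpM2l ?fro_ge0 //; apply: le_trans (froD _ _).
by rewrite subrK.
Unshelve. all: by end_near. Qed.

Lemma lim0_comp p q (H : R -> 'M[C]_(p, q)) L (g : R -> R) : lim0 H L ->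
  g s @[s --> 0^'+] --> 0^'+ -> lim0 (fun s => H (g s)) L.
Proof. by move=> h hg; apply: (cvg_comp _ _ hg h). Qed.

Lemma lim0_neq0 p q (H : R -> 'M[C]_(p, q)) L : lim0 H L -> L != 0 ->
  \forall w \near 0^'+, H w != 0.
Proof.
move=> h L0; have Lp : 0 < fro L.
  by rewrite lt_def fro_ge0 andbT; apply: contra_neq L0; apply: fro_eq0.
have /cvgrPdist_lt /(_ _ Lp) := h; apply: filterS => w; rewrite sub0r normrN.
rewrite ger0_norm ?fro_ge0 //; apply: contraTneq => ->.
by rewrite sub0r froN ltxx.
Qed.

(* Laurent coefficients are recovered from values on the real half line: [h]
   is the sum of the series with coefficients [c] and [ptail c h j] is the sum
   of the series with coefficients [c (j + k)]. *)
Section PowerSeries.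
Variables p q : nat.
Implicit Types (c : nat -> 'M[C]_(p, q)) (h : R -> 'M[C]_(p, q)).

Definition psum c h (e : R) := forall w, 0 < w < e ->
  mxcvg (fun M => \sum_(k < M) w%:C ^+ k *: c k) (h w).

Fixpoint ptail c h (j : nat) : R -> 'M[C]_(p, q) :=
  if j is i.+1 then fun w => (w^-1)%:C *: (ptail c h i w - c i) else h.

Lemma geom_sum_le2 (a : R) n : 0 <= a <= 1 / 2 -> \sum_(k < n) a ^+ k <= 2.
Proof.
move=> /andP[a0 a1]; elim: n => [|n IH]; first by rewrite big_ord0.
rewrite big_ord_recl expr0 /=.
have -> : \sum_(i < n) a ^+ (bump 0 i) = a * \sum_(i < n) a ^+ i.
  by rewrite mulr_sumr; apply: eq_bigr => i _; rewrite -exprS.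
have s0 : 0 <= \sum_(i < n) a ^+ i by apply: sumr_ge0 => ? _; apply: exprn_ge0.
nra.
Qed.

Lemma psum_bounded c h e : 0 < e -> psum c h e ->
  exists2 B, 0 <= B & forall k, fro ((e / 2)%:C ^+ k *: c k) <= B.
Proof.
move=> e0 he; have he2 : 0 < e / 2 < e by lra.
have /mxcvgP cv := he _ he2.
have [B [_ hB]] := cvg_seq_bounded (cvgP _ cv).
have {hB} hB n : fro (\sum_(k < n) (e / 2)%:C ^+ k *: c k - h (e / 2)) <= `|B| + 1.
  have := hB (`|B| + 1); rewrite (le_lt_trans (ler_norm B)) ?ltrDl // => /(_ isT n I) /=.
  by rewrite ger0_norm ?fro_ge0.
exists ((`|B| + 1) + (`|B| + 1)) => [|k]; first by rewrite !addr_ge0.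
have -> : (e / 2)%:C ^+ k *: c k = (\sum_(k < k.+1) (e / 2)%:C ^+ k *: c k - h (e / 2)) -
   (\sum_(k < k) (e / 2)%:C ^+ k *: c k - h (e / 2)).
  by rewrite big_ord_recr /= opprB addrA subrK addrAC subrr add0r.
by apply: le_trans (froB _ _) _; apply: lerD.
Qed.

(** The terms at e/2 are bounded by some B, so for w < e/4 the part of the series from k = 1 on is
    dominated by a geometric series of ratio 2w/e <= 1/2; summing it gives [B * (w * (4 / e))]. *)
Lemma psum_lim c h e : 0 < e -> psum c h e -> lim0 h (c 0%N).
Proof.
move=> e0 he; have [B B0 hB] := psum_bounded e0 he.
have s : B * (w * (4 / e)) @[w --> 0^'+] --> B * (0 * (4 / e)).
  apply: cvgM; first exact: cvg_cst.
  apply: cvgM; last exact: cvg_cst.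
  exact: cvg_at_right_filter.
rewrite mul0r mulr0 in s.
apply: (squeeze0 s); near=> w; rewrite fro_ge0 /=.
have w0 : 0 < w by near: w; apply: nbhs_right_gt.
have we : w < e / 4 by near: w; apply: nbhs_right_lt; rewrite divr_gt0.
have wlt : 0 < w < e by rewrite w0 /=; lra.
have /mxcvgP cv := he _ wlt.
have cv2 : fro (\sum_(k < n) w%:C ^+ k *: c k - h w) + B * (w * (4 / e)) @[n --> \oo] -->
   0 + B * (w * (4 / e)) by apply: cvgD => //; apply: cvg_cst.
rewrite add0r in cv2; apply: (cvgr_to_ge cv2).
near=> n; have n0 : (0 < n)%N by near: n; exists 1%N.
rewrite -(prednK n0); set k0 := n.-1.
have -> : h w - c 0%N = (\sum_(k < k0.+1) w%:C ^+ k *: c k - c 0%N) -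
    (\sum_(k < k0.+1) w%:C ^+ k *: c k - h w).
  by rewrite opprB [RHS]addrC addrA subrK.
apply: le_trans (froB _ _) _; rewrite addrC lerD2l.
rewrite big_ord_recl expr0 scale1r addrAC subrr add0r.
apply: le_trans (fro_sum _ _ _) _.
have a0 : 0 <= w / (e / 2) <= 1 / 2.
  have e20 : 0 < e / 2 by lra.
  by rewrite divr_ge0 ?(ltW w0) ?(ltW e20) //= ler_pdivrMr //; lra.
apply: le_trans (_ : \sum_(k < k0) B * (w / (e / 2)) * (w / (e / 2)) ^+ k <= _).
  apply: ler_sum => k _; rewrite -mulrA -exprS lift0.
  have -> : w%:C ^+ k.+1 *: c k.+1 =
     ((w / (e / 2)) ^+ k.+1)%:C *: ((e / 2)%:C ^+ k.+1 *: c k.+1).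
    rewrite scalerA -!rmorphXn -rmorphM -exprMn divfK //.
    by rewrite gt_eqF // divr_gt0.
  rewrite froZR ger0_norm; last by apply: exprn_ge0; case/andP: a0.
  by rewrite mulrC ler_wpM2r // exprn_ge0 //; case/andP: a0.
rewrite -mulr_sumr; apply: le_trans (ler_wpM2l _ (geom_sum_le2 k0 a0)) _.
  by rewrite mulr_ge0 //; case/andP: a0.
rewrite le_eqVlt; apply/orP; left; apply/eqP; field; by rewrite gt_eqF.
Unshelve. all: by end_near. Qed.

Lemma psum_tail c h e j : psum c h e ->
  psum (fun k => c (j + k)%N) (ptail c h j) e.
Proof.
move=> he; elim: j => [|j IH] //= w we; apply/mxcvgP.
have /mxcvgP cv := IH _ we; have w0 : w != 0 by rewrite gt_eqF //; case/andP: we.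
have cv2 : `|w^-1| * fro (\sum_(k < n.+1) w%:C ^+ k *: c (j + k)%N - ptail c h j w)
    @[n --> \oo] --> `|w^-1| * 0.
  by apply: cvgM; [apply: cvg_cst|rewrite -cvg_shiftS in cv].
rewrite mulr0 in cv2; apply: cvg_trans cv2; apply: near_eq_cvg; near=> n.
rewrite -froZR; congr fro.
have -> : \sum_(k < n.+1) w%:C ^+ k *: c (j + k)%N =
    c j + w%:C *: \sum_(k < n) w%:C ^+ k *: c (j.+1 + k)%N.
  rewrite big_ord_recl expr0 scale1r addn0 scaler_sumr; congr (_ + _).
  by apply: eq_bigr => k _; rewrite scalerA lift0 addSnnS exprS.
set S := \sum_(k < n) _; rewrite !scalerBr scalerDr scalerA -rmorphM mulVf //.
by rewrite scale1r opprB addrCA [in RHS]addrA.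
Unshelve. all: by end_near. Qed.

Lemma ptail_lim c h e j : 0 < e -> psum c h e -> lim0 (ptail c h j) (c j).
Proof.
by move=> e0 hp; have := @psum_lim _ _ e e0 (@psum_tail c h e j hp); rewrite addn0.
Qed.

Lemma ptail_eq c h j w : w != 0 -> (forall k, (k < j)%N -> c k = 0) ->
  h w = (w ^+ j)%:C *: ptail c h j w.
Proof.
move=> w0; elim: j => [|j IH] hc /=; first by rewrite expr0 scale1r.
rewrite (hc j) // subr0 scalerA -rmorphM exprSr mulfK //.
by apply: IH => k kj; apply: hc; apply: ltnW.
Qed.

Lemma ptailS c h j w : w != 0 ->
  ptail c h j w = c j + w%:C *: ptail c h j.+1 w.
Proof. by move=> w0; rewrite /= scalerA -rmorphM divff // scale1r addrC subrK. Qed.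

End PowerSeries.

(** The Laurent series is restricted to the ray t + w. The pole has order at most N + 1, so the
    residue is the coefficient number N of w^(N+1) F. *)
Lemma is_residue_psum n (F : C -> 'M[C]_n) (t : R) A : is_residue F t%:C A ->
  exists N c e, [/\ 0 < e, c N = A &
    psum c (fun w => (w ^+ N.+1)%:C *: F (t + w)%:C) e].
Proof.
case=> N [c [e [e0 cN hc]]]; exists N, c, e; split=> // w we.
have tw : (t + w)%:C - t%:C = w%:C by rewrite -rmorphB addrAC subrr add0r.
have := hc (t + w)%:C; rewrite tw cmodR ger0_norm; last by rewrite ltW //; case/andP: we.
by move=> /(_ we); rewrite rmorphXn.
Qed.

End Limits.

(** * The matrix function W^0 and its residues *)

Section ModelProblem.
Context {R : realType}.
Local Notation C := (R[i]).
Local Notation Re := (@complex.Re R).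
Local Notation Im := (@complex.Im R).
Local Open Scope classical_set_scope.

Section Projection.
Variables (m : nat) (T : 'M[C]_m).
Hypothesis hT : orth_proj T.

Lemma projTT : T *m T = T. Proof. by case: hT. Qed.
Lemma projT_adj : adjmx T = T. Proof. by case: hT. Qed.
Lemma projTS : T *m perp T = 0. Proof. by rewrite mulmxBr mulmx1 projTT subrr. Qed.
Lemma projST : perp T *m T = 0. Proof. by rewrite mulmxBl mul1mx projTT subrr. Qed.
Lemma projSS : perp T *m perp T = perp T.
Proof. by rewrite {1}/perp mulmxBl mul1mx projTS subr0. Qed.
Lemma projS_adj : adjmx (perp T) = perp T.
Proof. by rewrite adjmxB adjmx1 projT_adj. Qed.
Lemma projD : T + perp T = 1%:M. Proof. by rewrite addrC subrK. Qed.
End Projection.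

Variables (m : nat) (T1 T2 : 'M[C]_m).
Hypotheses (hT1 : orth_proj T1) (hT2 : orth_proj T2).
Local Notation S1 := (perp T1).
Local Notation S2 := (perp T2).

(* The pairs of complementary projections enter only through these equations. *)
Section Algebra.
Variables (t1 s1 t2 s2 : 'M[C]_m).
Hypotheses (tt1 : t1 *m t1 = t1) (ts1 : t1 *m s1 = 0) (st1 : s1 *m t1 = 0).
Hypotheses (ss1 : s1 *m s1 = s1) (d1 : t1 + s1 = 1%:M).
Hypotheses (tt2 : t2 *m t2 = t2) (ts2 : t2 *m s2 = 0) (st2 : s2 *m t2 = 0).
Hypotheses (ss2 : s2 *m s2 = s2) (d2 : t2 + s2 = 1%:M).

Let sandwich (a b c d : 'M[C]_m) : a *m b *m (c *m d) = a *m (b *m c) *m d.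
Proof. by rewrite !mulmxA. Qed.
(** Eliminates s2 in favour of t2 inside triple products; what remains is linear in a few monomials
    and is closed entrywise by [ring]. *)
Let split2 (a b : 'M[C]_m) : a *m s2 *m b = a *m b - a *m t2 *m b.
Proof. by rewrite -[in X in X - _](mulmx1 a) -d2 mulmxDr mulmxDl addrC addKr. Qed.

Lemma alg_PP_QQ : (t1 *m t2 + s1 *m s2) *m (t2 *m t1 + s2 *m s1) +
  (s1 *m t2 - t1 *m s2) *m (t2 *m s1 - s2 *m t1) = 1%:M.
Proof.
rewrite !(mulmxDl, mulmxDr) !(mulNmx, mulmxN) !sandwich tt2 ts2 st2 ss2.
rewrite !(mulmx0, mul0mx) !split2 tt1 ss1 -d1.
move: (t1 *m t2 *m t1) (s1 *m t2 *m s1) => a b.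
by apply/matrixP => i j; rewrite !mxE; ring.
Qed.

Lemma alg_PQ_QP : (t1 *m t2 + s1 *m s2) *m (t2 *m s1 - s2 *m t1) =
  (s1 *m t2 - t1 *m s2) *m (t2 *m t1 + s2 *m s1).
Proof.
rewrite !(mulmxDl, mulmxDr) !(mulNmx, mulmxN) !sandwich tt2 ts2 st2 ss2.
rewrite !(mulmx0, mul0mx) !split2 ts1 st1.
move: (t1 *m t2 *m s1) (s1 *m t2 *m t1) => a b.
by apply/matrixP => i j; rewrite !mxE; ring.
Qed.

Let PS : (t1 *m t2 + s1 *m s2) *m (t2 - s2) = t1 *m t2 - s1 *m s2.
Proof.
rewrite mulmxBr !mulmxDl -!mulmxA tt2 ts2 st2 ss2 !mulmx0.
by rewrite addr0 add0r.
Qed.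
Let QS : (s1 *m t2 - t1 *m s2) *m (t2 - s2) = s1 *m t2 + t1 *m s2.
Proof.
rewrite mulmxBr !mulmxBl -!mulmxA tt2 ts2 st2 ss2 !mulmx0.
by rewrite subr0 sub0r opprK.
Qed.

(** The reflection t2 - s2 is carried to t1 - s1. This handles the sums of frequencies in Gram
    matrices, where T1 - T1^perp stands between two kernel projections. *)
Lemma alg_sigma1 : (t1 *m t2 + s1 *m s2) *m (t2 - s2) *m (t2 *m t1 + s2 *m s1) -
  (s1 *m t2 - t1 *m s2) *m (t2 - s2) *m (t2 *m s1 - s2 *m t1) = t1 - s1.
Proof.
rewrite PS QS !(mulmxDl, mulmxDr) !(mulNmx, mulmxN) !sandwich tt2 ts2 st2 ss2.
rewrite !(mulmx0, mul0mx) !split2 tt1 ss1.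
move: (t1 *m t2 *m t1) (s1 *m t2 *m s1) => a b.
by apply/matrixP => i j; rewrite !mxE; ring.
Qed.

Lemma alg_sigma2 : (t1 *m t2 + s1 *m s2) *m (t2 - s2) *m (t2 *m s1 - s2 *m t1) +
  (s1 *m t2 - t1 *m s2) *m (t2 - s2) *m (t2 *m t1 + s2 *m s1) = 0.
Proof.
rewrite PS QS !(mulmxDl, mulmxDr) !(mulNmx, mulmxN) !sandwich tt2 ts2 st2 ss2.
rewrite !(mulmx0, mul0mx) !split2 ts1 st1.
move: (t1 *m t2 *m s1) (s1 *m t2 *m t1) => a b.
by apply/matrixP => i j; rewrite !mxE; ring.
Qed.

Lemma alg_UU_WW (P Q P' Q' : 'M[C]_m) (c s : C) : c * c + s * s = 1 ->
  P' *m P + Q' *m Q = 1%:M -> P' *m Q = Q' *m P ->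
  (c *: P' + s *: Q') *m (c *: P + s *: Q) +
  (s *: P' - c *: Q') *m (s *: P - c *: Q) = 1%:M.
Proof.
move=> cs h1 h2; rewrite !(mulmxDl, mulmxDr) !(mulNmx, mulmxN).
rewrite -!(scalemxAl, scalemxAr) !scalerA h2.
have -> : 1%:M = (c * c + s * s) *: 1%:M :> 'M[C]_m by rewrite cs scale1r.
rewrite -h1.
move: (P' *m P) (Q' *m Q) (Q' *m P) => a b d.
by apply/matrixP => i j; rewrite !mxE; ring.
Qed.

Lemma alg_UW_WU (P Q P' Q' : 'M[C]_m) (c s : C) : P' *m Q = Q' *m P ->
  (c *: P' + s *: Q') *m (s *: P - c *: Q) =
  (s *: P' - c *: Q') *m (c *: P + s *: Q).
Proof.
move=> h2; rewrite !(mulmxDl, mulmxDr) !(mulNmx, mulmxN).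
rewrite -!(scalemxAl, scalemxAr) !scalerA h2.
move: (P' *m P) (Q' *m Q) (Q' *m P) => a b d.
by apply/matrixP => i j; rewrite !mxE; ring.
Qed.
End Algebra.

(** P and [Qm] act as a matrix cosine and sine of an angle between the two boundary conditions: W^0
    plays the role of the sine, and U^0 of the cosine, of rho pi minus that angle. *)
Definition Pm : 'M[C]_m := T2 *m T1 + S2 *m S1.
Definition Qm : 'M[C]_m := T2 *m S1 - S2 *m T1.
Definition sigma1 : 'M[C]_m := T1 - S1.
Definition sigma2 : 'M[C]_m := T2 - S2.

Lemma adjPm : adjmx Pm = T1 *m T2 + S1 *m S2.
Proof. by rewrite adjmxD !adjmxM (projT_adj hT1) (projT_adj hT2) (projS_adj hT1) (projS_adj hT2). Qed.
Lemma adjQm : adjmx Qm = S1 *m T2 - T1 *m S2.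
Proof. by rewrite adjmxB !adjmxM (projT_adj hT1) (projT_adj hT2) (projS_adj hT1) (projS_adj hT2). Qed.

Lemma PP_QQ : adjmx Pm *m Pm + adjmx Qm *m Qm = 1%:M.
Proof.
rewrite adjPm adjQm; apply: alg_PP_QQ;
  by [exact: projTT|exact: projTS|exact: projST|exact: projSS|exact: projD].
Qed.
Lemma PQ_QP : adjmx Pm *m Qm = adjmx Qm *m Pm.
Proof.
rewrite adjPm adjQm; apply: alg_PQ_QP;
  by [exact: projTT|exact: projTS|exact: projST|exact: projSS|exact: projD].
Qed.
Lemma sigma1E : adjmx Pm *m sigma2 *m Pm - adjmx Qm *m sigma2 *m Qm = sigma1.
Proof.
rewrite adjPm adjQm; apply: alg_sigma1;
  by [exact: projTT|exact: projTS|exact: projST|exact: projSS|exact: projD].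
Qed.
Lemma sigma2_PQ : adjmx Pm *m sigma2 *m Qm + adjmx Qm *m sigma2 *m Pm = 0.
Proof.
rewrite adjPm adjQm; apply: alg_sigma2;
  by [exact: projTT|exact: projTS|exact: projST|exact: projSS|exact: projD].
Qed.

Definition Wr (rho : R) : 'M[C]_m :=
  (sin (rho * pi))%:C *: Pm - (cos (rho * pi))%:C *: Qm.
Definition Ur (rho : R) : 'M[C]_m :=
  (cos (rho * pi))%:C *: Pm + (sin (rho * pi))%:C *: Qm.

Lemma cexp_ci (y : R) : cexp (ci * y%:C) = cos y +i* sin y.
Proof.
rewrite /cexp /ci ReM ImM /= !(mul0r, mul1r, mulr0, subr0, addr0, add0r) expR0.
by apply: complex_eq; rewrite /= !(mul0r, mul1r, subr0, addr0).
Qed.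

Lemma cexpN_ci (y : R) : cexp (- (ci * y%:C)) = cos y -i* sin y.
Proof. by rewrite -mulrN -rmorphN cexp_ci cosN sinN. Qed.

Lemma ccosR (y : R) : ccos y%:C = (cos y)%:C.
Proof.
rewrite /ccos cexp_ci cexpN_ci; have e2 : (2 : C) != 0 by rewrite pnatr_eq0.
apply: (mulIf e2); rewrite divfK // -[2]/(1 + 1) mulrDr !mulr1.
by apply: complex_eq; rewrite /= ?subrr ?addr0.
Qed.

Lemma csinR (y : R) : csin y%:C = (sin y)%:C.
Proof.
rewrite /csin cexp_ci cexpN_ci; have e2 : (2 * ci : C) != 0.
  by rewrite mulf_neq0 ?pnatr_eq0 // eq_complex /= oner_eq0 andbF.
apply: (mulIf e2); rewrite divfK // -[2]/(1 + 1) mulrDl !mulrDr !mul1r /ci.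
by apply: complex_eq; rewrite /=; ring.
Qed.

Lemma W0R (rho : R) : W0 T1 T2 rho%:C = Wr rho.
Proof.
rewrite /W0 -rmorphM csinR ccosR /Wr /Pm /Qm; congr (_ + _).
by rewrite -scalerN opprB.
Qed.

Lemma U0R (rho : R) : U0 T1 T2 rho%:C = Ur rho.
Proof. by rewrite /U0 -rmorphM csinR ccosR. Qed.

(** Addition theorem: a shift of the argument rotates the pair (W^0, U^0). In particular pi U^0 is
    the derivative of W^0. *)
Lemma WrD (a w : R) : Wr (a + w) =
  (cos (w * pi))%:C *: Wr a + (sin (w * pi))%:C *: Ur a.
Proof.
rewrite /Wr /Ur mulrDl sinD cosD; move: Pm Qm => P Q; apply/matrixP => i j; rewrite !mxE.
by rewrite !(rmorphD, rmorphN, rmorphM) /=; ring.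
Qed.

Lemma UrD (a w : R) : Ur (a + w) =
  (cos (w * pi))%:C *: Ur a - (sin (w * pi))%:C *: Wr a.
Proof.
rewrite /Wr /Ur mulrDl sinD cosD; move: Pm Qm => P Q; apply/matrixP => i j; rewrite !mxE.
by rewrite !(rmorphD, rmorphN, rmorphM) /=; ring.
Qed.

Lemma cos_sin_natpi n : sin (n%:R * pi : R) = 0 /\ cos (n%:R * pi : R) = (-1) ^+ n.
Proof.
elim: n => [|n [IHs IHc]]; first by rewrite mul0r sin0 cos0.
rewrite -natr1 mulrDl mul1r sinDpi cosDpi IHs IHc oppr0 exprS.
by rewrite mulN1r.
Qed.

(** Integer shifts only change the sign, so the kernel at n + r_k is the kernel at r_k. *)
Lemma WrDn (a : R) n : Wr (n%:R + a) = ((-1) ^+ n)%:C *: Wr a.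
Proof.
by rewrite addrC WrD; case: (cos_sin_natpi n) => -> ->; rewrite scale0r addr0.
Qed.
Lemma UrDn (a : R) n : Ur (n%:R + a) = ((-1) ^+ n)%:C *: Ur a.
Proof.
by rewrite addrC UrD; case: (cos_sin_natpi n) => -> ->; rewrite scale0r subr0.
Qed.

Lemma UU_WW a : adjmx (Ur a) *m Ur a + adjmx (Wr a) *m Wr a = 1%:M.
Proof.
rewrite /Ur /Wr adjmxB adjmxD !adjmxZR; apply: alg_UU_WW.
- by rewrite -!rmorphM -rmorphD -!expr2 cos2Dsin2.
- exact: PP_QQ.
- exact: PQ_QP.
Qed.

Lemma UW_WU a : adjmx (Ur a) *m Wr a = adjmx (Wr a) *m Ur a.
Proof.
by rewrite /Ur /Wr adjmxB adjmxD !adjmxZR; apply: alg_UW_WU; apply: PQ_QP.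
Qed.

End ModelProblem.

(** * Laurent coefficients of the inverse of W^0 times U^0 *)

Section Residue.
Context {R : realType}.
Local Notation C := (R[i]).
Local Notation Re := (@complex.Re R).
Local Notation Im := (@complex.Im R).
Local Open Scope classical_set_scope.

Lemma near0_pos : \forall w \near (0 : R)^'+, 0 < w.
Proof. exact: nbhs_right_gt. Qed.

Lemma cvg0_id : w @[w --> (0 : R)^'+] --> (0 : R).
Proof. exact: cvg_at_right_filter. Qed.

Lemma cvg0_expS n : w ^+ n.+1 @[w --> (0 : R)^'+] --> (0 : R).
Proof.
elim: n => [|n IH]; first by under eq_fun do rewrite expr1; apply: cvg0_id.
under eq_fun do rewrite exprS.
have h : w * w ^+ n.+1 @[w --> (0 : R)^'+] --> (0 * 0 : R) by apply: cvgM; [apply: cvg0_id|].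
by rewrite mul0r in h.
Qed.

Lemma cvg0_cospi : cos (w * pi) @[w --> (0 : R)^'+] --> (1 : R).
Proof.
have h : cos (pi * w) @[w --> (0 : R)^'+] --> (cos (pi * 0) : R).
  by apply: cvg_at_right_filter; apply: continuous_cosM.
by rewrite mulr0 cos0 in h; under eq_fun do rewrite mulrC.
Qed.

Lemma cvg0_sinpi : sin (w * pi) @[w --> (0 : R)^'+] --> (0 : R).
Proof.
have h : sin (pi * w) @[w --> (0 : R)^'+] --> (sin (pi * 0) : R).
  by apply: cvg_at_right_filter; apply: continuous_sinM.
by rewrite mulr0 sin0 in h; under eq_fun do rewrite mulrC.
Qed.

Lemma cvg0_sincpi : w^-1 * sin (w * pi) @[w --> (0 : R)^'+] --> (pi : R).
Proof.
have h : w * (pi ^+ 2 : R) @[w --> 0^'+] --> 0 * pi ^+ 2.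
  by apply: cvgM; [apply: cvg0_id|apply: cvg_cst].
rewrite mul0r in h; apply/cvgrPdist_le => e e0.
have /cvgrPdist_le /(_ e e0) := h; apply: filterS2 near0_pos => w w0.
rewrite sub0r normrN; apply: le_trans; rewrite [leRHS]ger0_norm; last first.
  by rewrite mulr_ge0 ?sqr_ge0 // ltW.
have := sin_taylor 0 (w * pi); rewrite add0r sin0 subr0 cos0 mulr1 => h2.
have -> : pi - w^-1 * sin (w * pi) = - w^-1 * (sin (w * pi) - w * pi).
  by field; rewrite gt_eqF.
have iw0 : 0 < w^-1 by rewrite invr_gt0.
rewrite normrM normrN (ger0_norm (ltW iw0)) -(ler_pM2l w0) mulrA divff ?gt_eqF //.
by rewrite mul1r; apply: le_trans h2 _; rewrite exprMn [w ^+ 2]expr2 -mulrA.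
Qed.

Lemma cvg0_at_right (g : R -> R) : g s @[s --> 0^'+] --> (0 : R) ->
  (\forall s \near 0^'+, 0 < g s) -> g s @[s --> 0^'+] --> (0 : R)^'+.
Proof.
by move=> hg g0 P hP; have := hg _ hP; apply: filterS2 g0 => s /= g0 /(_ g0).
Qed.

Section Projector.
Variables (m : nat) (T1 T2 : 'M[C]_m).
Hypotheses (hT1 : orth_proj T1) (hT2 : orth_proj T2).
Local Notation W := (Wr T1 T2).
Local Notation U := (Ur T1 T2).

Lemma lim0_W a : lim0 (fun w => W (a + w)) (W a).
Proof.
rewrite -[X in lim0 _ X](_ : 1%:C *: W a + 0%:C *: U a = W a); last first.
  by rewrite scale1r scale0r addr0.
apply: (@lim0_near _ _ _ (fun w => (cos (w * pi))%:C *: W a + (sin (w * pi))%:C *: U a)).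
  by near=> w; rewrite WrD.
by apply: lim0D; apply: lim0Z; [apply: cvg0_cospi|apply: lim0_cst|apply: cvg0_sinpi|apply: lim0_cst].
Unshelve. all: by end_near. Qed.

Lemma lim0_U a : lim0 (fun w => U (a + w)) (U a).
Proof.
rewrite -[X in lim0 _ X](_ : 1%:C *: U a - 0%:C *: W a = U a); last first.
  by rewrite scale1r scale0r subr0.
apply: (@lim0_near _ _ _ (fun w => (cos (w * pi))%:C *: U a - (sin (w * pi))%:C *: W a)).
  by near=> w; rewrite UrD.
apply: lim0D; last apply: lim0N;
  by apply: lim0Z; [apply: cvg0_cospi || apply: cvg0_sinpi|apply: lim0_cst].
Unshelve. all: by end_near. Qed.

Section Laurent.
Variables (a e : R) (N : nat) (c : nat -> 'M[C]_m) (F : R -> 'M[C]_m).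
Hypothesis e0 : 0 < e.
Hypothesis hc : psum c (fun w => (w ^+ N.+1)%:C *: F w) e.
Hypothesis hF : \forall w \near 0^'+, W (a + w) *m F w = U (a + w).
Let h := fun w : R => (w ^+ N.+1)%:C *: F w.
Let H := ptail c h.

(** These are the coefficients of w^j and w^(j+1) in W(a + w) times the series of the c_k, which
    equals w^(N+1) U(a + w). W(a + w) is expanded by [WrD], and its first-order term pi w U(a)
    produces the second summand; the right-hand side is felt only at order N + 1. *)
Lemma laurent_step j : (j <= N)%N -> (forall k, (k < j)%N -> c k = 0) ->
  W a *m c j = 0 /\
  W a *m c j.+1 + pi%:C *: (U a *m c j) = (j == N)%:R *: U a.
Proof.
move=> jN cj0.
have eqH : \forall w \near 0^'+, W (a + w) *m H j w = (w ^+ (N - j).+1)%:C *: U (a + w).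
  apply: filterS2 near0_pos hF => w w0 Fw.
  have wn0 : w != 0 by rewrite gt_eqF.
  have := @ptail_eq _ _ _ c h j w wn0 cj0; rewrite /h => eh.
  have -> : H j w = ((w ^+ j)^-1 * w ^+ N.+1)%:C *: F w.
    by rewrite rmorphM -scalerA eh scalerA -rmorphM mulVf ?scale1r // expf_neq0.
  rewrite -scalemxAr Fw; congr (_%:C *: _).
  by rewrite -[in LHS](subnK jN) -addSn exprD mulrC mulfK // expf_neq0.
have Hj k : lim0 (H k) (c k) by exact: (@ptail_lim _ _ _ c h e).
have Wcj : W a *m c j = 0.
  apply: (lim0_uniq (lim0M (lim0_W a) (Hj j))).
  apply: (@lim0_near _ _ _ (fun w => (w ^+ (N - j).+1)%:C *: U (a + w))).
    by apply: filterS eqH => w ->.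
  by rewrite -(scale0r (U a)); apply: lim0Z; [apply: cvg0_expS|apply: lim0_U].
split=> //.
have l1 : lim0 (fun w => (cos (w * pi))%:C *: (W a *m H j.+1 w) +
    (w^-1 * sin (w * pi))%:C *: (U a *m H j w))
   (1%:C *: (W a *m c j.+1) + pi%:C *: (U a *m c j)).
  apply: lim0D; apply: lim0Z; [exact: cvg0_cospi| |exact: cvg0_sincpi|];
    by apply: lim0M; [apply: lim0_cst|].
have l2 : lim0 (fun w => (w ^+ (N - j))%:C *: U (a + w)) ((j == N)%:R%:C *: U a).
  apply: lim0Z (lim0_U a); have [->|jn] := eqVneq j N.
    by rewrite subnn; under eq_fun do rewrite expr0; apply: cvg_cst.
  have : (0 < N - j)%N by rewrite subn_gt0 ltn_neqAle jn.
  by case: (N - j)%N => // k _; apply: cvg0_expS.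
have <- : (j == N)%:R%:C *: U a = (j == N)%:R *: U a by rewrite rmorph_nat.
rewrite -[X in X + _ = _]scale1r; apply: (lim0_uniq l1); apply: lim0_near l2.
apply: filterS2 near0_pos eqH => w w0; have wn0 : w != 0 by rewrite gt_eqF.
rewrite WrD mulmxDl -!scalemxAl [X in W a *m X](ptailS c h j wn0) mulmxDr Wcj add0r.
rewrite -scalemxAr exprS rmorphM -scalerA => eq1.
apply: (scalerI (_ : w%:C != 0)); first by rewrite eq_complex /= (negbTE wn0).
rewrite -eq1 scalerDr !scalerA -!rmorphM; congr (_ + _ *: _); last first.
  by rewrite mulrA divff // mul1r.
by rewrite mulrC.
Qed.

Lemma adj_mul_eq0 (X : 'M[C]_m) : adjmx X *m X = 0 -> X = 0.
Proof.
move=> X0; apply: fro_eq0; rewrite -fro_adjmx /fro /rdot adjmxK X0.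
by rewrite raddf0 sqrtr0.
Qed.

(** On the kernel of W(a) the matrix U(a) is an isometry, and by [ker_UW] it maps this kernel into
    the orthogonal complement of the range of W(a). *)
Lemma ker_UU (V : 'M[C]_m) : W a *m V = 0 -> adjmx (U a) *m (U a *m V) = V.
Proof.
move=> WV; rewrite mulmxA -[RHS]mul1mx -(UU_WW hT1 hT2 a) mulmxDl.
by rewrite -(mulmxA (adjmx (W a))) WV mulmx0 addr0.
Qed.

Lemma ker_UW (V : 'M[C]_m) : W a *m V = 0 -> adjmx V *m adjmx (U a) *m W a = 0.
Proof.
move=> WV; rewrite -mulmxA UW_WU // mulmxA -adjmxM WV adjmx0 mul0mx.
by [].
Qed.

Lemma pi_neq0 : (pi : R)%:C != 0.
Proof. by rewrite eq_complex /= gt_eqF // pi_gt0. Qed.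

(** The pole is simple. Multiplying the second equation of [laurent_step] on the left by the adjoint
    of U(a) c_k removes the unknown c_(k+1) and leaves pi times c_k^dagger c_k equal to 0. *)
Lemma laurent_low k : (k < N)%N -> c k = 0.
Proof.
elim/ltn_ind: k => k IH kN.
have [|Wc eq1] := @laurent_step k (ltnW kN).
  by move=> l lk; apply: IH => //; apply: ltn_trans kN.
rewrite (ltn_eqF kN) scale0r in eq1.
have := congr1 (fun X => adjmx (c k) *m adjmx (U a) *m X) eq1.
rewrite mulmx0 mulmxDr mulmxA ker_UW // mul0mx add0r -scalemxAr -mulmxA ker_UU //.
by move/eqP; rewrite scaler_eq0 (negbTE pi_neq0) /= => /eqP /adj_mul_eq0.
Qed.

Lemma laurent_lim : lim0 (fun w => w%:C *: F w) (c N).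
Proof.
have HN : lim0 (H N) (c N) by exact: (@ptail_lim _ _ _ c h e).
apply: lim0_near HN; apply: filterS near0_pos => w w0.
have wn0 : w != 0 by rewrite gt_eqF.
apply: (scalerI (_ : (w ^+ N)%:C != 0)).
  by rewrite eq_complex /= expf_eq0 (negbTE wn0) !andbF.
rewrite -(@ptail_eq _ _ _ c h N w wn0 laurent_low) /h scalerA -rmorphM.
by rewrite exprSr.
Qed.

Let A := pi%:C *: c N.

(** At order N the coefficient equation is multiplied on the left by the adjoint of U(a) V, where
    W(a) V = 0. The term with W(a) disappears and V^dagger A = V^dagger remains. Taking V = A shows
    that A is selfadjoint and idempotent; a general V shows that its range is the whole kernel. *)
Lemma residue_projector : [/\ adjmx A = A, A *m A = A, W a *m A = 0 &
  forall V : 'M[C]_m, W a *m V = 0 -> A *m V = V].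
Proof.
have [Wc] := @laurent_step N (leqnn N) laurent_low; rewrite eqxx scale1r => eq1.
have WA : W a *m A = 0 by rewrite -scalemxAr Wc scaler0.
have eqA : W a *m c N.+1 + U a *m A = U a by rewrite -scalemxAr.
have UUadj (V : 'M[C]_m) : W a *m V = 0 -> adjmx V *m adjmx (U a) *m U a = adjmx V.
  by move=> WV; rewrite -[in RHS](ker_UU WV) !adjmxM adjmxK.
have VA (V : 'M[C]_m) : W a *m V = 0 -> adjmx V *m A = adjmx V.
  move=> WV; have := congr1 (fun X => adjmx V *m adjmx (U a) *m X) eqA.
  rewrite mulmxDr mulmxA (ker_UW WV) mul0mx add0r (UUadj V WV) => eqV.
  by rewrite -[RHS]eqV -[in LHS](ker_UU WA) !mulmxA.
have AA : adjmx A *m A = adjmx A by apply: VA.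
have hA : adjmx A = A.
  by rewrite -[in RHS](adjmxK A) -[in RHS]AA adjmxM adjmxK.
split; [exact: hA|by rewrite -{1}hA AA hA|exact: WA|].
by move=> V /VA /(congr1 (@adjmx R _ _)); rewrite adjmxM adjmxK hA.
Qed.

End Laurent.
End Projector.
End Residue.

(** * Weights and eigenfunctions of the model problem *)

Section Weyl.
Context {R : realType}.
Local Notation C := (R[i]).
Local Notation Re := (@complex.Re R).
Local Notation Im := (@complex.Im R).
Local Open Scope classical_set_scope.

Lemma is_derive_cosM (rho t : R) :
  is_derive t (1 : R) (fun u => cos (rho * u)) (- sin (rho * t) * rho).
Proof.
have h1 : is_derive t (1 : R) (fun u : R => rho * u) rho.
  have := @is_deriveZ _ _ _ id rho t 1 1 (is_derive_id _ _).
  by rewrite /GRing.scale /= mulr1.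
exact: (@is_derive1_comp _ (@cos R) _ t _ _ (is_derive_cos (rho * t)) h1).
Qed.

Lemma is_derive_sinM (rho t : R) :
  is_derive t (1 : R) (fun u => sin (rho * u)) (cos (rho * t) * rho).
Proof.
have h1 : is_derive t (1 : R) (fun u : R => rho * u) rho.
  have := @is_deriveZ _ _ _ id rho t 1 1 (is_derive_id _ _).
  by rewrite /GRing.scale /= mulr1.
exact: (@is_derive1_comp _ (@sin R) _ t _ _ (is_derive_sin (rho * t)) h1).
Qed.

Lemma is_derive_mul_add (f g k l : R -> R) (t df dg dk dl : R) :
  is_derive t (1 : R) f df -> is_derive t (1 : R) g dg ->
  is_derive t (1 : R) k dk -> is_derive t (1 : R) l dl ->
  is_derive t (1 : R) (fun u => f u * g u + k u * l u)
    (f t * dg + g t * df + (k t * dl + l t * dk)).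
Proof.
move=> hf hg hk hl.
exact: (@is_deriveD _ _ _ (f * g) (k * l) t 1 _ _
  (is_deriveM hf hg) (is_deriveM hk hl)).
Qed.

Lemma within_mul_add (f g k l : R -> R) (D : set R) :
  {within D, continuous f} -> continuous g ->
  {within D, continuous k} -> continuous l ->
  {within D, continuous (fun u => f u * g u + k u * l u)}.
Proof.
move=> cf cg ck cl t.
have cg' := continuous_subspaceT (A := D) cg; have cl' := continuous_subspaceT (A := D) cl.
by apply: cvgD; apply: cvgM; [apply: cf|apply: cg'|apply: ck|apply: cl'].
Qed.

(** Rotating (y, z) backwards gives two combinations with zero derivative, so they keep their
    initial values y(0) and z(0) up to pi; the rotation is then inverted. *)
Lemma ode_solution (rho : R) (y z : R -> R) : rho != 0 ->
  (forall t, 0 < t < pi -> is_derive t (1 : R) y (z t) /\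
     is_derive t (1 : R) z (- rho ^+ 2 * y t)) ->
  {within `[0, pi], continuous y} -> {within `[0, pi], continuous z} ->
  y pi = cos (rho * pi) * y 0 + rho^-1 * sin (rho * pi) * z 0 /\
  z pi = cos (rho * pi) * z 0 - rho * sin (rho * pi) * y 0.
Proof.
move=> r0 hd cy cz.
have cst0 (f : R -> R) : (forall t, 0 < t < pi -> is_derive t (1 : R) f 0) ->
    {within `[0, pi], continuous f} -> f pi = f 0.
  move=> df cf.
  have df' t : t \in `]0, pi[%R -> is_derive t (1 : R) f 0 by rewrite in_itv /=; apply: df.
  have [t _] := @MVT_segment R f (fun=> 0) 0 pi (pi_ge0 R) df' cf.
  by rewrite mul0r => /eqP; rewrite subr_eq0 => /eqP.
pose cs (c : R) (t : R) := c * cos (rho * t); pose sn (c : R) (t : R) := c * sin (rho * t).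
have dcs c t : is_derive t (1 : R) (cs c) (c * (- sin (rho * t) * rho)).
  exact: (@is_deriveZ _ _ _ _ c t 1 _ (is_derive_cosM rho t)).
have dsn c t : is_derive t (1 : R) (sn c) (c * (cos (rho * t) * rho)).
  exact: (@is_deriveZ _ _ _ _ c t 1 _ (is_derive_sinM rho t)).
have ccs c : continuous (cs c) by apply: continuousMr; [apply: continuous_cst|apply: continuous_cosM].
have csn c : continuous (sn c) by apply: continuousMr; [apply: continuous_cst|apply: continuous_sinM].
have u : y pi * cos (rho * pi) - z pi * (rho^-1 * sin (rho * pi)) = y 0.
  have : y pi * cs 1 pi + z pi * sn (- rho^-1) pi = y 0 * cs 1 0 + z 0 * sn (- rho^-1) 0.
    apply: (cst0 (fun t => y t * cs 1 t + z t * sn (- rho^-1) t)) => [t tp|].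
      have [hy hz] := hd t tp.
      have := is_derive_mul_add hy (dcs 1 t) hz (dsn (- rho^-1) t).
      rewrite (_ : _ + _ = 0) // /cs /sn.
      transitivity ((rho * rho^-1 - 1) * (rho * sin (rho * t) * y t - z t * cos (rho * t))).
        by ring.
      by rewrite divff // subrr mul0r.
    exact: within_mul_add.
  rewrite /cs /sn [rho * 0]mulr0 sin0 cos0 !mulr0 addr0 !mul1r mulr1 => <-; ring.
have v : y pi * (rho * sin (rho * pi)) + z pi * cos (rho * pi) = z 0.
  have : y pi * sn rho pi + z pi * cs 1 pi = y 0 * sn rho 0 + z 0 * cs 1 0.
    apply: (cst0 (fun t => y t * sn rho t + z t * cs 1 t)) => [t tp|].
      have [hy hz] := hd t tp.
      have := is_derive_mul_add hy (dsn rho t) hz (dcs 1 t).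
      by rewrite (_ : _ + _ = 0) // /cs /sn; ring.
    exact: within_mul_add.
  by rewrite /cs /sn [rho * 0]mulr0 sin0 cos0 !mulr0 add0r !mul1r mulr1.
have cs1 := cos2Dsin2 (rho * pi).
rewrite -u -v; move: (y pi) (z pi) (cos _) (sin _) cs1 => Y Z c s cs1.
by split; rewrite -[LHS]mulr1 -cs1; field.
Qed.

Section WeylMatrix.
Variables (m : nat) (T1 T2 : 'M[C]_m).
Hypotheses (hT1 : orth_proj T1) (hT2 : orth_proj T2).
Local Notation S1 := (perp T1).
Local Notation W := (Wr T1 T2).
Local Notation U := (Ur T1 T2).

Lemma matrix_ode_solution (rho : R) (Phi DPhi : R -> 'M[C]_m) : rho != 0 ->
  (forall x, 0 < x < pi -> mx_is_derive Phi x (DPhi x) /\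
     mx_is_derive DPhi x (- (rho ^+ 2)%:C *: Phi x)) ->
  mx_continuous_on `[0, pi] Phi -> mx_continuous_on `[0, pi] DPhi ->
  Phi pi = (cos (rho * pi))%:C *: Phi 0 + (rho^-1 * sin (rho * pi))%:C *: DPhi 0 /\
  DPhi pi = (cos (rho * pi))%:C *: DPhi 0 - (rho * sin (rho * pi))%:C *: Phi 0.
Proof.
move=> r0 hd cP cD.
have reP i j := @ode_solution rho (fun t => Re (Phi t i j)) (fun t => Re (DPhi t i j)) r0.
have imP i j := @ode_solution rho (fun t => Im (Phi t i j)) (fun t => Im (DPhi t i j)) r0.
have {}reP i j : Re (Phi pi i j) = cos (rho * pi) * Re (Phi 0 i j) + rho^-1 * sin (rho * pi) * Re (DPhi 0 i j) /\
   Re (DPhi pi i j) = cos (rho * pi) * Re (DPhi 0 i j) - rho * sin (rho * pi) * Re (Phi 0 i j).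
  apply: reP; [|by case: (cP i j)|by case: (cD i j)].
  move=> t /hd [/(_ i j) [h1 _] /(_ i j) [h2 _]]; split=> //.
  by move: h2; rewrite mxE -rmorphN ReRM.
have {}imP i j : Im (Phi pi i j) = cos (rho * pi) * Im (Phi 0 i j) + rho^-1 * sin (rho * pi) * Im (DPhi 0 i j) /\
   Im (DPhi pi i j) = cos (rho * pi) * Im (DPhi 0 i j) - rho * sin (rho * pi) * Im (Phi 0 i j).
  apply: imP; [|by case: (cP i j)|by case: (cD i j)].
  move=> t /hd [/(_ i j) [_ h1] /(_ i j) [_ h2]]; split=> //.
  by move: h2; rewrite mxE -rmorphN ImRM.
split; apply/matrixP => i j; have [r1 r2] := reP i j; have [i1 i2] := imP i j.
  by apply: complex_eq; rewrite !mxE !(ReD, ImD) !(ReRM, ImRM).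
by apply: complex_eq; rewrite !mxE !(ReD, ImD, ReN, ImN) !(ReRM, ImRM).
Qed.

Definition Trho (rho : R) : 'M[C]_m := T1 + rho%:C *: S1.

(** The condition at 0 expresses a = Phi(0) and b = Phi'(0) through M alone. The condition at pi,
    rescaled by [ri *: t2 + s2], then becomes a relation for M. Scalars and projections are abstract
    so that the entries are settled by [field]. *)
Lemma weyl_alg (t1 s1 t2 s2 M a b : 'M[C]_m) (r ri c s : C) : r * ri = 1 ->
  t1 *m t1 = t1 -> t1 *m s1 = 0 -> s1 *m t1 = 0 -> s1 *m s1 = s1 ->
  t1 + s1 = 1%:M -> t2 *m t2 = t2 -> t2 *m s2 = 0 -> s2 *m t2 = 0 -> s2 *m s2 = s2 ->
  t1 *m b - s1 *m a = 1%:M -> M = t1 *m a + s1 *m b ->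
  t2 *m (c *: b - (r * s) *: a) - s2 *m (c *: a + (ri * s) *: b) = 0 ->
  (s *: (t2 *m t1 + s2 *m s1) - c *: (t2 *m s1 - s2 *m t1)) *m (t1 *m M + ri *: (s1 *m M)) =
  (c *: (t2 *m t1 + s2 *m s1) + s *: (t2 *m s1 - s2 *m t1)) *m (ri *: t1 + s1).
Proof.
move=> rri tt1 ts1 st1 ss1 d1 tt2 ts2 st2 ss2 bc0 eM bcpi.
have tM : t1 *m M = t1 *m a by rewrite eM mulmxDr !mulmxA tt1 ts1 mul0mx addr0.
have sM : s1 *m M = s1 *m b by rewrite eM mulmxDr !mulmxA ss1 st1 mul0mx add0r.
have tb : t1 *m b = t1.
  by rewrite -[RHS]mulmx1 -bc0 mulmxBr !mulmxA tt1 ts1 mul0mx subr0.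
have sa : s1 *m a = - s1.
  by rewrite -[X in - X]mulmx1 -bc0 mulmxBr !mulmxA ss1 st1 mul0mx sub0r opprK.
have ea : a = t1 *m M - s1 by rewrite tM -sa -mulmxDl d1 mul1mx.
have eb : b = t1 + s1 *m M by rewrite sM -[in RHS]tb -mulmxDl d1 mul1mx.
have k1 : (ri *: t2 + s2) *m t2 = ri *: t2 by rewrite mulmxDl -scalemxAl tt2 st2 addr0.
have k2 : (ri *: t2 + s2) *m s2 = s2 by rewrite mulmxDl -scalemxAl ts2 ss2 scaler0 add0r.
have := congr1 (mulmx (ri *: t2 + s2)) bcpi.
rewrite mulmx0 mulmxBr !mulmxA k1 k2 -scalemxAl => e1.
pose X := t1 *m M; pose Z := s1 *m M.
have p1 : t1 *m (X + ri *: Z) = X by rewrite mulmxDr -scalemxAr !mulmxA tt1 ts1 mul0mx scaler0 addr0.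
have p2 : s1 *m (X + ri *: Z) = ri *: Z by rewrite mulmxDr -scalemxAr !mulmxA ss1 st1 mul0mx add0r.
have q1 : t1 *m (ri *: t1 + s1) = ri *: t1 by rewrite mulmxDr -scalemxAr tt1 ts1 addr0.
have q2 : s1 *m (ri *: t1 + s1) = s1 by rewrite mulmxDr -scalemxAr ss1 st1 scaler0 add0r.
rewrite -/X -/Z in ea eb *.
rewrite !(mulmxBl, mulmxDl) ?mulNmx -!scalemxAl !(mulmxBl, mulmxDl) ?mulNmx -!mulmxA p1 p2 q1 q2 -!scalemxAr.
move: e1; rewrite ea eb !(mulmxBr, mulmxDr) -!scalemxAr !(mulmxBr, mulmxDr).
move: (t2 *m t1) (t2 *m s1) (s2 *m t1) (s2 *m s1) (t2 *m X) (t2 *m Z) (s2 *m X) (s2 *m Z).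
move=> x1 x2 x3 x4 x5 x6 x7 x8 e1; apply/matrixP => i j.
have := congr1 (fun A : 'M[C]_m => A i j) e1; rewrite !mxE => e1ij.
rewrite -[LHS]addr0 -[X in _ + X = _]e1ij.
have -> : ri = r^-1.
  by apply: (@mulfI _ r); rewrite ?rri ?divff //; apply/eqP => r0; move: rri; rewrite r0 mul0r => /eqP; rewrite eq_sym oner_eq0.
field.
by apply/eqP => r0; move: rri; rewrite r0 mul0r => /eqP; rewrite eq_sym oner_eq0.
Qed.

(** Solved for [M], this is M = rho^(-1) T_rho W^(-1) U T_rho with T_rho = [Trho rho], wherever
    W(rho) is invertible. *)
Lemma weyl_eq (rho : R) (M : 'M[C]_m) : rho != 0 -> is_weyl_value T1 T2 (rho ^+ 2)%:C M ->
  W rho *m (T1 *m M + (rho^-1)%:C *: (S1 *m M)) = U rho *m ((rho^-1)%:C *: T1 + S1).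
Proof.
move=> r0 [Phi [DPhi [hd [cP cD] h0 hpi eM]]].
have [e1 e2] := matrix_ode_solution r0 hd cP cD.
rewrite e1 e2 !rmorphM in hpi.
apply: (weyl_alg (a := Phi 0) (b := DPhi 0) (r := rho%:C) _ _ _ _ _ _ _ _ _ _ h0 eM hpi);
  try by [exact: projTT|exact: projTS|exact: projST|exact: projSS|exact: projD].
by rewrite -rmorphM divff.
Qed.

Lemma TrhoV (rho : R) : rho != 0 -> (T1 + (rho^-1)%:C *: S1) *m Trho rho = 1%:M /\
  Trho rho *m (T1 + (rho^-1)%:C *: S1) = 1%:M.
Proof.
move=> r0; have e : rho%:C * (rho^-1)%:C = 1 :> C by rewrite -rmorphM divff.
have [[[t ts] st] ss] := (projTT hT1, projTS hT1, projST hT1, projSS hT1).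
split; rewrite /Trho !(mulmxDl, mulmxDr) -!(scalemxAl, scalemxAr) t ts st ss.
  by rewrite !scaler0 addr0 add0r scalerA mulrC e scale1r projD.
by rewrite !scaler0 addr0 add0r scalerA e scale1r projD.
Qed.

(** [zero_order] supplies a nonzero Taylor coefficient, so the zeros of the determinant cannot
    accumulate at [a] from the right. *)
Lemma det_near_unit (a : R) d : zero_order (fun z => \det (W0 T1 T2 z)) a%:C d ->
  \forall w \near 0^'+, W (a + w) \in unitmx.
Proof.
move=> [c [e [e0 cd cl hc]]].
pose c' k : 'M[C]_1 := (c k)%:M; pose h (w : R) : 'M[C]_1 := (\det (W (a + w)))%:M.
have hp : psum c' h e.
  move=> w we; have aw : (a + w)%:C - a%:C = w%:C by rewrite -rmorphB addrAC subrr add0r.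
  have := hc (a + w)%:C; rewrite aw cmodR ger0_norm; last by rewrite ltW //; case/andP: we.
  case/andP: (we) => _ wlt /(_ wlt); rewrite W0R /h.
  rewrite (_ : (fun M => (\sum_(k < M) w%:C ^+ k * c k)%:M) =
     (fun M => \sum_(k < M) w%:C ^+ k *: c' k)) //.
  apply/funext => n; rewrite raddf_sum; apply: eq_bigr => k _.
  by rewrite /c' scale_scalar_mx.
have c'd : c' d != 0.
  apply: contra_neq cd => /matrixP /(_ ord0 ord0); rewrite !mxE eqxx mulr1n.
  by [].
have := lim0_neq0 (@ptail_lim _ _ _ c' h e d e0 hp) c'd.
apply: filterS2 (near0_pos (R := R)) => w w0 H0.
have wn0 : w != 0 by rewrite gt_eqF.
have cl' k : (k < d)%N -> c' k = 0 by move=> /cl; rewrite /c' => ->; rewrite raddf0.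
have hE := @ptail_eq _ _ _ c' h d w wn0 cl'.
rewrite unitmxE unitfE; apply: contra_neq H0 => det0.
apply: (scalerI (_ : (w ^+ d)%:C != 0)).
  by rewrite eq_complex /= expf_eq0 (negbTE wn0) !andbF.
by rewrite -hE /h det0 scaler0 raddf0.
Qed.
End WeylMatrix.

End Weyl.

Section ModelWeights.
Context {R : realType}.
Local Notation C := (R[i]).
Local Notation Re := (@complex.Re R).
Local Notation Im := (@complex.Im R).
Local Open Scope classical_set_scope.

Section Weights.
Variables (m : nat) (T1 T2 : 'M[C]_m).
Hypotheses (hT1 : orth_proj T1) (hT2 : orth_proj T2).
Local Notation S1 := (perp T1).
Local Notation S2 := (perp T2).
Local Notation W := (Wr T1 T2).
Local Notation U := (Ur T1 T2).
Local Notation Trho := (Trho T1).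

Definition WU (a w : R) : 'M[C]_m := invmx (W (a + w)) *m U (a + w).

Lemma is_A_props (a : R) d (B : 'M[C]_m) :
  zero_order (fun z => \det (W0 T1 T2 z)) a%:C d ->
  is_residue (fun z => invmx (W0 T1 T2 z) *m U0 T1 T2 z) a%:C B ->
  let A := pi%:C *: B in
  lim0 (fun w => w%:C *: WU a w) B /\
  [/\ adjmx A = A, A *m A = A, W a *m A = 0 &
      forall V : 'M[C]_m, W a *m V = 0 -> A *m V = V].
Proof.
move=> /det_near_unit unitW /is_residue_psum [N [c [e [e0 <- hc]]]] /=.
have {}hc : psum c (fun w => (w ^+ N.+1)%:C *: WU a w) e.
  by move=> w we; have := hc w we; rewrite W0R U0R.
have hF : \forall w \near 0^'+, W (a + w) *m WU a w = U (a + w).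
  by apply: filterS unitW => w uw; rewrite mulmxA mulmxV // mul1mx.
split; first exact: (laurent_lim hT1 hT2 e0 hc hF).
exact: (residue_projector hT1 hT2 e0 hc hF).
Qed.

(* [lambda = rho ^ 2] has a double zero in [rho] at [rho = 0], which halves the residue. *)
Definition cw (rho : R) : R := if rho == 0 then pi^-1 else 2 / pi.

(** With rho = r0 + s and r0 = n + a, the spectral variable moves by g(s) = s (2 r0 + s), and
    [weyl_eq] turns g M into (2 r0 + s)/(r0 + s) times T_rho (s W^(-1) U) T_rho. The scalar tends to
    2, or to 1 when r0 = 0, which is the dichotomy in [cw]; the matrix tends to the residue [B]
    between two factors T_rho. *)
Lemma model_weightE (a : R) n d (B alpha : 'M[C]_m) : 0 <= a ->
  zero_order (fun z => \det (W0 T1 T2 z)) a%:C d ->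
  lim0 (fun w => w%:C *: WU a w) B ->
  is_model_weight T1 T2 ((n%:R + a) ^+ 2)%:C alpha ->
  alpha = (cw (n%:R + a))%:C *: (Trho (n%:R + a) *m (pi%:C *: B) *m Trho (n%:R + a)).
Proof.
move=> a0 /det_near_unit unitW limF [Mt [e [e0 hweyl]]].
move=> /is_residue_psum [N [c [e' [e'0 <- hc]]]].
set r0 := n%:R + a; have r00 : 0 <= r0 by rewrite addr_ge0.
pose g (s : R) := s * (2 * r0 + s).
have g0 s : 0 < s -> 0 < g s by move=> s0; rewrite mulr_gt0 //; lra.
have cg0 : g s @[s --> 0^'+] --> (0 : R).
  have h : s * (2 * r0 + s) @[s --> (0 : R)^'+] --> (0 * (2 * r0 + 0) : R).
    apply: cvgM; first exact: cvg0_id.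
    by apply: cvgD; [apply: cvg_cst|apply: cvg0_id].
  by rewrite mul0r in h.
have gp : \forall s \near 0^'+, 0 < g s by apply: filterS (near0_pos (R := R)) => s /g0.
have cg := cvg0_at_right cg0 gp.
have ge : \forall s \near 0^'+, g s < e.
  have /cvgrPdist_lt /(_ _ e0) := cg0; apply: filterS2 gp => s gs.
  by rewrite sub0r normrN gtr0_norm.
pose cc : R := if r0 == 0 then 1 else 2.
pose G (s : R) := (g s)%:C *: Mt (r0 ^+ 2 + g s)%:C.
have GE : \forall s \near 0^'+, (((2 * r0 + s) / (r0 + s))%:C *:
    (Trho (r0 + s) *m (s%:C *: WU a s) *m Trho (r0 + s))) = G s.
  near=> s; have s0 : 0 < s by near: s; apply: near0_pos.
  have us : W (a + s) \in unitmx by near: s.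
  have gse : g s < e by near: s.
  have rho0 : r0 + s != 0 by rewrite gt_eqF //; lra.
  have := hweyl (r0 ^+ 2 + g s)%:C.
  rewrite -rmorphB addrAC subrr add0r cmodR (gtr0_norm (g0 _ s0)) (g0 _ s0) gse => /(_ isT).
  have -> : r0 ^+ 2 + g s = (r0 + s) ^+ 2 by rewrite /g; ring.
  move=> /(weyl_eq hT1 hT2 rho0) eqW.
  have sg0 : ((-1) ^+ n : R)%:C != 0 by rewrite eq_complex /= signr_eq0.
  have eqW2 : W (a + s) *m (T1 *m Mt ((r0 + s) ^+ 2)%:C + ((r0 + s)^-1)%:C *: (S1 *m Mt ((r0 + s) ^+ 2)%:C)) =
      U (a + s) *m (((r0 + s)^-1)%:C *: T1 + S1).
    apply: (scalerI sg0); move: eqW; rewrite {1 5}/r0 -!addrA WrDn UrDn.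
    by rewrite -!scalemxAl.
  have [tl tr] := TrhoV hT1 rho0.
  have eM : Mt ((r0 + s) ^+ 2)%:C = ((r0 + s)^-1)%:C *: (Trho (r0 + s) *m WU a s *m Trho (r0 + s)).
    have aux (iV V V' X Y D : 'M[C]_m) : iV *m V = 1%:M -> D *m X = Mt ((r0 + s) ^+ 2)%:C ->
        V *m X = V' *m Y -> Mt ((r0 + s) ^+ 2)%:C = D *m (iV *m V') *m Y.
      by move=> h <- e1; rewrite -!mulmxA -e1 (mulmxA iV) h mul1mx.
    rewrite [LHS](aux _ _ _ _ _ (Trho (r0 + s)) (mulVmx us) _ eqW2); last first.
      by rewrite scalemxAl -mulmxDl mulmxA tr mul1mx.
    rewrite -/(WU a s) scalemxAr; congr (_ *m _).
    by rewrite /Trho scalerDr scalerA -rmorphM mulVf // scale1r.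
  rewrite /G; have -> : r0 ^+ 2 + g s = (r0 + s) ^+ 2 by rewrite /g; ring.
  rewrite eM -scalemxAr -!scalemxAl !scalerA -!rmorphM; congr (_%:C *: _).
  by rewrite /g; field.
have limT : lim0 (fun s => Trho (r0 + s)) (Trho r0).
  apply: lim0D; first exact: lim0_cst.
  apply: lim0Z; last exact: lim0_cst.
  have h : r0 + s @[s --> (0 : R)^'+] --> (r0 + 0 : R).
    by apply: cvgD; [apply: cvg_cst|apply: cvg0_id].
  by rewrite addr0 in h.
have limq : (2 * r0 + s) / (r0 + s) @[s --> (0 : R)^'+] --> (cc : R).
  rewrite /cc; case: eqVneq => [->|rn0].
    have h1 : (fun _ : R => 1 : R) s @[s --> (0 : R)^'+] --> (1 : R) by apply: cvg_cst.
    apply: cvg_trans h1; apply: near_eq_cvg.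
    apply: filterS (near0_pos (R := R)) => s s0.
    by rewrite mulr0 !add0r divff // gt_eqF.
  have h : (2 * r0 + s) / (r0 + s) @[s --> (0 : R)^'+] --> ((2 * r0 + 0) / (r0 + 0) : R).
    apply: cvgM; first by apply: cvgD; [apply: cvg_cst|apply: cvg0_id].
    apply: cvgV; first by rewrite addr0.
    by apply: cvgD; [apply: cvg_cst|apply: cvg0_id].
  by rewrite !addr0 mulfK in h.
have limG : lim0 G (cc%:C *: (Trho r0 *m B *m Trho r0)).
  exact: (lim0_near GE (lim0Z limq (lim0M (lim0M limT limF) limT))).
pose h (w : R) := (w ^+ N.+1)%:C *: Mt (r0 ^+ 2 + w)%:C.
have Hj j : lim0 (fun s => ptail c h j (g s)) (c j).
  by apply: lim0_comp cg; apply: (@ptail_lim _ _ _ c h e' j e'0 hc).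
have Heq j : (j <= N)%N -> (forall k, (k < j)%N -> c k = 0) ->
    \forall s \near 0^'+, (g s ^+ (N - j))%:C *: G s = ptail c h j (g s).
  move=> jN cj; apply: filterS gp => s gs; have gn0 : g s != 0 by rewrite gt_eqF.
  apply: (scalerI (_ : (g s ^+ j)%:C != 0)).
    by rewrite eq_complex /= expf_eq0 (negbTE gn0) !andbF.
  rewrite -(@ptail_eq _ _ _ c h j (g s) gn0 cj) /h /G !scalerA.
  by rewrite -!rmorphM -exprSr -exprD addnS subnKC.
(* A finite limit of g M forces a simple pole in lambda, so the coefficients before the residue
   vanish one after the other. *)
have low k : (k < N)%N -> c k = 0.
  elim/ltn_ind: k => k IH kN.
  have ck l : (l < k)%N -> c l = 0 by move=> lk; apply: IH => //; apply: ltn_trans kN.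
  apply: (lim0_uniq (Hj k)); apply: (lim0_near (Heq k (ltnW kN) ck)).
  rewrite -(scale0r (cc%:C *: (Trho r0 *m B *m Trho r0))).
  suff l : g s ^+ (N - k) @[s --> (0 : R)^'+] --> (0 : R) by exact: (lim0Z l limG).
  have : (0 < N - k)%N by rewrite subn_gt0.
  case: (N - k)%N => // q _.
  elim: q => [|q IHq]; first by under eq_fun do rewrite expr1.
  under eq_fun do rewrite exprS.
  have hh : g s * g s ^+ q.+1 @[s --> (0 : R)^'+] --> (0 * 0 : R) by apply: cvgM.
  by rewrite mul0r in hh.
have -> : c N = cc%:C *: (Trho r0 *m B *m Trho r0).
  apply: (lim0_uniq (Hj N)); apply: (lim0_near (Heq N (leqnn N) low)).
  apply: lim0_near limG; apply: filterE => s.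
  by rewrite subnn expr0 scale1r.
rewrite -scalemxAr -scalemxAl scalerA -rmorphM; congr (_%:C *: _).
rewrite /cc /cw; case: eqVneq => _; first by rewrite mulVf // gt_eqF // pi_gt0.
by rewrite divfK // gt_eqF // pi_gt0.
Unshelve. all: by end_near. Qed.
End Weights.

Section Orthogonality.
Variables (m : nat) (T1 T2 : 'M[C]_m).
Hypotheses (hT1 : orth_proj T1) (hT2 : orth_proj T2).
Local Notation S1 := (perp T1).
Local Notation S2 := (perp T2).
Local Notation W := (Wr T1 T2).

(** T_rho times the model solution. It is bounded in rho and obeys the product formulas also at rho
    = 0, where it degenerates to T1. *)
Definition ert (rho t : R) : 'M[C]_m :=
  (cos (rho * t))%:C *: T1 + (sin (rho * t))%:C *: S1.

Lemma mcont_ert rho : mcont (ert rho).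
Proof.
apply: mcontD.
  by apply: (mcontZR (F := fun=> T1)); [apply: continuous_cosM|apply: mcont_cst].
by apply: (mcontZR (F := fun=> S1)); [apply: continuous_sinM|apply: mcont_cst].
Qed.

Lemma adj_ert rho t : adjmx (ert rho t) = ert rho t.
Proof. by rewrite adjmxD !adjmxZR (projT_adj hT1) (projS_adj hT1). Qed.

Lemma ertM r1 r2 t : ert r1 t *m ert r2 t =
  (1 / 2 * cos ((r1 - r2) * t))%:C *: 1%:M + (1 / 2 * cos ((r1 + r2) * t))%:C *: sigma1 T1.
Proof.
rewrite /ert !(mulmxDl, mulmxDr) -!(scalemxAl, scalemxAr) (projTT hT1) (projTS hT1) (projST hT1) (projSS hT1).
rewrite !scaler0 addr0 add0r !scalerA -!rmorphM -(projD T1) /sigma1.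
rewrite mulrBl mulrDl cosB cosD.
move: (cos (r1 * t)) (cos (r2 * t)) (sin (r1 * t)) (sin (r2 * t)) => c c' s s'.
set x := 1 / 2 * (c * c' + s * s'); set y := 1 / 2 * (c * c' - s * s').
have -> : c * c' = x + y by rewrite /x /y; field.
have -> : s * s' = x - y by rewrite /x /y; field.
by move: S1 => Z; rewrite rmorphD rmorphB !scalerDl !scalerDr scalerN scaleNr [RHS]addrACA.
Qed.

Definition dirichlet (u : R) : R := rint pi (fun t => cos (u * t)).

Lemma dirichlet0 : dirichlet 0 = pi.
Proof.
rewrite -[RHS]mul1r -rint_cst ?pi_ge0 //; apply: rint_ext => t _.
by rewrite mul0r cos0.
Qed.

Lemma dirichlet_neq0 u : u != 0 -> dirichlet u = sin (u * pi) / u.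
Proof. by move=> u0; rewrite /dirichlet rint_cosM ?pi_ge0. Qed.

Lemma mint_ertM r1 r2 : mint pi (fun t => ert r1 t *m ert r2 t) =
  (1 / 2 * dirichlet (r1 - r2))%:C *: 1%:M + (1 / 2 * dirichlet (r1 + r2))%:C *: sigma1 T1.
Proof.
have scal (f : R -> R) (A : 'M[C]_m) : continuous f ->
    mint pi (fun t => (f t)%:C *: A) = (rint pi f)%:C *: A.
  move=> cf; apply: rdot_inj => D; rewrite rdot_mint; last first.
    by apply: (mcontZR (F := fun=> A)) => //; apply: mcont_cst.
  rewrite rdotZl mulrC -rintZ //; apply: rint_ext => t _.
  by rewrite rdotZl mulrC.
have cc u : continuous (fun t : R => 1 / 2 * cos (u * t)).
  by apply: continuousMr; [apply: continuous_cst|apply: continuous_cosM].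
rewrite (mint_ext (fun t _ => ertM r1 r2 t)) mintD.
- have rz u : rint pi (fun t => 1 / 2 * cos (u * t)) = 1 / 2 * dirichlet u.
    by rewrite rintZ //; exact: continuous_cosM.
  by rewrite (scal _ _ (cc _)) (scal _ _ (cc _)) !rz.
- by apply: (mcontZR (F := fun=> 1%:M)); [apply: cc|apply: mcont_cst].
- by apply: (mcontZR (F := fun=> sigma1 T1)); [apply: cc|apply: mcont_cst].
Qed.

(** Elimination between two angle relations; the resulting coefficients are the sines and cosines of
    the difference and of the sum of the angles. *)
Lemma orth_alg (x y u v : 'M[C]_m) (c s c' s' : C) :
  s *: x = c *: v -> s *: u = c *: y -> s' *: x = c' *: u -> s' *: v = c' *: y ->
  (s * c' - c * s') *: (x + y) = (c * c' + s * s') *: (v - u) /\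
  (s * c' + c * s') *: (x - y) = (c * c' - s * s') *: (v + u).
Proof.
move=> h1 h2 h3 h4.
split; apply/matrixP => i j.
  have := congr1 (fun A : 'M[C]_m => A i j) h1; have := congr1 (fun A : 'M[C]_m => A i j) h2.
  have := congr1 (fun A : 'M[C]_m => A i j) h3; have := congr1 (fun A : 'M[C]_m => A i j) h4.
  rewrite !mxE => e4 e3 e2 e1.
  transitivity (c' * (s * x i j) + s * (c' * y i j) - c * (s' * x i j) - s' * (c * y i j)); first by ring.
  by rewrite -e4 e3 -e2 e1; ring.
have := congr1 (fun A : 'M[C]_m => A i j) h1; have := congr1 (fun A : 'M[C]_m => A i j) h2.
have := congr1 (fun A : 'M[C]_m => A i j) h3; have := congr1 (fun A : 'M[C]_m => A i j) h4.
rewrite !mxE => e4 e3 e2 e1.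
transitivity (c' * (s * x i j) - s * (c' * y i j) + c * (s' * x i j) - s' * (c * y i j)); first by ring.
by rewrite -e4 e3 -e2 e1; ring.
Qed.

(** On the kernel of W(r) one has sin P = cos Q at r pi. Combined for r1 and r2, these relations
    equate the sine of the difference times A1 (P^dagger P + Q^dagger Q) A2 with the cosine times A1
    (Q^dagger P - P^dagger Q) A2, where the first bracket is 1 and the second is 0. For the sum of
    the frequencies the reflection T2 - T2^perp is inserted. *)
Lemma kernel_orth (r1 r2 : R) (A1 A2 : 'M[C]_m) :
  adjmx A1 = A1 -> W r1 *m A1 = 0 -> W r2 *m A2 = 0 ->
  (sin ((r1 - r2) * pi))%:C *: (A1 *m A2) = 0 /\
  (sin ((r1 + r2) * pi))%:C *: (A1 *m sigma1 T1 *m A2) = 0.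
Proof.
move=> hA1 WA1 WA2.
have PQ (r : R) (A : 'M[C]_m) : W r *m A = 0 ->
    (sin (r * pi))%:C *: (Pm T1 T2 *m A) = (cos (r * pi))%:C *: (Qm T1 T2 *m A).
  by rewrite /Wr mulmxBl -!scalemxAl => /eqP; rewrite subr_eq0 => /eqP.
have e1 := PQ _ _ WA1; have e2 := PQ _ _ WA2.
have e1' : (sin (r1 * pi))%:C *: (A1 *m adjmx (Pm T1 T2)) = (cos (r1 * pi))%:C *: (A1 *m adjmx (Qm T1 T2)).
  by have := congr1 (@adjmx R _ _) e1; rewrite !adjmxZR !adjmxM hA1.
move: (PP_QQ hT1 hT2) (PQ_QP hT1 hT2) (sigma1E hT1 hT2) (sigma2_PQ hT1 hT2).
have cD (x y : R) : (x + y)%:C = x%:C + y%:C :> C by exact: rmorphD.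
have cB (x y : R) : (x - y)%:C = x%:C - y%:C :> C by exact: rmorphB.
have cM (x y : R) : (x * y)%:C = x%:C * y%:C :> C by exact: rmorphM.
move: e1' e2; rewrite mulrBl mulrDl sinB sinD !(cB, cD, cM).
move: (Pm T1 T2) (Qm T1 T2) (adjmx (Pm T1 T2)) (adjmx (Qm T1 T2)) (sigma2 T2) (sigma1 T1) => P Q P' Q' Z S.
move: (sin (r1 * pi))%:C (cos (r1 * pi))%:C (sin (r2 * pi))%:C (cos (r2 * pi))%:C => s1 c1 s2 c2 e1' e2 h1 h2 h3 h4.
(* [Y] will be the identity for the difference of the frequencies, and the reflection of T2, now
   named [Z], for their sum. *)
have key Y : s1 *: (A1 *m P' *m Y *m (P *m A2)) = c1 *: (A1 *m Q' *m Y *m (P *m A2)) /\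
    s1 *: (A1 *m P' *m Y *m (Q *m A2)) = c1 *: (A1 *m Q' *m Y *m (Q *m A2)) /\
    s2 *: (A1 *m P' *m Y *m (P *m A2)) = c2 *: (A1 *m P' *m Y *m (Q *m A2)) /\
    s2 *: (A1 *m Q' *m Y *m (P *m A2)) = c2 *: (A1 *m Q' *m Y *m (Q *m A2)).
  have aux (X X' V : 'M[C]_m) : s1 *: X = c1 *: X' -> s1 *: (X *m Y *m V) = c1 *: (X' *m Y *m V).
    by move=> h; rewrite 2!scalemxAl h -2!scalemxAl.
  have auxr (X V V' : 'M[C]_m) : s2 *: V = c2 *: V' -> s2 *: (X *m V) = c2 *: (X *m V').
    by move=> h; rewrite scalemxAr h -scalemxAr.
  by do 2 (split; first exact: aux); split; apply: auxr.
split.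
  have [k1 [k2 [k3 k4]]] := key 1%:M.
  have [+ _] := orth_alg k1 k2 k3 k4.
  have -> : A1 *m P' *m 1%:M *m (P *m A2) + A1 *m Q' *m 1%:M *m (Q *m A2) = A1 *m A2.
    by rewrite !mulmx1 !mulmxA -mulmxDl -!(mulmxA A1) -mulmxDr h1 mulmx1.
  rewrite (_ : A1 *m Q' *m 1%:M *m (P *m A2) - A1 *m P' *m 1%:M *m (Q *m A2) = 0) ?scaler0 //.
  by rewrite !mulmx1 !mulmxA -mulmxBl -!(mulmxA A1) -mulmxBr h2 subrr mulmx0 mul0mx.
have [k1 [k2 [k3 k4]]] := key Z.
have [_ +] := orth_alg k1 k2 k3 k4.
have -> : A1 *m P' *m Z *m (P *m A2) - A1 *m Q' *m Z *m (Q *m A2) = A1 *m S *m A2.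
  by rewrite !mulmxA -mulmxBl -!(mulmxA A1) -mulmxBr !mulmxA h3.
rewrite (_ : A1 *m Q' *m Z *m (P *m A2) + A1 *m P' *m Z *m (Q *m A2) = 0) ?scaler0 //.
by rewrite !mulmxA -mulmxDl -!(mulmxA A1) -mulmxDr (addrC (_ *m P)) h4 mulmx0 mul0mx.
Qed.

End Orthogonality.

(** P is the expansion of F along the [phi]. Orthogonality holds only over the whole interval, where
    the squared norm of P is B, whereas F is paired with P over [0, x]. Since B dominates the
    squared norm of P on [0, x], expanding the squared norm of F - P there gives the bound. *)
Lemma bessel (m p : nat) (I : eqType) (s : seq I) (phi : I -> R -> 'M[C]_m)
    (al : I -> 'M[C]_m) (x : R) (F : R -> 'M[C]_(p, m)) :
  uniq s -> (forall i, mcont (phi i)) -> (forall i t, adjmx (phi i t) = phi i t) ->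
  (forall i, i \in s -> adjmx (al i) = al i) ->
  (forall i j, i \in s -> j \in s ->
     al i *m mint pi (fun t => phi i t *m phi j t) *m al j = if i == j then al i else 0) ->
  0 <= x <= pi -> mcont F ->
  \sum_(i <- s) rdot (mint x (fun t => F t *m phi i t) *m al i)
                     (mint x (fun t => F t *m phi i t)) <= ip x F F.
Proof.
move=> us cphi hphi hal orth xpi cF.
pose Fh i := mint x (fun t => F t *m phi i t).
pose P (t : R) := \sum_(i <- s) Fh i *m al i *m phi i t.
pose B := \sum_(i <- s) rdot (Fh i *m al i) (Fh i).
have cPi i : mcont (fun t => Fh i *m al i *m phi i t).
  by apply: mcontM => //; apply: mcont_cst.
have cP : mcont P by apply: mcont_sum.
have ipFP : ip x F P = B.
  rewrite /P (@ip_sumr _ x _ _ _ s xpredT _ F cPi cF); apply: eq_bigr => i _.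
  rewrite ip_mint // rdotC (@mint_ext _ x _ _ _ (fun t => F t *m phi i t)) // => t _.
  by rewrite hphi.
have ipPP : ip pi P P = B.
  rewrite {2}/P (@ip_sumr _ pi _ _ _ s xpredT _ P cPi cP) /B !big_seq; apply: eq_bigr => i si.
  rewrite ip_mint // (@mint_ext _ pi _ _ _ (fun t => P t *m phi i t)) => [|t _]; last by rewrite hphi.
  have -> : mint pi (fun t => P t *m phi i t) =
      \sum_(j <- s) Fh j *m al j *m mint pi (fun t => phi j t *m phi i t).
    rewrite (@mint_ext _ pi _ _ _ (fun t => \sum_(j <- s) (Fh j *m al j) *m (phi j t *m phi i t))).
      rewrite mint_sum; last by move=> j; apply: mcontM; [apply: mcont_cst|apply: mcontM].
      by apply: eq_bigr => j _; rewrite mint_mulmxl //; apply: mcontM.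
    by move=> t _; rewrite /P mulmx_suml; apply: eq_bigr => j _; rewrite mulmxA.
  rewrite rdot_suml (bigD1_seq i) //= big_seq_cond big1 ?addr0.
    rewrite rdotC rdotMr hal // rdotC -!mulmxA.
    by rewrite [al i *m (_ *m _)]mulmxA orth // eqxx.
  move=> j /andP[sj ji]; rewrite rdotC rdotMr hal // rdotC -!mulmxA.
  by rewrite [al j *m (_ *m _)]mulmxA orth // (negbTE ji) mulmx0 rdot0l.
have ipxP : ip x P P <= B.
  by rewrite -ipPP; apply: rint_le_bound => // [|t _]; [apply: continuous_rdot|apply: rdot_ge0].
have := ip_ge0 x (fun t => F t - P t).
have cN := mcontN cP.
rewrite (ipDl x cF cN (mcontB cF cP)) (ipDr x cF cN cF) (ipDr x cF cN cN).
rewrite (ipNr x cP cF) (ipNl x cP cF) (ipNl x cP cN) (ipNr x cP cP) opprK (ipC x P F) ipFP.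
rewrite -/B; by move: ipxP; clear ipFP ipPP; move: (ip x P P) (ip x F F) (B) => a b d; lra.
Qed.

End ModelWeights.

(** * Perturbation of the identity by a limit of finite-rank operators *)

Section Fredholm.
Context {R : realType}.
Local Notation C := (R[i]).
Local Notation Re := (@complex.Re R).
Local Notation Im := (@complex.Im R).
Local Open Scope classical_set_scope.
Variables (m : nat) (X : Type) (E : X -> X -> Prop) (dist : X -> X -> R).
Hypothesis dist_ge0 : forall a b, 0 <= dist a b.
Local Notation M := 'M[C]_m.
Implicit Types (f g h : X -> M) (c : R).

(* [E] is the relation of lying in the same block, so that [Bd c f] says that the
   norm of [f] in the paper's Banach space is at most [c], up to the choice of the
   matrix norm. *)
Definition Bd c f : Prop :=
  (forall a, fro (f a) <= c) /\
  (forall a b, E a b -> fro (f a - f b) <= c * dist a b).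

Lemma BdD c d f g : Bd c f -> Bd d g -> Bd (c + d) (fun a => f a + g a).
Proof.
move=> [f1 f2] [g1 g2]; split=> [a|a b Eab].
  by apply: le_trans (froD _ _) _; apply: lerD.
rewrite opprD addrACA mulrDl; apply: le_trans (froD _ _) _.
by apply: lerD; [apply: f2|apply: g2].
Qed.
Lemma BdN c f : Bd c f -> Bd c (fun a => - f a).
Proof.
move=> [f1 f2]; split=> [a|a b Eab]; first by rewrite froN.
by rewrite -opprD froN; apply: f2.
Qed.
Lemma BdB c d f g : Bd c f -> Bd d g -> Bd (c + d) (fun a => f a - g a).
Proof. by move=> hf hg; exact: BdD hf (BdN hg). Qed.
Lemma BdW c d f : c <= d -> Bd c f -> Bd d f.
Proof.
move=> cd [f1 f2]; split=> [a|a b Eab]; first exact: le_trans (f1 a) cd.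
by apply: le_trans (f2 a b Eab) _; rewrite ler_wpM2r.
Qed.
Lemma Bd_mulmx c f (A : M) : Bd c f -> Bd (fro A * c) (fun a => A *m f a).
Proof.
move=> [f1 f2]; split=> [a|a b Eab].
  by apply: le_trans (froM _ _) _; rewrite ler_wpM2l ?fro_ge0.
rewrite -mulmxBr -mulrA; apply: le_trans (froM _ _) _.
by rewrite ler_wpM2l ?fro_ge0 ?f2.
Qed.
Lemma Bd0 : Bd 0 (fun=> 0).
Proof. by split=> [a|a b _]; rewrite ?subrr fro0 ?mul0r. Qed.
Lemma Bd_ext c f g : f =1 g -> Bd c f -> Bd c g.
Proof. by move=> fg [f1 f2]; split=> [a|a b]; rewrite -!fg //; apply: f2. Qed.
Lemma Bd_sum (I : Type) (s : seq I) (c : I -> R) (f : I -> X -> M) :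
  (forall i, Bd (c i) (f i)) -> Bd (\sum_(i <- s) c i) (fun a => \sum_(i <- s) f i a).
Proof.
move=> h; elim: s => [|i s IH].
  by rewrite big_nil; apply: Bd_ext Bd0 => a; rewrite big_nil.
rewrite big_cons; apply: Bd_ext (BdD (h i) IH) => a; by rewrite big_cons.
Qed.

Lemma fro_cvg_le p q (u : nat -> 'M[C]_(p, q)) l D c : mxcvg u l ->
  (\forall n \near \oo, fro (u n - D) <= c) -> fro (l - D) <= c.
Proof.
move=> /mxcvgP h hc.
have h2 : fro (u n - l) + c @[n --> \oo] --> (0 + c : R).
  by apply: cvgD => //; apply: cvg_cst.
rewrite add0r in h2; apply: (@cvgr_to_ge _ _ _ _ _ _ _ h2).
apply: filterS hc => n hn.
have -> : l - D = (u n - D) - (u n - l) by rewrite opprB [RHS]addrC addrA subrK.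
by apply: le_trans (froB _ _) _; rewrite addrC lerD2l.
Qed.

Lemma mxcvgB p q (u v : nat -> 'M[C]_(p, q)) l k : mxcvg u l -> mxcvg v k ->
  mxcvg (fun n => u n - v n) (l - k).
Proof.
move=> /mxcvgP hu /mxcvgP hv; apply/mxcvgP.
have s : (fun n => fro (u n - l) + fro (v n - k)) @ \oo --> (0 + 0 : R) by exact: cvgD hu hv.
rewrite addr0 in s.
apply: (squeeze0 s); apply: filterE => n; rewrite fro_ge0 /=.
have -> : u n - v n - (l - k) = (u n - l) - (v n - k).
  by apply/matrixP => i j; rewrite !mxE; ring.
exact: froB.
Qed.

Lemma Bd_closed c (u : nat -> X -> M) g :
  (\forall n \near \oo, Bd c (u n)) -> (forall a, mxcvg (fun n => u n a) (g a)) -> Bd c g.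
Proof.
move=> hu hg; split=> [a|a b Eab].
  rewrite -[g a]subr0; apply: (fro_cvg_le (hg a)).
  by apply: filterS hu => n [h _]; rewrite subr0.
rewrite -[g a - g b]subr0; apply: (fro_cvg_le (mxcvgB (hg a) (hg b))).
by apply: filterS hu => n [_ h]; rewrite subr0; apply: h.
Qed.

Lemma mxcvg_geometric (u : nat -> M) c : (forall k, fro (u k) <= c * (1 / 2) ^+ k) ->
  exists l, mxcvg (fun n => \sum_(k < n) u k) l.
Proof.
move=> hu.
have cvgs (w : nat -> R) : (forall k, `|w k| <= c * (1 / 2) ^+ k) -> cvg (series w @ \oo).
  move=> hw; apply: normed_cvg.
  apply: (@series_le_cvg _ _ (geometric c (1 / 2))) => [n|n|n|].
  - exact: normr_ge0.
  - exact: (le_trans (normr_ge0 (w n)) (hw n)).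
  - exact: hw.
  - apply: is_cvg_geometric_series; rewrite ger0_norm; lra.
have reP i j : cvg (series (fun k => Re (u k i j)) @ \oo).
  apply: cvgs => k; apply: le_trans (normRe_le _) _.
  by apply: le_trans (cmod_le_fro _ _ _) _.
have imP i j : cvg (series (fun k => Im (u k i j)) @ \oo).
  apply: cvgs => k; apply: le_trans (normIm_le _) _.
  by apply: le_trans (cmod_le_fro _ _ _) _.
exists (mxlim (fun n => \sum_(k < n) u k)) => i j; rewrite mxE /=.
have eR : (fun n => Re ((\sum_(k < n) u k) i j)) = series (fun k => Re (u k i j)).
  by apply/funext => n; rewrite summxE Re_sum /series /= big_mkord.
have eI : (fun n => Im ((\sum_(k < n) u k) i j)) = series (fun k => Im (u k i j)).
  by apply/funext => n; rewrite summxE Im_sum /series /= big_mkord.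
by rewrite eR eI; split; [apply: reP|apply: imP].
Qed.

Lemma Bd_complete c (f : nat -> X -> M) :
  (forall k, Bd (c * (1 / 2) ^+ k) (f k)) ->
  exists g, forall n, Bd (2 * c * (1 / 2) ^+ n) (fun a => g a - \sum_(k < n) f k a).
Proof.
move=> hf.
have /choice [g hg] : forall a, exists l, mxcvg (fun n => \sum_(k < n) f k a) l.
  by move=> a; apply: (@mxcvg_geometric (fun k => f k a) c) => k; case: (hf k).
have [[a0]|nX] := pselect (inhabited X); last first.
  by exists (fun=> 0) => n; split=> [a|a]; case: nX; exists.
have c0 : 0 <= c.
  have [/(_ a0) h _] := hf 0%N; rewrite expr0 mulr1 in h.
  exact: le_trans (fro_ge0 _) h.
exists g => n.
apply: (@Bd_closed _ (fun N a => \sum_(k < N) f k a - \sum_(k < n) f k a)); last first.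
  move=> a; apply: mxcvgB; first exact: hg.
  by move=> i j; split; apply: cvg_cst.
exists n => // N /= nN.
(* The bound is stable under adding one term, since c 2^(-N) = 2 c (2^(-N) - 2^(-N-1)). *)
have tele : Bd (2 * c * ((1 / 2) ^+ n - (1 / 2) ^+ N))
   (fun a => \sum_(k < N) f k a - \sum_(k < n) f k a).
  rewrite -(subnKC nN); move: (N - n)%N => d; elim: d => [|d IH].
    rewrite addn0 subrr mulr0; apply: Bd_ext Bd0 => a; by rewrite subrr.
  have h := BdD IH (hf (n + d)%N); rewrite addnS; apply: BdW (Bd_ext _ h).
    by rewrite exprS; move: (_ ^+ (n + d)) (_ ^+ n) => x y; lra.
  by move=> a /=; rewrite big_ord_recr /= addrAC.
apply: BdW tele; rewrite ler_wpM2l ?mulr_ge0 // lerBlDr lerDl exprn_ge0 //.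
Qed.

Section Neumann.
Variable D : (X -> M) -> X -> M.
Hypothesis D_half : forall c f, Bd c f -> Bd (c / 2) (D f).
Hypothesis D_lin : forall (A : M) f g c d, Bd c f -> Bd d g ->
  D (fun a => A *m f a + g a) = (fun a => A *m D f a + D g a).

Lemma D_add f g c d : Bd c f -> Bd d g ->
  D (fun a => f a + g a) = (fun a => D f a + D g a).
Proof.
move=> hf hg; have := D_lin 1%:M hf hg.
have -> : (fun a => 1%:M *m f a + g a) = (fun a => f a + g a).
  by apply/funext => a; rewrite mul1mx.
by move=> ->; apply/funext => a; rewrite mul1mx.
Qed.

Lemma D_0 : D (fun=> 0) = (fun=> 0).
Proof.
have := D_add Bd0 Bd0; have -> : (fun _ : X => 0 + 0 : M) = (fun=> 0).
  by apply/funext => a; rewrite addr0.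
move=> h; apply/funext => a; have /(congr1 (fun F => F a)) /eqP := h.
by rewrite -subr_eq0 opprD addNKr oppr_eq0 => /eqP.
Qed.

Lemma D_opp f c : Bd c f -> D (fun a => - f a) = (fun a => - D f a).
Proof.
move=> hf; have := D_lin (- 1%:M) hf Bd0; rewrite D_0.
have -> : (fun a => - 1%:M *m f a + 0) = (fun a => - f a).
  by apply/funext => a; rewrite mulNmx mul1mx addr0.
by move=> ->; apply/funext => a; rewrite mulNmx mul1mx addr0.
Qed.

(** Neumann series. [D] is known only through its effect on [Bd], so the limit is checked by
    applying [D_half] to the tail; the three errors 2c, c and c make up the factor 4 in [key]. *)
Lemma neumann c h : Bd c h -> exists2 g, Bd (2 * c) g & forall a, g a + D g a = h a.
Proof.
move=> hh; pose f := fix f (k : nat) : X -> M := if k is j.+1 then (fun a => - D (f j) a) else h.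
have hf k : Bd (c * (1 / 2) ^+ k) (f k).
  elim: k => [|k IH] /=; first by rewrite expr0 mulr1.
  have := BdN (D_half IH); rewrite exprS; apply: BdW.
  by rewrite le_eqVlt; apply/orP; left; apply/eqP; field.
have [g hg] := Bd_complete hf.
have hg0 : Bd (2 * c) g.
  by have := hg 0%N; rewrite expr0 mulr1; apply: Bd_ext => a; rewrite big_ord0 subr0.
exists g => // a; apply/eqP; rewrite -subr_eq0; apply/eqP/fro_approx0 => e e0.
have hS n : exists d, Bd d (fun a => \sum_(k < n) f k a).
  by exists (\sum_(k < n) (c * (1 / 2) ^+ k)); apply: (@Bd_sum _ (index_enum 'I_n) (fun k : 'I_n => c * (1 / 2) ^+ k)).
have DS n b : \sum_(k < n) f k b + D (fun a => \sum_(k < n) f k a) b = h b - f n b.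
  elim: n b => [|n IH] b.
    have -> : (fun a => \sum_(k < 0) f k a) = (fun=> 0).
      by apply/funext => z; rewrite big_ord0.
    by rewrite D_0 big_ord0 add0r subrr.
  have [d hd] := hS n.
  have -> : (fun a => \sum_(k < n.+1) f k a) = (fun a => \sum_(k < n) f k a + f n a).
    by apply/funext => z; rewrite big_ord_recr.
  rewrite (D_add hd (hf n)) big_ord_recr /= addrACA IH addrA subrK.
  by rewrite opprK.
have key n : fro (g a + D g a - h a) <= 4 * c * (1 / 2) ^+ n.
  have [d hd] := hS n; have h1 := hg n; have [h2 _] := D_half h1.
  have [h3 _] := hf n; have [h4 _] := h1.
  have -> : g a + D g a - h a = (g a - \sum_(k < n) f k a) +
      D (fun a => g a - \sum_(k < n) f k a) a - f n a.
    rewrite (D_add hg0 (BdN hd)) (D_opp hd).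
    have -> : h a = \sum_(k < n) f k a + D (fun a => \sum_(k < n) f k a) a + f n a.
      by rewrite DS subrK.
    move: (\sum_(k < n) f k a) (D _ a) (f n a) (g a) (D g a) => u v w y z.
    by apply/matrixP => i j; rewrite !mxE; ring.
  apply: le_trans (froB _ _) _; apply: le_trans (lerD (froD _ _) (lexx _)) _.
  apply: (le_trans (lerD (lerD (h4 a) (h2 a)) (h3 a))).
  by move: (_ ^+ n) => y; lra.
have := @cvg_geometric R (4 * c) (1 / 2); rewrite ger0_norm ?ltr_pdivrMr ?divr_ge0 // => hc.
have {}hc : geometric (4 * c) (1 / 2) @ \oo --> (0 : R) by apply: hc; lra.
have /cvgrPdist_le /(_ e e0) [n _ hn] := hc.
have := hn n (leqnn n); rewrite /= sub0r normrN => h1.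
exact: le_trans (key n) (le_trans (ler_norm _) h1).
Qed.
End Neumann.

Section FiniteRank.
Variable K : (X -> M) -> X -> M.
Hypothesis m0 : (0 < m)%N.
Hypothesis K_lin : forall (A : M) f g c d, Bd c f -> Bd d g ->
  K (fun a => A *m f a + g a) = (fun a => A *m K f a + K g a).
Hypothesis K_inj : forall c f, Bd c f -> (forall a, f a + K f a = 0) -> forall a, f a = 0.
Variables (n : nat) (pt : 'I_n -> X) (kap : 'I_n -> X -> M) (ck : R).
Hypothesis kap_bd : forall i, Bd ck (kap i).
Hypothesis K_approx : forall c f, Bd c f ->
  Bd (c / 2) (fun a => K f a - \sum_i f (pt i) *m kap i a).

Let D f a := K f a - \sum_i f (pt i) *m kap i a.

Let D_lin (A : M) f g c d : Bd c f -> Bd d g ->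
  D (fun a => A *m f a + g a) = (fun a => A *m D f a + D g a).
Proof.
move=> hf hg; apply/funext => a; rewrite /D (K_lin A hf hg).
have -> : \sum_i (A *m f (pt i) + g (pt i)) *m kap i a =
   A *m (\sum_i f (pt i) *m kap i a) + \sum_i g (pt i) *m kap i a.
  rewrite mulmx_sumr -big_split /=; apply: eq_bigr => i _.
  by rewrite mulmxDl mulmxA.
by rewrite mulmxBr opprD addrACA.
Qed.

Let D_half c f : Bd c f -> Bd (c / 2) (D f).
Proof. exact: K_approx. Qed.

(** Inverting I + D by the Neumann series leaves a finite-rank problem: g is the solution for [h]
    minus the sum of the u_b times those for the [kap b], and the unknown values u_b = g ([pt b])
    satisfy a finite linear system. Injectivity of I + K makes this system regular. *)
Lemma fredholm : exists2 c0, 0 <= c0 &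
  forall c h, Bd c h -> exists2 g, Bd (c0 * c) g & forall a, g a + K g a = h a.
Proof.
have /choice [kt hkt] : forall i, exists g, Bd (2 * ck) g /\ forall a, g a + D g a = kap i a.
  by move=> i; have [g h1 h2] := neumann D_half D_lin (kap_bd i); exists g.
pose N := #|{: 'I_n * 'I_m}|.
(* The unknown matrices multiply from the left, so their rows decouple: one scalar matrix indexed by
   pairs (point, column) serves all the rows. *)
pose S : 'M[C]_N := \matrix_(k, l) ((k == l)%:R +
  kt (enum_val k).1 (pt (enum_val l).1) (enum_val k).2 (enum_val l).2).
pose flat (u : 'I_n -> M) : 'M[C]_(m, N) := \matrix_(i, k) u (enum_val k).1 i (enum_val k).2.
have flatS u i b j : (flat u *m S) i (enum_rank (b, j)) =
    (u b + \sum_b' u b' *m kt b' (pt b)) i j.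
  rewrite !mxE; under eq_bigr do rewrite !mxE mulrDr; rewrite big_split /=; congr (_ + _).
    rewrite (bigD1 (enum_rank (b, j))) //= eqxx mulr1 big1 ?addr0 ?enum_rankK // => k kn.
    by rewrite (negbTE kn) mulr0.
  rewrite enum_rankK /= summxE (reindex enum_rank) /=; last exact: onW_bij (@enum_rank_bij _).
  under [RHS]eq_bigr do rewrite mxE.
  by rewrite pair_bigA /=; apply: eq_bigr => p _; rewrite enum_rankK.
have sumS (u : 'I_n -> M) : Bd (\sum_b fro (u b) * (2 * ck)) (fun a => \sum_b u b *m kt b a).
  by apply: Bd_sum => b; apply: Bd_mulmx; case: (hkt b).
have sumD (u : 'I_n -> M) a : \sum_b u b *m kt b a + D (fun a => \sum_b u b *m kt b a) a =
    \sum_b u b *m kap b a.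
  suff h (s : seq 'I_n) : D (fun a => \sum_(b <- s) u b *m kt b a) = (fun a => \sum_(b <- s) u b *m D (kt b) a).
    rewrite h -big_split /=; apply: eq_bigr => b _.
    by rewrite -mulmxDr; have [_ ->] := hkt b.
  elim: s => [|b s IH].
    have -> : (fun a => \sum_(b <- [::]) u b *m kt b a) = (fun=> 0).
      by apply/funext => z; rewrite big_nil.
    by rewrite (D_0 D_lin); apply/funext => z; rewrite big_nil.
  have -> : (fun a => \sum_(b <- b :: s) u b *m kt b a) =
      (fun a => u b *m kt b a + \sum_(b <- s) u b *m kt b a).
    by apply/funext => z; rewrite big_cons.
  have [hb _] := hkt b.
  have hs : Bd (\sum_(b <- s) fro (u b) * (2 * ck)) (fun a => \sum_(b <- s) u b *m kt b a).
    by apply: Bd_sum => i; apply: Bd_mulmx; case: (hkt i).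
  by rewrite (D_lin (u b) hb hs) IH; apply/funext => z; rewrite big_cons.
have Sunit : S \in unitmx.
  rewrite -row_free_unit; apply: inj_row_free => w wS.
  (* Every row of [u] is a copy of the null vector [w]. The homogeneous solution built from it is 0,
     and [w] is read off in row 0, which exists since m > 0. *)
  pose u (b : 'I_n) : M := \matrix_(i, j) w ord0 (enum_rank (b, j)).
  have flatu i : row i (flat u) = w.
    apply/rowP => k; rewrite !mxE; congr (w _ _); apply: enum_val_inj.
    by rewrite enum_rankK; case: (enum_val k).
  have uS b : u b + \sum_b' u b' *m kt b' (pt b) = 0.
    apply/matrixP => i j; rewrite -flatS.
    have := congr1 (fun r : 'rV[C]_N => r ord0 (enum_rank (b, j))) (row_mul i (flat u) S).
    by rewrite flatu wS !mxE => ->.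
  pose g a := - \sum_b u b *m kt b a.
  have hg := BdN (sumS u).
  have gpt b : g (pt b) = u b by rewrite /g; apply/eqP; rewrite eqr_oppLR -subr_eq0 opprK addrC uS.
  have gK a : g a + K g a = 0.
    have -> : K g a = D g a + \sum_i g (pt i) *m kap i a by rewrite /D subrK.
    have -> : \sum_i g (pt i) *m kap i a = \sum_i u i *m kap i a.
      by apply: eq_bigr => b _; congr (_ *m _); apply: gpt.
    rewrite /g (D_opp D_lin (sumS u)) addrA -opprD sumD addrC subrr.
    by [].
  have g0 := K_inj hg gK.
  apply/rowP => k; rewrite mxE -(enum_valK k); case: (enum_val k) => b j.
  have gz : g (pt b) = 0 by exact: g0.
  rewrite gpt in gz; move/matrixP: gz => /(_ (Ordinal m0) j); rewrite !mxE.
  by [].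
have [cS cS0 hcS] : exists2 cS, 0 <= cS & forall u v : 'I_n -> M,
    (forall b, u b + \sum_b' u b' *m kt b' (pt b) = v b) -> forall c, 0 <= c ->
    (forall b, fro (v b) <= c) -> forall b, fro (u b) <= cS * c.
  exists ((m * m)%:R * ((m * N)%:R * fro (invmx S))) => [|u v huv c c0 hv b].
    by rewrite !mulr_ge0 ?fro_ge0.
  have eflat : flat u *m S = flat v.
    apply/matrixP => i k; rewrite -[k](enum_valK k); case: (enum_val k) => b' j.
    by rewrite flatS huv /flat !mxE enum_rankK.
  have eu : flat u = flat v *m invmx S by rewrite -eflat mulmxK.
  have entry i j : cmod (u b i j) <= (m * N)%:R * fro (invmx S) * c.
    have -> : u b i j = flat u i (enum_rank (b, j)) by rewrite mxE enum_rankK.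
    apply: le_trans (cmod_le_fro _ _ _) _; rewrite eu mulrAC.
    apply: le_trans (froM _ _) _; rewrite ler_wpM2r ?fro_ge0 //.
    apply: le_trans (fro_le_sum _) _.
    apply: le_trans (_ : \sum_(i < m) \sum_(j < N) c <= _).
      apply: ler_sum => i' _; apply: ler_sum => k _; rewrite mxE.
      exact: le_trans (cmod_le_fro _ _ _) (hv _).
    by rewrite !sumr_const !card_ord -mulrnA -[leLHS]mulr_natl [(N * m)%N]mulnC.
  apply: le_trans (fro_le_sum _) _.
  apply: le_trans (_ : \sum_(i < m) \sum_(j < m) (m * N)%:R * fro (invmx S) * c <= _).
    by apply: ler_sum => i _; apply: ler_sum => j _; apply: entry.
  by rewrite !sumr_const !card_ord -mulrnA -[leLHS]mulr_natl mulrA.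
have [j0|n0] := pselect (inhabited X); last first.
  exists 0 => // c h hh; exists h => [|a]; last by case: n0; exists.
  by split=> a; case: n0; exists.
have [a0] := j0.
(* The norms of the u_b are at most [cS * (2 * c)] and the functions [kt b] are bounded by [2 * ck].
   The absolute value makes the constant nonnegative also for n = 0, when nothing forces a sign on
   [ck]. *)
exists (2 + \sum_(b < n) cS * 2 * (2 * `|ck|)) => [|c h hh].
  by rewrite addr_ge0 // sumr_ge0 // => b _; rewrite !mulr_ge0.
have c0 : 0 <= c by have [/(_ a0) h1 _] := hh; exact: le_trans (fro_ge0 _) h1.
have [hb hbb hbE] := neumann D_half D_lin hh.
have [V eV] : exists V : 'M[C]_(m, N), V *m S = flat (fun b => hb (pt b)).
  by exists (flat (fun b => hb (pt b)) *m invmx S); rewrite mulmxKV.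
pose u (b : 'I_n) : M := \matrix_(i, j) V i (enum_rank (b, j)).
have flatu : flat u = V.
  apply/matrixP => i k; rewrite !mxE; congr (V _ _); apply: enum_val_inj.
  by rewrite enum_rankK; case: (enum_val k).
have uS b : u b + \sum_b' u b' *m kt b' (pt b) = hb (pt b).
  apply/matrixP => i j; rewrite -flatS flatu eV mxE enum_rankK.
  by [].
have ub b : fro (u b) <= cS * (2 * c).
  have h20 : 0 <= 2 * c by rewrite mulr_ge0.
  have hbp b' : fro (hb (pt b')) <= 2 * c by case: hbb.
  exact: (hcS u (fun b => hb (pt b)) uS (2 * c) h20 hbp b).
exists (fun a => hb a - \sum_b u b *m kt b a).
  apply: BdW (BdB hbb (sumS u)); rewrite [leRHS]mulrDl lerD2l mulr_suml ler_sum // => b _.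
  have ck0 : 0 <= ck by have [/(_ a0) h1 _] := kap_bd b; exact: le_trans (fro_ge0 _) h1.
  apply: le_trans (_ : cS * (2 * c) * (2 * ck) <= _); first by rewrite ler_wpM2r ?mulr_ge0.
  by rewrite ger0_norm // le_eqVlt; apply/orP; left; apply/eqP; ring.
move=> a; pose g a := hb a - \sum_b u b *m kt b a; rewrite -[LHS]/(g a + K g a).
have gpt b : g (pt b) = u b by rewrite /g -uS addrK.
have -> : K g a = D g a + \sum_i g (pt i) *m kap i a by rewrite /D subrK.
have -> : \sum_i g (pt i) *m kap i a = \sum_i u i *m kap i a.
  by apply: eq_bigr => b _; congr (_ *m _); apply: gpt.
have -> : D g = (fun a => D hb a - D (fun a => \sum_b u b *m kt b a) a).
  by rewrite /g (D_add D_lin hbb (BdN (sumS u))) (D_opp D_lin (sumS u)).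
rewrite -sumD /g -hbE.
move: (\sum_b _) (hb a) (D hb a) (D _ a) => x y z w.
by apply/matrixP => i j; rewrite !mxE; ring.
Qed.
End FiniteRank.
End Fredholm.

(** * Blocks of indices *)

Section Blocks.
Context {R : realType}.
Local Notation C := (R[i]).
Local Open Scope classical_set_scope.
Variables (m : nat) (T1 T2 : 'M[C]_m) (r : 'I_m -> R) (n0 : nat) (lam : J T1 T2 -> R).
Hypothesis m0 : (0 < m)%N.
Local Notation JT := (J T1 T2).
Local Notation JJT := (JJ T1 T2).
Local Notation G := (@G R m T1 T2 r n0).
Local Notation nJ := #|calJ r|.
Local Notation rho := (rhoI r lam).
Implicit Types (a b : JJT) (f : JJT -> 'M[C]_m).

(** The least index carrying the value [r k] is taken: minimality makes its predecessor, if any,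
    carry another value, which is membership in [calJ]. *)
Lemma calJ_rep (k : 'I_m) : exists2 s : 'I_nJ, r (enum_val s) = r k & (enum_val s <= k)%N.
Proof.
have ex : exists n, [exists j : 'I_m, ((j : nat) == n) && (r j == r k)].
  by exists (k : nat); apply/existsP; exists k; rewrite !eqxx.
case: (ex_minnP ex) => n /existsP [j /andP[/eqP jn /eqP rjk]] minn.
have jJ : j \in calJ r.
  rewrite inE; apply/forallP => l; apply/implyP => /eqP lj.
  apply/eqP => rjl; have : (n <= l)%N; last by rewrite -jn -lj ltnn.
  by apply: (minn l); apply/existsP; exists l; rewrite eqxx /= -rjl rjk.
exists (enum_rank_in jJ j); rewrite enum_rankK_in // -jn in minn *.
by apply: (minn k); apply/existsP; exists k; rewrite !eqxx.
Qed.

Lemma nJ_gt0 : (0 < nJ)%N.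
Proof. by have [s _ _] := calJ_rep (Ordinal m0); apply: leq_ltn_trans (ltn_ord s). Qed.

(** The block of level n0 + q + 1 and of the s-th distinct value of [r]; the successor leaves index
    0 to the block of all levels up to n0. *)
Definition bidx (q : nat) (s : 'I_nJ) : nat := (nJ * q + s).+1.

Lemma bidx_inj q s q' s' : bidx q s = bidx q' s' -> q = q' /\ s = s'.
Proof.
move=> [] e.
have eq : q = q'.
  have := congr1 (fun n => n %/ nJ)%N e.
  by rewrite !(mulnC nJ) !divnMDl ?nJ_gt0 // !divn_small ?ltn_ord // !addn0.
split=> //; apply: val_inj; move: e; rewrite eq => /addnI.
by [].
Qed.

Lemma bidx_surj N : exists q s, N.+1 = bidx q s.
Proof.
exists (N %/ nJ)%N; have lt : (N %% nJ < nJ)%N by rewrite ltn_mod nJ_gt0.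
by exists (Ordinal lt); rewrite /bidx /= mulnC -divn_eq.
Qed.

Lemma G0E a : G 0 a <-> (J1 a.1 <= n0)%N.
Proof. by split=> [[[]//|[q [s []]//]]|h]; left. Qed.

Lemma GbE q s a : G (bidx q s) a <->
  J1 a.1 = (n0 + q).+1 /\ r (J2 a.1) = r (enum_val s).
Proof.
split=> [[[]//|[q' [s' [e h1 h2]]]]|[h1 h2]].
  by have [-> ->] := bidx_inj e; rewrite h1 h2 addn1.
by right; exists q, s; rewrite h1 h2 addn1.
Qed.

Lemma G_cover a : exists N, G N a.
Proof.
have [h|h] := leqP (J1 a.1) n0; first by exists 0%N; apply/G0E.
have [s hs _] := calJ_rep (J2 a.1).
exists (bidx (J1 a.1 - n0.+1) s); apply/GbE; split=> //.
by rewrite -addSn subnKC.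
Qed.

Lemma G_level N a : G N a -> (J1 a.1 <= n0 + N)%N.
Proof.
case: N => [/G0E|N]; first by rewrite addn0.
have [q [s ->]] := bidx_surj N; move=> /GbE [-> _].
rewrite /bidx addnS ltnS leq_add2l (leq_trans _ (leq_addr _ _)) //.
by rewrite leq_pmull ?nJ_gt0.
Qed.

Definition JL (L : nat) : seq JT :=
  pmap insub [seq (n, k) | n <- iota 0 L.+1, k <- enum 'I_m].
Definition LL (L : nat) : seq JJT := [seq (x, i) | x <- JL L, i <- [:: false; true]].

Lemma mem_JL L (a : JT) : (a \in JL L) = (J1 a <= L)%N.
Proof.
rewrite /JL mem_pmap_sub; apply/allpairsP/idP => [[[n k] [ni _ e]]|h].
  by have -> : J1 a = n := congr1 fst e; move: ni; rewrite mem_iota add0n ltnS => /andP[].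
exists (val a); rewrite mem_iota mem_enum add0n ltnS; split=> //.
by case: (val a).
Qed.

Lemma uniq_JL L : uniq (JL L).
Proof.
apply: pmap_sub_uniq; apply: allpairs_uniq; rewrite ?iota_uniq ?enum_uniq //.
by move=> [? ?] [? ?] _ _ /= [-> ->].
Qed.

Lemma mem_LL L a : (a \in LL L) = (J1 a.1 <= L)%N.
Proof.
apply/allpairsP/idP => [[[b i] /= [bi _ ->]]|h]; first by rewrite mem_JL in bi.
by exists a; rewrite mem_JL h !inE; split=> //; case: a {h} => b [].
Qed.

Lemma uniq_LL L : uniq (LL L).
Proof.
apply: allpairs_uniq; rewrite ?uniq_JL //.
by move=> [? ?] [? ?] _ _ /= [-> ->].
Qed.

(** Membership in [G N] is a mere proposition. Block N lives on levels at most n0 + N, so a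
    classical filter of a finite list enumerates it and its sums become ordinary ones. *)
Definition Gseq (N : nat) : seq JJT := [seq a <- LL (n0 + N) | `[< G N a >]].

Lemma mem_Gseq N a : a \in Gseq N <-> G N a.
Proof.
rewrite mem_filter mem_LL; split=> [/andP[/asboolP]//|h].
by apply/andP; split; [apply/asboolP|apply: G_level].
Qed.

Lemma uniq_Gseq N : uniq (Gseq N).
Proof. by rewrite filter_uniq // uniq_LL. Qed.

Lemma sum_Gseq (V : zmodType) N (F : JJT -> V) :
  \sum_(b \in G N) F b = \sum_(b <- Gseq N) F b.
Proof.
have -> : G N = [set` Gseq N] by apply/seteqP; split=> b /=; rewrite mem_Gseq.
by rewrite (fsbig_seq _ F (uniq_Gseq N)).
Qed.

(** For each index of its group of equal [r] a block has one given and one model frequency. [Jpos]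
    already adds 1 to the level. *)
Lemma sum_Gseq_block (V : zmodType) q s (F : JJT -> V) :
  \sum_(b <- Gseq (bidx q s)) F b =
  \sum_(j | r j == r (enum_val s))
    (F (Jpos T1 T2 (n0 + q) j, false) + F (Jpos T1 T2 (n0 + q) j, true)).
Proof.
pose B := [seq (Jpos T1 T2 (n0 + q) j, i) | j <- [seq j <- enum 'I_m | r j == r (enum_val s)],
   i <- [:: false; true]].
have uB : uniq B.
  apply: allpairs_uniq => //; first by apply: filter_uniq; apply: enum_uniq.
  move=> [j i] [j' i'] _ _ /= e.
  have e1 : j = j' := congr1 (fun z : JJT => J2 z.1) e.
  by have e2 : i = i' := congr1 snd e; rewrite e1 e2.
have memB b : (b \in B) = (b \in Gseq (bidx q s)).
  apply/allpairsP/idP => [[[j i] /= [jm _ ->]]|].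
    apply/mem_Gseq/GbE; split=> //=.
    by move: jm; rewrite mem_filter => /andP[/eqP].
  move=> /mem_Gseq /GbE [h1 h2]; exists (J2 b.1, b.2) => /=; split.
  - by rewrite mem_filter mem_enum h2 eqxx.
  - by rewrite !inE; case: b.2.
  - case: b h1 h2 => [[[n k] ik] i] /= h1 _; have e : n = (n0 + q).+1 := h1; subst n.
    by congr (_, _); apply: val_inj.
rewrite -(perm_big _ (uniq_perm uB (uniq_Gseq _) memB)) /= /B.
rewrite big_allpairs_dep /= big_filter big_enum_cond /=.
by apply: eq_bigr => j _; rewrite !big_cons big_nil addr0.
Qed.

Lemma rhoI_ge0 a : 0 <= rho a. Proof. exact: sqrtr_ge0. Qed.

Definition sameG a b : Prop := exists N, G N a /\ G N b.
Definition drho a b : R := `|rho a - rho b|.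

Lemma drho_ge0 a b : 0 <= drho a b. Proof. exact: normr_ge0. Qed.

Local Notation Bd := (Bd sameG drho).
Local Notation normB := (normB r n0 lam).
Local Notation frakB := (frakB r n0 lam).

(** The factor m^2 is the price of passing from the operator norm to the Frobenius norm; the
    converse [Bd_normB_le] has no loss. *)
Lemma normB_le_Bd f (c : R) : (forall N a b, G N a -> G N b -> rho a = rho b -> f a = f b) ->
  (normB f <= c%:E)%E -> Bd ((m ^ 2)%:R * c) f.
Proof.
move=> comp hf.
have hN N : (normBG r n0 lam f N <= c%:E)%E.
  by apply: le_trans hf; apply: ereal_sup_ubound; exists N.
have h1 a : mxnorm (f a) <= c.
  have [N Na] := G_cover a; rewrite -lee_fin; apply: le_trans (hN N).
  rewrite /normBG le_max; apply/orP; left; apply: ereal_sup_ubound.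
  by exists a.
have c0 : 0 <= c.
  exact: le_trans (mxnorm_ge0 _) (h1 (Jpos T1 T2 0 (Ordinal m0), true)).
split=> [a|a b [N [Na Nb]]].
  by apply: le_trans (fro_le_mxnorm _) _; rewrite ler_wpM2l.
(* The difference quotients in [normB] skip pairs with equal rho; for these the consistency of [f]
   on a block is used. *)
have [e|ne] := eqVneq (rho a) (rho b).
  by rewrite (comp _ _ _ Na Nb e) subrr fro0 !mulr_ge0 ?drho_ge0.
have dp : 0 < `|rho a - rho b| by rewrite normr_gt0 subr_eq0.
apply: le_trans (fro_le_mxnorm _) _; rewrite -mulrA ler_wpM2l // /drho.
rewrite -ler_pdivrMr // mulrC -lee_fin; apply: le_trans (hN N).
rewrite /normBG le_max; apply/orP; right; apply: ereal_sup_ubound.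
by exists (a, b) => //=; split=> //; apply/eqP.
Qed.

Lemma Bd_normB_le f (c : R) : Bd c f -> (normB f <= c%:E)%E.
Proof.
move=> [h1 h2]; apply: ge_ereal_sup => _ [N _ <-].
rewrite /normBG ge_max; apply/andP; split; apply: ge_ereal_sup => y.
  by move=> [a _ <-]; rewrite lee_fin; apply: le_trans (mxnorm_le_fro _) (h1 a).
move=> [[a b] /= [Na Nb ne] <-].
have dp : 0 < `|rho a - rho b| by rewrite normr_gt0 subr_eq0; apply/eqP.
rewrite lee_fin mulrC ler_pdivrMr //; apply: le_trans (mxnorm_le_fro _) _.
by apply: h2; exists N.
Qed.

Lemma Bd_comp f c : Bd c f -> forall N a b, G N a -> G N b -> rho a = rho b -> f a = f b.
Proof.
move=> [_ h] N a b Na Nb e; apply/eqP; rewrite -subr_eq0; apply/eqP/fro_le0.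
have := h a b (ex_intro _ N (conj Na Nb)); rewrite /drho e subrr normr0 mulr0.
by [].
Qed.

Lemma Bd_frakB f c : Bd c f -> frakB f.
Proof.
move=> hf; split; first exact: (Bd_comp hf).
by apply: le_lt_trans (Bd_normB_le hf) _; rewrite ltry.
Qed.

Lemma frakB_norm f : frakB f -> exists2 c : R, 0 <= c & normB f = c%:E.
Proof.
move=> [comp hf].
have h0 : (0 <= normB f)%E.
  have [N Na] := G_cover (Jpos T1 T2 0 (Ordinal m0), true).
  apply: le_trans (_ : normBG r n0 lam f N <= _)%E; last by apply: ereal_sup_ubound; exists N.
  rewrite /normBG le_max; apply/orP; left.
  apply: le_trans (_ : (mxnorm (f (Jpos T1 T2 0 (Ordinal m0), true)))%:E <= _)%E.
    by rewrite lee_fin mxnorm_ge0.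
  by apply: ereal_sup_ubound; exists (Jpos T1 T2 0 (Ordinal m0), true).
have fn : normB f \is a fin_num by rewrite ge0_fin_numE.
exists (fine (normB f)); first by rewrite fine_ge0.
by rewrite fineK.
Qed.

Lemma frakB_Bd f : frakB f -> exists2 c : R, normB f = c%:E & Bd ((m ^ 2)%:R * c) f.
Proof.
move=> hf; have [c c0 e] := frakB_norm hf; exists c => //.
by apply: normB_le_Bd; [case: hf|rewrite e].
Qed.

End Blocks.

(** * Convergence of the block sums in L_2 *)

Section SquareSummable.
Context {R : realType}.
Local Notation C := (R[i]).
Local Open Scope classical_set_scope.

Lemma esum_seq_bound (T : choiceType) (D : set T) (a : T -> R) :
  (forall x, 0 <= a x) -> (\esum_(x in D) (a x)%:E < +oo)%E ->
  exists S, forall s : seq T, uniq s -> (forall x, x \in s -> D x) -> \sum_(x <- s) a x <= S.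
Proof.
move=> a0 fin; have s0 : (0 <= \esum_(x in D) (a x)%:E)%E.
  by apply: esum_ge0 => x _; rewrite lee_fin.
have fn : \esum_(x in D) (a x)%:E \is a fin_num by rewrite ge0_fin_numE.
exists (fine (\esum_(x in D) (a x)%:E)) => s us hs.
rewrite -lee_fin fineK //; apply: esum_ge; exists [set` s].
  by split; [exact: finite_seq|move=> x /= /hs].
by rewrite -(fsbig_seq _ _ us) sumEFin.
Qed.

Lemma sum_inv_sqr_le2 n : \sum_(q < n) (q.+1%:R ^- 2 : R) <= 2.
Proof.
suff h k : \sum_(q < k.+1) (q.+1%:R ^- 2 : R) <= 2 - k.+1%:R^-1.
  case: n => [|n]; first by rewrite big_ord0.
  by apply: le_trans (h n) _; rewrite gerBl invr_ge0.
elim: k => [|k IH]; first by rewrite big_ord1 expr1n invr1; lra.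
rewrite big_ord_recr /=; apply: (le_trans (lerD IH (lexx _))).
have k1 : (0 : R) < k.+1%:R by rewrite ltr0n.
have -> : k.+2%:R = k.+1%:R + 1 :> R by rewrite natr1.
move: k1; move: (k.+1%:R : R) => x x0.
rewrite -subr_ge0.
have -> : 2 - (x + 1)^-1 - (2 - x^-1 + (x + 1) ^- 2) = x^-1 * (x + 1) ^- 2.
  by field; rewrite !gt_eqF //; lra.
by rewrite mulr_ge0 // ?invr_ge0 ?exprn_ge0 //; lra.
Qed.

Lemma bounded_sum_cauchy (u : nat -> R) (S : R) : (forall k, 0 <= u k) ->
  (forall n, \sum_(k < n) u k <= S) -> forall e, 0 < e ->
  exists N0, forall N M, (N0 <= N <= M)%N -> \sum_(N <= k < M) u k <= e.
Proof.
move=> u0 uS e e0.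
have cv : cvg (series u @ \oo).
  apply: nondecreasing_is_cvgn.
    by move=> p q pq; rewrite /series /= (big_cat_nat (leq0n p) pq) //= lerDl sumr_ge0.
  by exists S => _ [n _ <-]; rewrite /series /= big_mkord.
have [l hl] : exists l : R, series u @ \oo --> l by exists (lim (series u @ \oo)).
have e2 : 0 < e / 2 by lra.
have /cvgrPdist_le /(_ _ e2) [N0 _ hN0] := hl.
exists N0 => N M /andP[N0N NM].
have h1 := hN0 N N0N; have h2 := hN0 M (leq_trans N0N NM).
have -> : \sum_(N <= k < M) u k = (l - series u N) - (l - series u M).
  rewrite /series /= (big_cat_nat (leq0n N) NM) //= opprB [RHS]addrC addrA subrK addrAC.
  by rewrite subrr add0r.
apply: le_trans (ler_norm _) _; apply: le_trans (ler_normB _ _) _.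
have := lerD h1 h2; lra.
Qed.

Lemma sum_blocks (V : zmodType) p (g : nat -> V) n :
  \sum_(k < p * n) g k = \sum_(q < n) \sum_(s < p) g (p * q + s)%N.
Proof.
elim: n => [|n IH]; first by rewrite muln0 !big_ord0.
rewrite mulnS addnC big_split_ord /= IH big_ord_recr /=; congr (_ + _).
Qed.

(** Sorting the blocks by [s] leaves, for each [s], frequencies with a common fractional part, to
    which orthogonality applies. The mask makes the range of [q] the same for every [s]. *)
Lemma sum_masked (V : zmodType) p (g : nat -> V) N M : (0 < p)%N -> (0 < N)%N ->
  \sum_(N <= k < M) g k =
  \sum_(s < p) \sum_(q < M) (if (N <= (p * q + s).+1 < M)%N then g (p * q + s).+1 else 0).
Proof.
move=> p0 N0; rewrite exchange_big /=.
rewrite -(sum_blocks p (fun k => if (N <= k.+1 < M)%N then g k.+1 else 0)).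
rewrite -(big_mkord xpredT (fun k => if (N <= k.+1 < M)%N then g k.+1 else 0)).
have -> : \sum_(0 <= k < p * M) (if (N <= k.+1 < M)%N then g k.+1 else 0) =
    \sum_(1 <= k < (p * M).+1) (if (N <= k < M)%N then g k else 0).
  by rewrite big_add1 /=.
rewrite -big_mkcond /= -[RHS]big_filter -[LHS]big_filter filter_predT.
apply: perm_big; apply: uniq_perm; rewrite ?iota_uniq ?filter_uniq ?iota_uniq //.
move=> k; rewrite mem_filter !mem_index_iota.
apply/idP/idP => [/andP[Nk kM]|/andP[]//].
rewrite Nk kM /= (leq_trans N0 Nk) /= ltnS.
by apply: leq_trans (ltnW kM) _; rewrite leq_pmull.
Qed.

End SquareSummable.

(** * Orthogonal sums of shifted cosines and sines *)

Section TrigSums.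
Context {R : realType}.
Local Notation C := (R[i]).
Local Open Scope classical_set_scope.

Lemma dirichlet_nat n (k : R) : k = n%:R -> k != 0 -> dirichlet k = 0.
Proof.
move=> kn k0; rewrite dirichlet_neq0 // kn; have [-> _] := cos_sin_natpi (R := R) n.
by rewrite mul0r.
Qed.

Lemma dirichletN (k : R) : dirichlet (- k) = dirichlet k.
Proof. by apply: rint_ext => t _; rewrite mulNr cosN. Qed.

Lemma dirichletB n p : dirichlet (n%:R - p%:R : R) = if n == p then pi else 0.
Proof.
case: eqVneq => [->|np]; first by rewrite subrr dirichlet0.
have [pn|np'] := leqP p n.
  apply: (@dirichlet_nat (n - p)); first by rewrite natrB.
  by rewrite subr_eq0 eqr_nat.
rewrite -dirichletN opprB; apply: (@dirichlet_nat (p - n)); first by rewrite natrB // ltnW.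
by rewrite subr_eq0 eqr_nat eq_sym.
Qed.

Lemma dirichletD n p : (0 < n)%N -> dirichlet (n%:R + p%:R : R) = 0.
Proof.
move=> n0; apply: (@dirichlet_nat (n + p)); first by rewrite natrD.
by rewrite -natrD pnatr_eq0 -lt0n ltn_addr.
Qed.

Lemma rint_coscos n p : (0 < n)%N ->
  rint pi (fun t : R => cos (n%:R * t) * cos (p%:R * t)) = if n == p then pi / 2 else 0.
Proof.
move=> n0; transitivity (rint pi (fun t : R =>
    1 / 2 * cos ((n%:R - p%:R) * t) + 1 / 2 * cos ((n%:R + p%:R) * t))).
  by apply: rint_ext => t _; rewrite mulrBl mulrDl cosB cosD; field.
have cc u : continuous (fun t : R => cos (u * t)) by exact: continuous_cosM.
rewrite rintD ?rintZ //; try by apply: continuousMr => //; apply: continuous_cst.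
rewrite -/(dirichlet _) -/(dirichlet (_ + _)) dirichletB dirichletD // mulr0 addr0.
by case: eqP => _; rewrite ?mulr0 //; field.
Qed.

Lemma rint_sinsin n p : (0 < n)%N ->
  rint pi (fun t : R => sin (n%:R * t) * sin (p%:R * t)) = if n == p then pi / 2 else 0.
Proof.
move=> n0; transitivity (rint pi (fun t : R =>
    1 / 2 * cos ((n%:R - p%:R) * t) + (- (1 / 2)) * cos ((n%:R + p%:R) * t))).
  by apply: rint_ext => t _; rewrite mulrBl mulrDl cosB cosD; field.
have cc u : continuous (fun t : R => cos (u * t)) by exact: continuous_cosM.
rewrite rintD ?rintZ //; try by apply: continuousMr => //; apply: continuous_cst.
rewrite -/(dirichlet _) -/(dirichlet (_ + _)) dirichletB dirichletD // mulr0 addr0.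
by case: eqP => _; rewrite ?mulr0 //; field.
Qed.

Variables (m : nat).

(** Orthogonality gives exactly the factor sqrt (pi / 2), which is rounded up to pi. *)
Lemma nL_orth_sum Q (g : 'I_Q -> R -> R) (P : 'I_Q -> 'M[C]_m) :
  (forall q, continuous (g q)) ->
  (forall q q', rint pi (fun t => g q t * g q' t) = if q == q' then pi / 2 else 0) ->
  nL pi (fun t => \sum_q (g q t)%:C *: P q) <= pi * Num.sqrt (\sum_q fro (P q) ^+ 2).
Proof.
move=> cg orth.
have cgP q : mcont (fun t => (g q t)%:C *: P q).
  by apply: (mcontZR (F := fun=> P q)) => //; apply: mcont_cst.
have -> : nL pi (fun t => \sum_q (g q t)%:C *: P q) = Num.sqrt (pi / 2 * \sum_q fro (P q) ^+ 2).
  congr Num.sqrt; have cs : mcont (fun t => \sum_q (g q t)%:C *: P q) by apply: mcont_sum.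
  rewrite (ip_suml _ _ _ cgP cs) mulr_sumr; apply: eq_bigr => q _.
  rewrite (ip_sumr _ _ _ cgP (cgP q)) (bigD1 q) //= big1 ?addr0 => [|q' q'q].
    transitivity (rint pi (fun t => rdot (P q) (P q) * (g q t * g q t))).
      by apply: rint_ext => t _; rewrite rdotZl rdotZr; ring.
    rewrite rintZ; last by apply: continuousMr.
    by rewrite orth eqxx mulrC fro_sqr.
  transitivity (rint pi (fun t => rdot (P q) (P q') * (g q t * g q' t))).
    by apply: rint_ext => t _; rewrite rdotZl rdotZr; ring.
  rewrite rintZ; last by apply: continuousMr.
  by rewrite orth eq_sym (negbTE q'q) mulr0.
rewrite sqrtrM ?divr_ge0 ?pi_ge0 // ler_wpM2r ?sqrtr_ge0 //.
rewrite -[leRHS]ger0_norm ?pi_ge0 // -sqrtr_sqr ler_sqrt ?sqr_ge0 //.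
have := pi_ge2 R; nra.
Qed.

Variable T1 : 'M[C]_m.
Local Notation S1 := (perp T1).
Local Notation ert := (ert T1).

(** The derivative of [ert] in rho is t times this function. *)
Definition dert (rho t : R) : 'M[C]_m :=
  (- sin (rho * t))%:C *: T1 + (cos (rho * t))%:C *: S1.

Lemma mcont_dert rho : mcont (dert rho).
Proof.
apply: mcontD.
  apply: (mcontZR (F := fun=> T1)); last exact: mcont_cst.
  by apply: continuousNr; apply: continuous_sinM.
by apply: (mcontZR (F := fun=> S1)); [apply: continuous_cosM|apply: mcont_cst].
Qed.

Lemma ert_shift (n rho t : R) : ert (n + rho) t =
  (cos (n * t))%:C *: ert rho t + (sin (n * t))%:C *: dert rho t.
Proof.
rewrite /ert /dert; move: S1 => Z; rewrite mulrDl cosD sinD !scalerDr !scalerA addrACA -!scalerDl.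
by rewrite -!rmorphM -!rmorphD; congr (_%:C *: _ + _%:C *: _); ring.
Qed.

Lemma dert_shift (n rho t : R) : dert (n + rho) t =
  (cos (n * t))%:C *: dert rho t + (sin (n * t))%:C *: - ert rho t.
Proof.
rewrite /ert /dert; move: S1 => Z; rewrite mulrDl cosD sinD (opprD (_ *: T1)).
rewrite -[- (_ *: T1)]scaleNr -[- (_ *: Z)]scaleNr !scalerDr !scalerA addrACA -!scalerDl.
by rewrite -!rmorphN -!rmorphM -!rmorphD; congr (_%:C *: _ + _%:C *: _); ring.
Qed.

Definition cT : R := fro T1 + fro S1.

Lemma cT_ge0 : 0 <= cT. Proof. by rewrite addr_ge0 ?fro_ge0. Qed.

Lemma fro_comb (a b c : R) : `|a| <= c -> `|b| <= c ->
  fro (a%:C *: T1 + b%:C *: S1) <= c * cT.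
Proof.
move=> ha hb; apply: le_trans (froD _ _) _; rewrite !froZR mulrDr.
by apply: lerD; rewrite ler_wpM2r ?fro_ge0.
Qed.

Lemma fro_ert rho t : fro (ert rho t) <= cT.
Proof. by rewrite -[leRHS]mul1r; apply: fro_comb; [apply: cos_max|apply: sin_max]. Qed.

Lemma fro_dert rho t : fro (dert rho t) <= cT.
Proof.
by rewrite -[leRHS]mul1r; apply: fro_comb; rewrite ?normrN; [apply: sin_max|apply: cos_max].
Qed.

Lemma ert_lip (r1 r2 t : R) : 0 <= t <= pi -> fro (ert r1 t - ert r2 t) <= pi * cT * `|r1 - r2|.
Proof.
move=> /andP[t0 tpi].
have -> : ert r1 t - ert r2 t = (cos (r1 * t) - cos (r2 * t))%:C *: T1 +
    (sin (r1 * t) - sin (r2 * t))%:C *: S1.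
  by rewrite /ert !rmorphB !scalerBl opprD addrACA.
have h : `|r1 * t - r2 * t| <= pi * `|r1 - r2|.
  by rewrite -mulrBl normrM mulrC (ger0_norm t0) ler_wpM2r.
rewrite mulrAC; apply: fro_comb; apply: le_trans h; [exact: cos_lip|exact: sin_lip].
Qed.

Lemma ert_taylor (rho k t : R) : 0 <= t <= pi ->
  fro (ert (rho + k) t - ert rho t - (k * t)%:C *: dert rho t) <= pi ^+ 2 * cT * k ^+ 2.
Proof.
move=> /andP[t0 tpi].
have -> : ert (rho + k) t - ert rho t - (k * t)%:C *: dert rho t =
    (cos (rho * t + k * t) - cos (rho * t) + k * t * sin (rho * t))%:C *: T1 +
    (sin (rho * t + k * t) - sin (rho * t) - k * t * cos (rho * t))%:C *: S1.
  rewrite /ert /dert; move: S1 => Z; rewrite mulrDl scalerDr !scalerA opprD addrACA -!scalerBl opprD addrACA -!scalerBl.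
  by rewrite -!rmorphM -!rmorphB; congr (_%:C *: _ + _%:C *: _); ring.
have h : (k * t) ^+ 2 <= pi ^+ 2 * k ^+ 2.
  by rewrite exprMn mulrC ler_wpM2r ?sqr_ge0 // ler_sqr ?nnegrE // (le_trans t0).
by rewrite [leRHS]mulrAC; apply: fro_comb; apply: le_trans h; [exact: cos_taylor|exact: sin_taylor].
Qed.

(* Expanding the common shift [rho] of the frequencies leaves cosine and sine sums
   with integer frequencies, which are orthogonal on [0, pi]. *)
Lemma nL_shifted_sum Q (n1 : nat) (rho : R) (P V : 'I_Q -> 'M[C]_m) :
  nL pi (fun t => \sum_(q < Q) (P q *m ert ((n1 + q).+1%:R + rho) t +
                               V q *m (t%:C *: dert ((n1 + q).+1%:R + rho) t))) <=
  4 * pi ^+ 2 * cT * (Num.sqrt (\sum_q fro (P q) ^+ 2) + Num.sqrt (\sum_q fro (V q) ^+ 2)).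
Proof.
have aux (c x y : R) : 0 <= c -> 0 <= x -> 0 <= y ->
    c * x + c * x + (c * y + c * y) <= 4 * c * (x + y).
  by move=> c0 x0 y0; have := mulr_ge0 c0 x0; have := mulr_ge0 c0 y0; lra.
pose gc (q : 'I_Q) (t : R) := cos ((n1 + q).+1%:R * t).
pose gs (q : 'I_Q) (t : R) := sin ((n1 + q).+1%:R * t).
pose sm (g : 'I_Q -> R -> R) (X : 'I_Q -> 'M[C]_m) t := \sum_q (g q t)%:C *: X q.
have cgc q : continuous (gc q) by exact: continuous_cosM.
have cgs q : continuous (gs q) by exact: continuous_sinM.
have csm g X : (forall q, continuous (g q)) -> mcont (sm g X).
  by move=> cg; apply: mcont_sum => q; apply: (mcontZR (F := fun=> X q)) => //; apply: mcont_cst.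
have nq (q q' : 'I_Q) : ((n1 + q).+1 == (n1 + q').+1) = (q == q').
  by rewrite eqSS eqn_add2l.
have bc X : nL pi (sm gc X) <= pi * Num.sqrt (\sum_q fro (X q) ^+ 2).
  by apply: nL_orth_sum => // q q'; rewrite rint_coscos // nq.
have bs X : nL pi (sm gs X) <= pi * Num.sqrt (\sum_q fro (X q) ^+ 2).
  by apply: nL_orth_sum => // q q'; rewrite rint_sinsin // nq.
have ct : continuous (fun t : R => t) by move=> t; apply: cvg_id.
have mtd : mcont (fun t => t%:C *: dert rho t) by apply: (mcontZR (f := id)) => //; apply: mcont_dert.
have mte : mcont (fun t => t%:C *: - ert rho t).
  by apply: (mcontZR (f := id)) => //; apply: mcontN; apply: mcont_ert.
have term g (w : R -> 'M[C]_m) X : (forall q, continuous (g q)) -> mcont w ->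
    (forall t, 0 <= t <= pi -> fro (w t) <= pi * cT) ->
    nL pi (sm g X) <= pi * Num.sqrt (\sum_q fro (X q) ^+ 2) ->
    nL pi (fun t => sm g X t *m w t) <= pi ^+ 2 * cT * Num.sqrt (\sum_q fro (X q) ^+ 2).
  move=> cg cw hw hb; have pc : 0 <= pi * cT by rewrite mulr_ge0 ?pi_ge0 ?cT_ge0.
  apply: le_trans (nL_mulr (csm _ _ cg) cw pc hw) _.
  apply: le_trans (ler_wpM2l pc hb) _.
  by rewrite expr2 !mulrA [pi * cT * pi]mulrAC.
have pi1 : 1 <= pi :> R by apply: le_trans (pi_ge2 R); lra.
have w1 t : 0 <= t <= pi -> fro (ert rho t) <= pi * cT.
  move=> _; apply: le_trans (fro_ert _ _) _; rewrite -[leLHS]mul1r ler_wpM2r ?cT_ge0 //.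
have w2 t : 0 <= t <= pi -> fro (dert rho t) <= pi * cT.
  move=> _; apply: le_trans (fro_dert _ _) _; rewrite -[leLHS]mul1r ler_wpM2r ?cT_ge0 //.
have w3 t : 0 <= t <= pi -> fro (t%:C *: dert rho t) <= pi * cT.
  by move=> /andP[t0 tpi]; rewrite froZR (ger0_norm t0) ler_pM ?fro_ge0 // fro_dert.
have w4 t : 0 <= t <= pi -> fro (t%:C *: - ert rho t) <= pi * cT.
  by move=> /andP[t0 tpi]; rewrite froZR froN (ger0_norm t0) ler_pM ?fro_ge0 // fro_ert.
have split4 t : \sum_(q < Q) (P q *m ert ((n1 + q).+1%:R + rho) t +
      V q *m (t%:C *: dert ((n1 + q).+1%:R + rho) t)) =
    (sm gc P t *m ert rho t + sm gs P t *m dert rho t) +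
    (sm gc V t *m (t%:C *: dert rho t) + sm gs V t *m (t%:C *: - ert rho t)).
  rewrite /sm !mulmx_suml -!big_split /=; apply: eq_bigr => q _.
  rewrite ert_shift dert_shift -/(gc q t) -/(gs q t).
  move: (ert rho t) (dert rho t) (gc q t) (gs q t) (P q) (V q) => A B c s X Y.
  rewrite scalerDr !mulmxDr -!(scalemxAl, scalemxAr) !scalerA.
  by rewrite ![t%:C * _]mulrC.
rewrite (nL_ext (fun t _ => split4 t)).
have m1 : mcont (fun t => sm gc P t *m ert rho t) by apply: mcontM; [apply: csm|apply: mcont_ert].
have m2 : mcont (fun t => sm gs P t *m dert rho t) by apply: mcontM; [apply: csm|apply: mcont_dert].
have m3 : mcont (fun t => sm gc V t *m (t%:C *: dert rho t)) by apply: mcontM => //; apply: csm.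
have m4 : mcont (fun t => sm gs V t *m (t%:C *: - ert rho t)) by apply: mcontM => //; apply: csm.
apply: le_trans (nLD pi (mcontD m1 m2) (mcontD m3 m4)) _.
apply: le_trans (lerD (nLD pi m1 m2) (nLD pi m3 m4)) _.
have t1 := term _ _ P cgc (mcont_ert T1 rho) w1 (bc P).
have t2 := term _ _ P cgs (mcont_dert rho) w2 (bs P).
have t3 := term _ _ V cgc mtd w3 (bc V).
have t4 := term _ _ V cgs mte w4 (bs V).
apply: le_trans (lerD (lerD t1 t2) (lerD t3 t4)) _.
have c0 : 0 <= pi ^+ 2 * cT :> R by rewrite mulr_ge0 ?sqr_ge0 ?cT_ge0.
apply: le_trans (aux _ _ _ c0 (sqrtr_ge0 _) (sqrtr_ge0 _)) _.
by rewrite mulrA.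
Qed.

End TrigSums.

(** * Normalised model solutions and partial sums of the operator *)

Section MainOperator.
Context {R : realType}.
Local Notation C := (R[i]).
Local Notation Re := (@complex.Re R).
Local Notation Im := (@complex.Im R).
Local Open Scope classical_set_scope.
Variables (m : nat) (T1 T2 : 'M[C]_m) (r : 'I_m -> R) (n0 : nat).
Variables (lam : J T1 T2 -> R) (alpha alphat : J T1 T2 -> 'M[C]_m).
Hypothesis m0 : (0 < m)%N.
Hypothesis hT1 : orth_proj T1.
Hypothesis hr01 : forall k, 0 <= r k < 1.
Hypothesis hlam : forall a, 0 <= lam a.
Local Notation S1 := (perp T1).
Local Notation JJT := (JJ T1 T2).
Local Notation rho := (rhoI r lam).
Local Notation lI := (lamI r lam).
Local Notation TT := (TI r lam).
Local Notation Trho := (Trho T1).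
Local Notation ert := (ert T1).
Local Notation Gseq := (@Gseq R m T1 T2 r n0).
Local Notation Bd := (Bd (sameG r n0 (T1 := T1) (T2 := T2)) (drho r lam)).
Implicit Types (a b : JJT) (f : JJT -> 'M[C]_m).

Lemma lamI_sqr b : lI b = rho b ^+ 2.
Proof.
rewrite sqr_sqrtr //; case: b => a [] /=; rewrite /lamI /=; last exact: hlam.
by rewrite sqr_ge0.
Qed.

Lemma rhoI_model (a : J T1 T2) : rho (a, true) = (J1 a)%:R + r (J2 a).
Proof.
rewrite /rhoI /lamI /= sqrtr_sqr ger0_norm // addr_ge0 //.
by case/andP: (hr01 (J2 a)).
Qed.

Definition phiI b (t : R) : 'M[C]_m := phit T1 t (lI b).

Lemma phiI_E b t : phiI b t =
  (cos (rho b * t))%:C *: T1 + (sinc (rho b) t)%:C *: S1.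
Proof. by []. Qed.

Lemma continuous_sinc (u : R) : continuous (sinc u).
Proof.
rewrite /sinc; case: eqP => [_|_]; first by move=> t; apply: cvg_id.
under eq_fun do rewrite mulrC.
by apply: continuousMr; [apply: continuous_cst|apply: continuous_sinM].
Qed.

Lemma mcont_phiI b : mcont (phiI b).
Proof.
apply: mcontD.
  by apply: (mcontZR (F := fun=> T1)); [apply: continuous_cosM|apply: mcont_cst].
by apply: (mcontZR (F := fun=> S1)); [apply: continuous_sinc|apply: mcont_cst].
Qed.

Lemma adj_phiI b t : adjmx (phiI b t) = phiI b t.
Proof. by rewrite phiI_E adjmxD !adjmxZR (projT_adj hT1) (projS_adj hT1). Qed.

Lemma combM (x y z w : C) : (x *: T1 + y *: S1) *m (z *: T1 + w *: S1) =
  (x * z) *: T1 + (y * w) *: S1.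
Proof.
rewrite !(mulmxDl, mulmxDr) -!(scalemxAl, scalemxAr).
rewrite (projTT hT1) (projTS hT1) (projST hT1) (projSS hT1) !scaler0 addr0 add0r.
by rewrite !scalerA.
Qed.

Lemma Trho_phiI b t : Trho (rho b) *m phiI b t = ert (rho b) t.
Proof.
have -> : Trho (rho b) = 1%:C *: T1 + (rho b)%:C *: S1 by rewrite scale1r.
rewrite phiI_E combM mul1r -rmorphM.
congr (_ + _%:C *: _); rewrite /sinc; case: eqVneq => [->|u0].
  by rewrite !mul0r sin0.
by rewrite mulrC divfK.
Qed.

Definition tI b : R := if rho b == 0 then 1 else rho b.

Lemma tI_neq0 b : tI b != 0.
Proof. by rewrite /tI; case: (eqVneq (rho b) 0) => // _; apply: oner_neq0. Qed.

Lemma TI_E b : TT b = T1 + (tI b)%:C *: S1.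
Proof. by rewrite /TI /tI; case: eqP => // _; rewrite scale1r projD. Qed.

Lemma TI_comb b : TT b = 1%:C *: T1 + (tI b)%:C *: S1.
Proof. by rewrite scale1r TI_E. Qed.

Lemma TI_inv b : invmx (TT b) = 1%:C *: T1 + ((tI b)^-1)%:C *: S1.
Proof.
have e : (1%:C *: T1 + ((tI b)^-1)%:C *: S1) *m TT b = 1%:M.
  rewrite TI_comb combM mulr1 -rmorphM mulVf ?tI_neq0 // !scale1r.
  exact: projD.
have [u _] := mulmx1_unit e.
by rewrite -[RHS]mulmx1 -(mulmxV (proj2 (mulmx1_unit e))) mulmxA e mul1mx.
Qed.

Lemma TI_unit b : TT b \in unitmx.
Proof.
have e : (1%:C *: T1 + ((tI b)^-1)%:C *: S1) *m TT b = 1%:M.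
  rewrite TI_comb combM mulr1 -rmorphM mulVf ?tI_neq0 // !scale1r.
  exact: projD.
by case: (mulmx1_unit e).
Qed.

Definition sne (u t : R) : R := if u == 0 then t else sin (u * t).

(** The factor T keeps this bounded as rho grows: for rho nonzero it is [ert (rho b)]. At rho = 0,
    where T = I, its second component is t instead of 0, so the family jumps there. *)
Definition eps b (t : R) : 'M[C]_m := phiI b t *m TT b.

Lemma eps_E b t : eps b t = (cos (rho b * t))%:C *: T1 + (sne (rho b) t)%:C *: S1.
Proof.
rewrite /eps phiI_E TI_comb combM mulr1 -rmorphM; congr (_ + _%:C *: _).
rewrite /sinc /tI /sne; case: eqVneq => [_|u0]; first by rewrite mulr1.
by rewrite divfK.
Qed.

Lemma eps_ert b t : rho b != 0 -> eps b t = ert (rho b) t.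
Proof. by move=> b0; rewrite eps_E /sne (negbTE b0). Qed.

Lemma mcont_eps b : mcont (eps b).
Proof. by apply: mcontM; [apply: mcont_phiI|apply: mcont_cst]. Qed.

Lemma phiI_eps b t : phiI b t = invmx (TT b) *m eps b t.
Proof.
rewrite eps_E TI_inv combM mul1r -rmorphM phiI_E; congr (_ + _%:C *: _).
rewrite /sinc /tI /sne; case: eqVneq => [_|u0]; first by rewrite invr1 mul1r.
by rewrite mulrC.
Qed.

Local Notation cT := (cT T1).

Lemma fro_eps b t : 0 <= t <= pi -> fro (eps b t) <= pi * cT.
Proof.
move=> /andP[t0 tpi]; have p1 : 1 <= pi :> R by apply: le_trans (pi_ge2 R); lra.
rewrite eps_E; apply: fro_comb; first exact: le_trans (cos_max _) p1.
rewrite /sne; case: eqP => _; last exact: le_trans (sin_max _) p1.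
by rewrite ger0_norm.
Qed.

Definition kapJ (a : J T1 T2) : R := Num.sqrt (lam a) - ((J1 a)%:R + r (J2 a)).

Section Gap.
Variable ck : R.
Hypothesis kap_le : forall a : J T1 T2, `|kapJ a| <= ck.

Lemma rhoI_lower b : (J1 b.1)%:R - ck <= rho b.
Proof.
have ck0 : 0 <= ck by apply: le_trans (kap_le b.1).
case: b => a []; rewrite ?rhoI_model /=; have /andP[r0 _] := hr01 (J2 a); first by lra.
have := kap_le a; rewrite /rhoI /lamI /= /kapJ ler_norml => /andP[]; lra.
Qed.

(** As rho >= n - ck, all but finitely many rho exceed 1. The gap compensates for the jump of [eps]
    at rho = 0: any difference quotient against a vanishing rho has a denominator of at least d. *)
Lemma rhoI_gap : exists2 d : R, 0 < d & forall b, rho b = 0 \/ d <= rho b.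
Proof.
have ck0 : 0 <= ck by apply: le_trans (kap_le (Jpos T1 T2 0 (Ordinal m0))).
have fin (s : seq JJT) : exists2 d : R, 0 < d & forall b, b \in s -> rho b = 0 \/ d <= rho b.
  elim: s => [|b s [d d0 hd]]; first by exists 1.
  have [b0|bn0] := eqVneq (rho b) 0.
    by exists d => // b'; rewrite inE => /orP[/eqP ->|/hd //]; left.
  exists (Num.min d (rho b)); first by rewrite lt_min d0 lt_def bn0 rhoI_ge0.
  move=> b'; rewrite inE => /orP[/eqP ->|/hd [->|h]]; first by right; rewrite ge_min lexx orbT.
    by left.
  by right; rewrite ge_min h.
have [d d0 hd] := fin (LL T1 T2 (Num.truncn (ck + 1)).+1).
exists (Num.min d 1); first by rewrite lt_min d0 ltr01.
move=> b; have [bs|bs] := boolP (b \in LL T1 T2 (Num.truncn (ck + 1)).+1).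
  by have [->|h] := hd b bs; [left|right; rewrite ge_min h].
right; rewrite ge_min; apply/orP; right; apply: le_trans (rhoI_lower b).
move: bs; rewrite mem_LL -ltnNge => h.
have h2 : ck + 1 < (J1 b.1)%:R.
  apply: lt_le_trans (_ : (Num.truncn (ck + 1)).+1%:R <= _); last by rewrite ler_nat ltnW.
  by rewrite Num.Theory.truncnS_gt.
lra.
Qed.

Lemma eps_lip : exists2 c2, 0 <= c2 & forall a b t, 0 <= t <= pi ->
  fro (eps a t - eps b t) <= c2 * `|rho a - rho b|.
Proof.
have [d d0 hd] := rhoI_gap.
have pc : 0 <= pi * cT by rewrite mulr_ge0 ?pi_ge0 ?cT_ge0.
have dpc : 0 <= 2 * (pi * cT) / d by apply: divr_ge0; [apply: mulr_ge0|apply: ltW].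
exists (pi * cT + 2 * (pi * cT) / d) => [|a b t tpi]; first by rewrite addr_ge0.
have big : d <= `|rho a - rho b| -> fro (eps a t - eps b t) <=
    (pi * cT + 2 * (pi * cT) / d) * `|rho a - rho b|.
  move=> h; apply: le_trans (froB _ _) _; apply: le_trans (lerD (fro_eps a tpi) (fro_eps b tpi)) _.
  rewrite [leRHS]mulrDl -[leLHS]add0r; apply: lerD; first exact: mulr_ge0.
  rewrite [leRHS]mulrAC ler_pdivlMr //.
  have -> : pi * cT + pi * cT = 2 * (pi * cT) by ring.
  by apply: ler_wpM2l => //; apply: mulr_ge0.
have [a0|an0] := eqVneq (rho a) 0; have [b0|bn0] := eqVneq (rho b) 0.
- by rewrite !eps_E a0 b0 subrr fro0 mulr_ge0 // addr_ge0.
- by apply: big; rewrite a0 sub0r normrN ger0_norm ?rhoI_ge0 //; case: (hd b) => // h; rewrite h eqxx in bn0.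
- by apply: big; rewrite b0 subr0 ger0_norm ?rhoI_ge0 //; case: (hd a) => // h; rewrite h eqxx in an0.
rewrite !eps_ert //; apply: le_trans (ert_lip _ _ _ tpi) _.
by rewrite ler_wpM2r // lerDl.
Qed.

Definition solF (x : R) (F : R -> 'M[C]_m) : JJT -> 'M[C]_m :=
  fun a => mint x (fun t => F t *m eps a t).

Lemma solF_Bd : exists2 c3, 0 <= c3 & forall x F, 0 <= x <= pi -> mcont F ->
  Bd (c3 * nL x F) (solF x F).
Proof.
have [c2 c20 h2] := eps_lip.
have pc : 0 <= pi * cT by rewrite mulr_ge0 ?pi_ge0 ?cT_ge0.
exists (Num.sqrt pi * (pi * cT + c2)) => [|x F /andP[x0 xpi] cF].
  by rewrite mulr_ge0 ?sqrtr_ge0 ?addr_ge0.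
have sx : Num.sqrt x <= Num.sqrt pi by rewrite ler_sqrt // pi_ge0.
split=> [a|a b _].
  apply: le_trans (fro_mint_le cF (mcont_eps a) x0 pc _) _.
    by move=> t /andP[t0 tx]; apply: fro_eps; rewrite t0 (le_trans tx).
  rewrite ler_wpM2r ?nL_ge0 // ler_pM ?sqrtr_ge0 //.
  by rewrite lerDl.
have -> : solF x F a - solF x F b = mint x (fun t => F t *m (eps a t - eps b t)).
  rewrite /solF -mintN; last by apply: mcontM => //; apply: mcont_eps.
  rewrite -mintD; last 2 first.
  - by apply: mcontM => //; apply: mcont_eps.
  - by apply: mcontN; apply: mcontM => //; apply: mcont_eps.
  by apply: mint_ext => t _; rewrite mulmxBr.
have d0 : 0 <= c2 * drho r lam a b by rewrite mulr_ge0 ?drho_ge0.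
apply: le_trans (fro_mint_le cF (mcontB (mcont_eps a) (mcont_eps b)) x0 d0 _) _.
  by move=> t /andP[t0 tx]; apply: h2; rewrite t0 (le_trans tx).
rewrite [leRHS]mulrAC ler_wpM2r ?nL_ge0 // -mulrA ler_pM ?sqrtr_ge0 //.
by rewrite ler_wpM2r ?drho_ge0 // lerDr.
Qed.

End Gap.

Local Notation aI := (alphaI r lam alpha alphat).

Definition cf f b : 'M[C]_m := (-1) ^+ b.2 *: (f b *m invmx (TT b) *m aI b).
Definition blk f (k : nat) (t : R) : 'M[C]_m := \sum_(b <- Gseq k) cf f b *m phiI b t.
Definition FN f (N : nat) (t : R) : 'M[C]_m := \sum_(k < N) blk f k t.

Lemma mcont_blk f k : mcont (blk f k).
Proof. by apply: mcont_sum => b; apply: mcontM; [apply: mcont_cst|apply: mcont_phiI]. Qed.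

Lemma mcont_FN f N : mcont (FN f N).
Proof. by apply: mcont_sum => k; apply: mcont_blk. Qed.

Lemma mint_sumphi x (s : seq JJT) (c : JJT -> 'M[C]_m) a :
  mint x (fun t => (\sum_(b <- s) c b *m phiI b t) *m phiI a t) =
  \sum_(b <- s) c b *m Dt T1 x (lI b) (lI a).
Proof.
rewrite (@mint_ext _ _ _ _ _ (fun t => \sum_(b <- s) c b *m (phiI b t *m phiI a t))).
  rewrite mint_sum; last first.
    by move=> b; apply: mcontM; [apply: mcont_cst|apply: mcontM; apply: mcont_phiI].
  by apply: eq_bigr => b _; rewrite mint_mulmxl //; apply: mcontM; apply: mcont_phiI.
by move=> t _; rewrite mulmx_suml; apply: eq_bigr => b _; rewrite mulmxA.
Qed.

Lemma Rblock_mint x f k a : Rblock r n0 lam alpha alphat x f k a =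
  mint x (fun t => blk f k t *m phiI a t) *m TT a.
Proof.
rewrite /Rblock sum_Gseq // mint_sumphi mulmx_suml; apply: eq_bigr => b _.
by rewrite /cf -!scalemxAl.
Qed.

Lemma Rpartial_solF x f a N : Rpartial r n0 lam alpha alphat x f a N = solF x (FN f N) a.
Proof.
rewrite /Rpartial /solF /FN; under eq_bigr do rewrite Rblock_mint.
rewrite -mulmx_suml -mint_sum; last by move=> k; apply: mcontM; [apply: mcont_blk|apply: mcont_phiI].
rewrite -mint_mulmxr; last first.
  by apply: mcont_sum => k; apply: mcontM; [apply: mcont_blk|apply: mcont_phiI].
by apply: mint_ext => t _; rewrite /eps mulmxA; congr (_ *m _); rewrite mulmx_suml.
Qed.

Lemma cf_lin (A : 'M[C]_m) f g b : cf (fun a => A *m f a + g a) b = A *m cf f b + cf g b.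
Proof. by rewrite /cf !mulmxDl scalerDr -scalemxAr !mulmxA. Qed.

Lemma FN_lin (A : 'M[C]_m) f g N t :
  FN (fun a => A *m f a + g a) N t = A *m FN f N t + FN g N t.
Proof.
rewrite /FN mulmx_sumr -big_split; apply: eq_bigr => k _ /=.
rewrite /blk mulmx_sumr -big_split; apply: eq_bigr => b _ /=.
by rewrite cf_lin mulmxDl mulmxA.
Qed.

(** The constant is not uniform in k; this serves for the finitely many blocks that precede the
    Cauchy estimate. *)
Lemma blk_bound k : exists2 c, 0 <= c & forall d f, Bd d f -> nL pi (blk f k) <= c * d.
Proof.
exists (\sum_(b <- Gseq k) fro (invmx (TT b) *m aI b) * nL pi (phiI b)) => [|d f [hf _]].
  by apply: sumr_ge0 => b _; rewrite mulr_ge0 ?fro_ge0 ?nL_ge0.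
apply: le_trans (nL_sum _ _ _ _) _.
  by move=> b; apply: mcontM; [apply: mcont_cst|apply: mcont_phiI].
rewrite mulr_suml; apply: ler_sum => b _.
apply: le_trans (nL_mull _ _ (mcont_phiI b)) _.
rewrite [leRHS]mulrAC ler_wpM2r ?nL_ge0 // mulrC.
have -> : fro (cf f b) = fro (f b *m (invmx (TT b) *m aI b)).
  by rewrite /cf froZ mulmxA; case: b.2; rewrite ?expr0 ?expr1 ?cmodN -[1]/(1%:C) cmodR normr1 mul1r.
by apply: le_trans (froM _ _) _; rewrite ler_wpM2r ?fro_ge0.
Qed.

End MainOperator.

(** * Asymptotics of the normalised weights in a block *)

Section Asymptotics.
Context {R : realType}.
Local Notation C := (R[i]).
Local Notation Re := (@complex.Re R).
Local Notation Im := (@complex.Im R).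
Local Open Scope classical_set_scope.
Variables (m : nat) (T1 T2 : 'M[C]_m) (r : 'I_m -> R) (n0 : nat).
Variables (A : 'I_m -> 'M[C]_m).
Variables (lam : J T1 T2 -> R) (alpha alphat : J T1 T2 -> 'M[C]_m).
Hypothesis m0 : (0 < m)%N.
Hypothesis hT1 : orth_proj T1.
Hypothesis hT2 : orth_proj T2.
Hypothesis hr : zeros_of_detW0 T1 T2 r.
Hypothesis hA : is_A T1 T2 r A.
Hypothesis halphat : forall a : J T1 T2, is_model_weight T1 T2 (lamt r a)%:C (alphat a).
Hypothesis hpsd : forall a, psd (alpha a).
Local Notation S1 := (perp T1).
Local Notation JT := (J T1 T2).
Local Notation JJT := (JJ T1 T2).
Local Notation rho := (rhoI r lam).
Local Notation TT := (TI r lam).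
Local Notation Trho := (Trho T1).
Local Notation nJ := #|calJ r|.
Local Notation aI := (alphaI r lam alpha alphat).
Local Notation kapJ := (kapJ r lam).
Local Notation Jp := (Jpos T1 T2).

Let hr01 k : 0 <= r k < 1. Proof. by case: hr. Qed.
Let r_mono (j k : 'I_m) : (j <= k)%N -> r j <= r k. Proof. by case: hr => _ h _; apply: h. Qed.

Lemma A_props k : [/\ adjmx (A k) = A k, A k *m A k = A k, Wr T1 T2 (r k) *m A k = 0 &
  forall V : 'M[C]_m, Wr T1 T2 (r k) *m V = 0 -> A k *m V = V].
Proof.
have [B hB ->] := hA k; have [_ _ hz] := hr.
by have [_] := is_A_props hT1 hT2 (hz _ (hr01 k)) hB.
Qed.

Lemma alphat_E (a : JT) : alphat a = (cw (rho (a, true)))%:C *: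
  (Trho (rho (a, true)) *m A (J2 a) *m Trho (rho (a, true))).
Proof.
rewrite rhoI_model //; have [B hB eA] := hA (J2 a); have [_ _ hz] := hr.
have hzk := hz _ (hr01 (J2 a)).
have [hl _] := is_A_props hT1 hT2 hzk hB; rewrite eA.
have /andP[rk0 _] := hr01 (J2 a).
exact: (model_weightE hT1 hT2 rk0 hzk hl (halphat a)).
Qed.

Lemma nat_frac_inj (n n' : nat) (x x' : R) : 0 <= x < 1 -> 0 <= x' < 1 ->
  n%:R + x = n'%:R + x' -> n = n' /\ x = x'.
Proof.
move=> /andP[x0 x1] /andP[x'0 x'1] e.
have lt (p q : nat) (y y' : R) : 0 <= y -> y' < 1 -> p%:R + y = q%:R + y' -> (p <= q)%N.
  move=> y0 y'1 e'; rewrite -ltnS -(ltr_nat R) -natr1.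
  by apply: le_lt_trans (_ : p%:R + y < _); [lra|rewrite e'; lra].
have nn' : n = n'.
  apply/eqP; rewrite eqn_leq (lt n n' x x') //=.
  by rewrite (lt n' n x' x).
by split=> //; move: e; rewrite nn' => /addrI.
Qed.

Lemma lamt_inj (a b : JT) : lamt r a = lamt r b -> J1 a = J1 b /\ r (J2 a) = r (J2 b).
Proof.
rewrite /lamt => /eqP; rewrite eqrXn2 //; try by rewrite addr_ge0 //; case/andP: (hr01 (J2 a)) (hr01 (J2 b)) => ? ? /andP[].
by move=> /eqP /nat_frac_inj; apply.
Qed.

(** [r] is nondecreasing, so equal values are consecutive, and the larger of two such indices would
    have a predecessor with the same value. *)
Lemma calJ_inj (k k' : 'I_m) : k \in calJ r -> k' \in calJ r -> r k = r k' -> k = k'.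
Proof.
wlog kk' : k k' / (k <= k')%N => [h|].
  by have [/h//|/ltnW /h h'] := leqP k k' => kJ k'J e; apply/esym/h'.
move=> _ k'J e; apply/eqP; apply: contraT => ne.
have lt : (k < k')%N by rewrite ltn_neqAle kk' andbT.
have k'0 : (0 < k')%N by apply: leq_ltn_trans lt.
have jlt : (k'.-1 < m)%N by apply: leq_ltn_trans (leq_pred _) (ltn_ord k').
move: k'J; rewrite inE => /forallP /(_ (Ordinal jlt)) /implyP.
rewrite /= prednK // eqxx => /(_ isT) /eqP []; apply/eqP.
rewrite eq_le; apply/andP; split; last by apply: r_mono => /=; apply: leq_pred.
by rewrite -e; apply: r_mono => /=; rewrite -ltnS prednK.
Qed.

(** In a group of equal model eigenvalues the primed weight sits at the first index, which is the
    representative in [calJ]. *)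
Lemma alphaI_model n (k j : 'I_m) : k \in calJ r -> r j = r k ->
  aI (Jp n j, true) = if j == k then alphat (Jp n j) else 0.
Proof.
move=> kJ rjk; rewrite /alphaI /= /prime_of; case: eqVneq => [jk|jk].
  case: asboolP => // -[b [blt be]]; have [e1 e2] := lamt_inj be.
  case: blt => [|[_ lt]]; first by rewrite e1 ltnn.
  have [s e3 e4] := calJ_rep r (J2 b).
  have sk : enum_val s = k.
    by apply: calJ_inj => //; [apply: enum_valP|rewrite e3 e2 -rjk].
  by move: e4; rewrite sk leqNgt -jk lt.
case: asboolP => // -[]; exists (Jp n k).
have [s e3 e4] := calJ_rep r j.
have sk : enum_val s = k.
  by apply: calJ_inj => //; [apply: enum_valP|rewrite e3 rjk].
split; last by rewrite /lamt /J1 /J2 /= rjk.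
right; split=> //; rewrite sk in e4.
by rewrite ltn_neqAle e4 andbT eq_sym.
Qed.

(** Writing phi~ as T^(-1) [eps] puts the weight between two factors T^(-1). This conjugate stays
    bounded, although alpha' may grow like n^2. *)
Definition aa (b : JJT) : 'M[C]_m := invmx (TT b) *m aI b *m invmx (TT b).
Definition rho0 q (s : 'I_nJ) : R := (n0 + q).+1%:R + r (enum_val s).

Lemma cf_phiI f (b : JJT) t : cf r lam alpha alphat f b *m phiI r lam b t =
  (-1) ^+ b.2 *: (f b *m aa b *m eps r lam b t).
Proof.
rewrite phiI_eps // /cf /aa -!scalemxAl !mulmxA.
by [].
Qed.

Lemma rho_model_block q (s : 'I_nJ) j : r j = r (enum_val s) -> rho (Jp (n0 + q) j, true) = rho0 q s.
Proof. by move=> e; rewrite rhoI_model // /rho0 -e. Qed.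

Lemma rho0_gt0 q s : 0 < rho0 q s.
Proof.
by rewrite /rho0 ltr_wpDr // ?ltr0n //; case/andP: (hr01 (enum_val s)).
Qed.

Lemma aa_model q (s : 'I_nJ) : \sum_(j | r j == r (enum_val s)) aa (Jp (n0 + q) j, true) =
  (2 / pi)%:C *: A (enum_val s).
Proof.
rewrite (bigD1 (enum_val s)) //= big1 ?addr0 => [|j /andP[/eqP rj js]]; last first.
  rewrite /aa (alphaI_model _ (enum_valP s) rj) (negbTE js).
  by rewrite mulmx0 mul0mx.
rewrite /aa (alphaI_model _ (enum_valP s) (erefl _)) eqxx alphat_E.
have e : rho (Jp (n0 + q) (enum_val s), true) = rho0 q s by apply: rho_model_block.
have r0 : rho0 q s != 0 by rewrite gt_eqF // rho0_gt0.
have eT : Trho (rho0 q s) = TT (Jp (n0 + q) (enum_val s), true).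
  by rewrite (TI_E r lam) /tI e (negbTE r0).
rewrite e eT /cw (negbTE r0) -scalemxAr -scalemxAl; congr (_ *: _).
by rewrite !mulmxA mulVmx ?TI_unit // mul1mx -mulmxA mulmxV ?TI_unit // mulmx1.
Qed.

Section WithK.
Variable K : nat -> 'I_m -> 'M[C]_m.
Hypothesis hK : forall (n : nat) (k : 'I_m), k \in calJ r ->
  \sum_(s | r s == r k) prime_of lam alpha (Jp n s) =
  (2 / pi)%:C *: ((T1 + n.+1%:R *: S1) *m (A k + K n k) *m (T1 + n.+1%:R *: S1)).
Variables ck cK : R.
Hypothesis kap_le : forall a : JT, `|kapJ a| <= ck.
Hypothesis K_le : forall n k, k \in calJ r -> fro (K n k) <= cK.

(** The size of the perturbation in a block. The last term pays for replacing n by rho in the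
    factors T1 + n T1^perp of condition (ii). *)
Definition xi q (s : 'I_nJ) : R :=
  \sum_(j | r j == r (enum_val s)) `|kapJ (Jp (n0 + q) j)| +
  fro (K (n0 + q) (enum_val s)) + ((n0 + q).+1%:R)^-1.

Lemma xi_ge0 q s : 0 <= xi q s.
Proof. by rewrite /xi !addr_ge0 ?fro_ge0 ?invr_ge0 // sumr_ge0. Qed.

Lemma kap_le_xi q (s : 'I_nJ) : \sum_(j | r j == r (enum_val s)) `|kapJ (Jp (n0 + q) j)| <= xi q s.
Proof. by rewrite /xi -addrA lerDl addr_ge0 ?fro_ge0 ?invr_ge0. Qed.
Lemma K_le_xi q (s : 'I_nJ) : fro (K (n0 + q) (enum_val s)) <= xi q s.
Proof. by rewrite /xi addrAC lerDr addr_ge0 ?invr_ge0 // sumr_ge0. Qed.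
Lemma inv_le_xi q (s : 'I_nJ) : ((n0 + q).+1%:R)^-1 <= xi q s.
Proof. by rewrite /xi lerDr addr_ge0 ?fro_ge0 // sumr_ge0. Qed.

Let Nm (u : R) : 'M[C]_m := 1%:C *: T1 + u%:C *: S1.
Let NmM u v : Nm u *m Nm v = Nm (u * v).
Proof. by rewrite /Nm (combM hT1) mulr1 -rmorphM. Qed.
Let Nm1 : Nm 1 = 1%:M. Proof. by rewrite /Nm !scale1r projD. Qed.
Let Nm_adj u : adjmx (Nm u) = Nm u.
Proof. by rewrite adjmxD !adjmxZR (projT_adj hT1) (projS_adj hT1). Qed.
Let Nm_sub1 u : Nm u - 1%:M = (u - 1)%:C *: S1.
Proof. by rewrite -Nm1 /Nm opprD addrACA subrr add0r -scalerBl -rmorphB. Qed.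

Lemma aI_rpsd a : rpsd (aI (a, false)).
Proof.
rewrite /alphaI /= /prime_of; case: asboolP => _; first exact: rpsd0.
exact: psd_rpsd.
Qed.

(** Condition (ii) controls only the sum over a group. Each summand is positive, so its norm is
    bounded by its trace and hence by the trace of the sum. Passing from n to rho multiplies T1^perp
    by n / rho = 1 + O(1/n) on both sides, which the individual bounds turn into an error of order
    1/n. *)
Lemma aa_est : exists2 Ca, 0 <= Ca & exists Q0, forall q (s : 'I_nJ), (Q0 <= q)%N ->
  (forall j, r j = r (enum_val s) -> rho (Jp (n0 + q) j, false) != 0 /\
     fro (aa (Jp (n0 + q) j, false)) <= Ca) /\
  fro (\sum_(j | r j == r (enum_val s)) aa (Jp (n0 + q) j, false) -
       (2 / pi)%:C *: A (enum_val s)) <= Ca * xi q s.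
Proof.
have ck0 : 0 <= ck by apply: le_trans (kap_le (Jp 0 (Ordinal m0))).
pose cA := \sum_k fro (A k).
have cA_le k : fro (A k) <= cA.
  by rewrite /cA (bigD1 k) //= lerDl sumr_ge0 // => j _; apply: fro_ge0.
have cK0 : 0 <= cK.
  have [s _ _] := calJ_rep r (Ordinal m0).
  exact: le_trans (fro_ge0 _) (K_le 0 (enum_valP s)).
have p20 : 0 <= 2 / pi :> R by rewrite divr_ge0 ?pi_ge0.
pose Ch := Num.sqrt m%:R * (2 / pi * (cA + cK)).
have cA0 : 0 <= cA by apply: sumr_ge0 => j _; apply: fro_ge0.
have Ch0 : 0 <= Ch.
  by apply: mulr_ge0; [exact: sqrtr_ge0|apply: mulr_ge0 => //; exact: addr_ge0].
pose C2 := 2 * (1 + ck); have C20 : 0 <= C2 by rewrite mulr_ge0 // addr_ge0.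
pose CY := fro (1%:M : 'M[C]_m) + C2 * fro S1.
have CY0 : 0 <= CY by apply: addr_ge0; [exact: fro_ge0|apply: mulr_ge0 => //; exact: fro_ge0].
pose CD := C2 * fro S1 * Ch * CY + Ch * (C2 * fro S1).
have s10 := fro_ge0 S1; have Cs0 : 0 <= C2 * fro S1 by exact: mulr_ge0.
have CD0 : 0 <= CD by apply: addr_ge0; [do 2 (apply: mulr_ge0 => //)|exact: mulr_ge0].
have CC0 : 0 <= m%:R * CD + 2 / pi :> R by apply: addr_ge0 => //; apply: mulr_ge0.
have CYC0 : 0 <= CY * Ch * CY by apply: mulr_ge0 => //; apply: mulr_ge0.
exists (CY * Ch * CY + (m%:R * CD + 2 / pi)); first exact: addr_ge0.
(* Ensures n > 2 ck + 1, whence rho >= n / 2 and n / rho - 1 is of order 1 / n. *)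
exists (Num.truncn (2 * ck + 1)).+1 => q s qQ.
pose nr : R := (n0 + q).+1%:R.
have nr_big : 2 * ck + 1 < nr.
  apply: lt_le_trans (_ : (Num.truncn (2 * ck + 1)).+1%:R <= _); first by rewrite Num.Theory.truncnS_gt.
  by rewrite ler_nat; apply: leq_trans qQ _; apply: leqW; apply: leq_addl.
have nr1 : 1 <= nr by rewrite ler1n.
have nr0 : 0 < nr by apply: lt_le_trans nr1.
have nrn0 : nr != 0 by rewrite gt_eqF.
(* With n in place of rho in the conjugation, condition (ii) becomes an exact identity for the
   sum. *)
pose ah j := Nm nr^-1 *m aI (Jp (n0 + q) j, false) *m Nm nr^-1.
have sum_ah : \sum_(j | r j == r (enum_val s)) ah j =
    (2 / pi)%:C *: (A (enum_val s) + K (n0 + q) (enum_val s)).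
  rewrite /ah -mulmx_suml -mulmx_sumr.
  have -> : \sum_(j | r j == r (enum_val s)) aI (Jp (n0 + q) j, false) =
      (2 / pi)%:C *: (Nm nr *m (A (enum_val s) + K (n0 + q) (enum_val s)) *m Nm nr).
    have -> : Nm nr = T1 + (n0 + q).+1%:R *: S1 by rewrite /Nm scale1r rmorph_nat.
    rewrite -hK ?enum_valP //.
  rewrite -scalemxAr -scalemxAl; congr (_ *: _).
  rewrite !mulmxA NmM mulVf // Nm1 mul1mx -mulmxA NmM divff // Nm1 mulmx1.
  by [].
have ah_psd j : rpsd (ah j) by apply: rpsd_conj; [apply: aI_rpsd|apply: Nm_adj].
have ah_le j : r j = r (enum_val s) -> fro (ah j) <= Ch.
  move=> rj; apply: le_trans (rpsd_fro_le_tr (ah_psd j)) _.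
  apply: le_trans (_ : Re (\tr (\sum_(j | r j == r (enum_val s)) ah j)) <= _).
    have -> : Re (\tr (\sum_(j | r j == r (enum_val s)) ah j)) =
        \sum_(j | r j == r (enum_val s)) Re (\tr (ah j)).
      apply: (big_morph (fun B : 'M[C]_m => Re (\tr B))) => [x y|]; last by rewrite mxtrace0.
      by rewrite mxtraceD ReD.
    rewrite [leRHS](bigD1 j (introT eqP rj)) /=.
    by rewrite lerDl sumr_ge0 // => i _; apply: le_trans (fro_ge0 _) (rpsd_fro_le_tr (ah_psd i)).
  rewrite sum_ah; apply: le_trans (Re_tr_le _) _; rewrite ler_wpM2l ?sqrtr_ge0 //.
  rewrite froZR ger0_norm // ler_wpM2l //; apply: le_trans (froD _ _) _.
  by apply: lerD; [apply: cA_le|apply: K_le; apply: enum_valP].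
have rho_est j : r j = r (enum_val s) -> rho (Jp (n0 + q) j, false) != 0 /\
    `|nr / rho (Jp (n0 + q) j, false) - 1| <= C2 / nr.
  move=> rj; have e : rho (Jp (n0 + q) j, false) = nr + (r j + kapJ (Jp (n0 + q) j)).
    rewrite /kapJ -/(rho (Jp (n0 + q) j, false)) /J1 /J2 /= -/nr.
    by rewrite /rhoI /lamI /=; ring.
  have := kap_le (Jp (n0 + q) j); rewrite ler_norml => /andP[k1 k2].
  have /andP[r0 r1] := hr01 j.
  have h2 : nr / 2 <= rho (Jp (n0 + q) j, false) by rewrite e; lra.
  have hp : 0 < rho (Jp (n0 + q) j, false) by apply: lt_le_trans h2; lra.
  split; first by rewrite gt_eqF.
  have -> : nr / rho (Jp (n0 + q) j, false) - 1 =
      (nr - rho (Jp (n0 + q) j, false)) / rho (Jp (n0 + q) j, false).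
    by field; rewrite gt_eqF.
  rewrite normrM normfV (gtr0_norm hp) ler_pdivrMr //.
  apply: le_trans (_ : 1 + ck <= _).
    by rewrite e ler_norml; apply/andP; split; lra.
  apply: le_trans (_ : C2 / nr * (nr / 2) <= _); last by rewrite ler_wpM2l ?divr_ge0 ?(ltW nr0).
  by rewrite /C2 le_eqVlt; apply/orP; left; apply/eqP; field.
have aaE j : r j = r (enum_val s) -> aa (Jp (n0 + q) j, false) =
    Nm (nr / rho (Jp (n0 + q) j, false)) *m ah j *m Nm (nr / rho (Jp (n0 + q) j, false)).
  move=> rj; have [rn0 _] := rho_est j rj.
  have -> : aa (Jp (n0 + q) j, false) = Nm (rho (Jp (n0 + q) j, false))^-1 *m
     aI (Jp (n0 + q) j, false) *m Nm (rho (Jp (n0 + q) j, false))^-1.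
    have eTI : invmx (TT (Jp (n0 + q) j, false)) = Nm (rho (Jp (n0 + q) j, false))^-1.
      by rewrite (TI_inv r lam hT1) /tI (negbTE rn0).
    by rewrite /aa eTI.
  rewrite /ah; move: (aI _) (rho _) rn0 => B u un0.
  have q1 : nr / u / nr = u^-1 by rewrite mulrAC divff // mul1r.
  have q2 : nr^-1 * (nr / u) = u^-1 by rewrite mulrA mulVf // mul1r.
  have e1 := etrans (NmM (nr / u) nr^-1) (congr1 Nm q1).
  have e2 := etrans (NmM nr^-1 (nr / u)) (congr1 Nm q2).
  move: e1 e2; move: (Nm (nr / u)) (Nm nr^-1) (Nm u^-1) => Y V W <- e2.
  by rewrite -!mulmxA e2.
have Ym1 j : r j = r (enum_val s) ->
    fro (Nm (nr / rho (Jp (n0 + q) j, false)) - 1%:M) <= C2 * fro S1 / nr.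
  move=> rj; have [_ h] := rho_est j rj.
  by rewrite Nm_sub1 froZR mulrAC ler_wpM2r ?fro_ge0.
have Y_le j : r j = r (enum_val s) -> fro (Nm (nr / rho (Jp (n0 + q) j, false))) <= CY.
  move=> rj; rewrite -[Nm _](subrK 1%:M); apply: le_trans (froD _ _) _.
  rewrite addrC lerD2l; apply: le_trans (Ym1 j rj) _.
  by rewrite ler_pdivrMr // ler_peMr // mulr_ge0 ?fro_ge0.
have aa_ah j : r j = r (enum_val s) -> fro (aa (Jp (n0 + q) j, false) - ah j) <= CD / nr.
  move=> rj; rewrite aaE //; set Y := Nm _.
  have -> : Y *m ah j *m Y - ah j = (Y - 1%:M) *m ah j *m Y + ah j *m (Y - 1%:M).
    by rewrite mulmxBl mul1mx mulmxBl mulmxBr mulmx1 addrA subrK.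
  apply: le_trans (froD _ _) _; rewrite /CD [leRHS]mulrDl; apply: lerD.
    apply: le_trans (froM _ _) _; rewrite mulrAC ler_pM ?fro_ge0 ?Y_le //.
    apply: le_trans (froM _ _) _; rewrite mulrAC ler_pM ?fro_ge0 ?ah_le //.
    exact: Ym1.
  by apply: le_trans (froM _ _) _; rewrite -mulrA ler_pM ?fro_ge0 ?ah_le // Ym1.
split.
  move=> j rj; split; first by case: (rho_est j rj).
  rewrite aaE //; apply: le_trans (_ : CY * Ch * CY <= _); last by rewrite lerDl.
  apply: le_trans (froM _ _) _; rewrite ler_pM ?fro_ge0 ?Y_le //.
  by apply: le_trans (froM _ _) _; rewrite ler_pM ?fro_ge0 ?Y_le ?ah_le.
apply: le_trans (_ : (m%:R * CD + 2 / pi) * xi q s <= _); last first.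
  by rewrite ler_wpM2r ?xi_ge0 // lerDr.
have -> : \sum_(j | r j == r (enum_val s)) aa (Jp (n0 + q) j, false) - (2 / pi)%:C *: A (enum_val s) =
    \sum_(j | r j == r (enum_val s)) (aa (Jp (n0 + q) j, false) - ah j) +
    (2 / pi)%:C *: K (n0 + q) (enum_val s).
  by rewrite sumrB sum_ah scalerDr opprD addrA subrK.
apply: le_trans (froD _ _) _; rewrite [leRHS]mulrDl; apply: lerD; last first.
  by rewrite froZR ger0_norm // ler_wpM2l // K_le_xi.
apply: le_trans (fro_sum _ _ _) _.
apply: le_trans (_ : \sum_(j | r j == r (enum_val s)) CD / nr <= _).
  by apply: ler_sum => j /eqP rj; apply: aa_ah.
rewrite sumr_const -[leLHS]mulr_natl -[leRHS]mulrA.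
apply: ler_pM; rewrite ?ler0n ?divr_ge0 ?(ltW nr0) //.
  by rewrite ler_nat; apply: leq_trans (max_card _) _; rewrite card_ord.
by rewrite ler_wpM2l // inv_le_xi.
Qed.

End WithK.
End Asymptotics.

Section SquareSums.
Context {R : realType}.

Lemma sum_norm_sqr_le n (P : pred 'I_n) (a : 'I_n -> R) :
  (\sum_(j | P j) `|a j|) ^+ 2 <= n%:R * \sum_j a j ^+ 2.
Proof.
apply: le_trans (_ : (\sum_j 1 * `|a j|) ^+ 2 <= _).
  under [in leRHS]eq_bigr do rewrite mul1r.
  rewrite ler_sqr ?nnegrE ?sumr_ge0 // [leRHS](bigID P) /= lerDl.
  by apply: sumr_ge0.
apply: le_trans (sum_sqr_CS _ _) _.
rewrite expr1n sumr_const card_ord; under eq_bigr do rewrite real_normK ?num_real //.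
by [].
Qed.

Lemma sqr3_le (a b c : R) : (a + b + c) ^+ 2 <= 3 * (a ^+ 2 + b ^+ 2 + c ^+ 2).
Proof.
have := sqr_ge0 (a - b); have := sqr_ge0 (a - c); have := sqr_ge0 (b - c); nra.
Qed.

End SquareSums.

(** * First-order expansion of the blocks and the Cauchy property *)

Section BlockAsymptotics.
Context {R : realType}.
Local Notation C := (R[i]).
Local Notation Re := (@complex.Re R).
Local Notation Im := (@complex.Im R).
Local Open Scope classical_set_scope.
Variables (m : nat) (T1 T2 : 'M[C]_m) (r : 'I_m -> R) (n0 : nat).
Variables (A : 'I_m -> 'M[C]_m).
Variables (lam : J T1 T2 -> R) (alpha alphat : J T1 T2 -> 'M[C]_m).
Hypothesis m0 : (0 < m)%N.
Hypothesis hT1 : orth_proj T1.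
Hypothesis hT2 : orth_proj T2.
Hypothesis hr : zeros_of_detW0 T1 T2 r.
Hypothesis hA : is_A T1 T2 r A.
Hypothesis halphat : forall a : J T1 T2, is_model_weight T1 T2 (lamt r a)%:C (alphat a).
Hypothesis hpsd : forall a, psd (alpha a).
Local Notation S1 := (perp T1).
Local Notation JT := (J T1 T2).
Local Notation JJT := (JJ T1 T2).
Local Notation rho := (rhoI r lam).
Local Notation ert := (ert T1).
Local Notation dert := (dert T1).
Local Notation Bd := (Bd (sameG r n0 (T1 := T1) (T2 := T2)) (drho r lam)).
Local Notation nJ := #|calJ r|.
Local Notation kapJ := (kapJ r lam).
Local Notation cT := (cT T1).
Local Notation Jp := (Jpos T1 T2).

Section WithK.
Variable K : nat -> 'I_m -> 'M[C]_m.
Hypothesis hK : forall (n : nat) (k : 'I_m), k \in calJ r ->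
  \sum_(s | r s == r k) prime_of lam alpha (Jp n s) =
  (2 / pi)%:C *: ((T1 + n.+1%:R *: S1) *m (A k + K n k) *m (T1 + n.+1%:R *: S1)).
Hypothesis kap_sum : (\esum_(a in [set: JT]) (kapJ a ^+ 2)%:E < +oo)%E.
Hypothesis K_sum : (\esum_(a in [set a : nat * 'I_m | a.2 \in calJ r])
  (mxnorm (K a.1 a.2) ^+ 2)%:E < +oo)%E.
Local Notation xi := (@xi R m T1 T2 r n0 lam K).
Local Notation rho0 := (@rho0 R m r n0).

Lemma kap_bounded : exists ck, forall a : JT, `|kapJ a| <= ck.
Proof.
have [S hS] := esum_seq_bound (fun a => sqr_ge0 (kapJ a)) kap_sum.
exists (S + 1) => a; have := hS [:: a] (erefl _) (fun _ _ => I).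
rewrite big_seq1 -(real_normK (num_real (kapJ a))).
by have := normr_ge0 (kapJ a); move: `|kapJ a| => u; nra.
Qed.

Lemma K_bounded : exists cK, forall n k, k \in calJ r -> fro (K n k) <= cK.
Proof.
have [S hS] := esum_seq_bound (fun a : nat * 'I_m => sqr_ge0 (mxnorm (K a.1 a.2))) K_sum.
exists ((m ^ 2)%:R * (S + 1)) => n k kJ.
apply: le_trans (fro_le_mxnorm _) _; rewrite ler_wpM2l //.
have := hS [:: (n, k)] (erefl _); rewrite big_seq1 /= => /(_ _).
have h x : x \in [:: (n, k)] -> x.2 \in calJ r by rewrite inE => /eqP ->.
by move=> /(_ h); have := mxnorm_ge0 (K n k); move: (mxnorm _) => u; nra.
Qed.

Lemma xi_sum : exists S, forall Q, \sum_(q < Q) \sum_s xi q s ^+ 2 <= S.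
Proof.
have [Sk hk] := esum_seq_bound (fun a => sqr_ge0 (kapJ a)) kap_sum.
have [SK hKs] := esum_seq_bound (fun a : nat * 'I_m => sqr_ge0 (mxnorm (K a.1 a.2))) K_sum.
exists (3 * (nJ%:R * (m%:R * Sk) + (m ^ 2)%:R ^+ 2 * SK + nJ%:R * 2)) => Q.
have hk' : \sum_(q < Q) \sum_j kapJ (Jp (n0 + q) j) ^+ 2 <= Sk.
  have := hk [seq Jp (n0 + q) j | q : 'I_Q <- enum 'I_Q, j <- enum 'I_m].
  rewrite big_allpairs_dep big_enum /=; under eq_bigr do rewrite big_enum /=; apply=> //.
  apply: allpairs_uniq; rewrite ?enum_uniq // => -[q j] [q' j'] _ _ /= [/addnI/val_inj -> ->].
  by [].
have hK' : \sum_(q < Q) \sum_(s < nJ) mxnorm (K (n0 + q) (enum_val s)) ^+ 2 <= SK.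
  have := hKs [seq ((n0 + q)%N, enum_val s) | q : 'I_Q <- enum 'I_Q, s : 'I_nJ <- enum 'I_nJ].
  rewrite big_allpairs_dep big_enum /=; under eq_bigr do rewrite big_enum /=; apply.
    apply: allpairs_uniq; rewrite ?enum_uniq // => -[q j] [q' j'] _ _ /= [/addnI/val_inj ->].
    by move=> /enum_val_inj ->.
  by move=> x /allpairsP [[q s] /= [_ _ ->]] /=; apply: enum_valP.
apply: le_trans (_ : \sum_(q < Q) \sum_(s < nJ) 3 * (m%:R * (\sum_j kapJ (Jp (n0 + q) j) ^+ 2) +
    (m ^ 2)%:R ^+ 2 * mxnorm (K (n0 + q) (enum_val s)) ^+ 2 + q.+1%:R ^- 2) <= _).
  apply: ler_sum => q _; apply: ler_sum => s _; apply: le_trans (sqr3_le _ _ _) _.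
  rewrite ler_wpM2l //; apply: lerD; first apply: lerD.
  - exact: sum_norm_sqr_le.
  - rewrite -exprMn ler_sqr ?nnegrE ?fro_ge0 ?mulr_ge0 ?mxnorm_ge0 //.
    exact: fro_le_mxnorm.
  - rewrite exprVn lef_pV2 ?posrE ?exprn_gt0 ?ltr0n // ler_sqr ?nnegrE //.
    by rewrite ler_nat ltnS leq_addl.
under eq_bigr do rewrite -mulr_sumr.
rewrite -mulr_sumr ler_wpM2l //.
have -> : \sum_(q < Q) \sum_(s < nJ) (m%:R * (\sum_j kapJ (Jp (n0 + q) j) ^+ 2) +
    (m ^ 2)%:R ^+ 2 * mxnorm (K (n0 + q) (enum_val s)) ^+ 2 + q.+1%:R ^- 2) =
  nJ%:R * (m%:R * \sum_(q < Q) \sum_j kapJ (Jp (n0 + q) j) ^+ 2) +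
  (m ^ 2)%:R ^+ 2 * (\sum_(q < Q) \sum_(s < nJ) mxnorm (K (n0 + q) (enum_val s)) ^+ 2) +
  nJ%:R * (\sum_(q < Q) q.+1%:R ^- 2 : R).
  rewrite !mulr_sumr -!big_split /=; apply: eq_bigr => q _.
  rewrite !big_split /= !sumr_const card_ord -mulr_sumr.
  by rewrite !mulr_natl.
apply: lerD; first apply: lerD.
- by rewrite !ler_wpM2l.
- by rewrite ler_wpM2l // exprn_ge0.
- by rewrite ler_wpM2l // sum_inv_sqr_le2.
Qed.

(** The given frequencies rho0 + kap are expanded about the model frequency rho0, and the three
    parts collect the orders 0, 1 and 2 in kap. The part of order 0 is small because given and model
    terms nearly cancel. Taking q >= Q0 also excludes rho = 0, where [eps] is not [ert]. *)
Lemma blk_decomp : exists2 Cb, 0 <= Cb & exists Q0, forall q (s : 'I_nJ), (Q0 <= q)%N ->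
  forall d f, Bd d f -> exists pvw : 'M[C]_m * 'M[C]_m * (R -> 'M[C]_m),
   [/\ mcont pvw.2,
    forall t, blk r n0 lam alpha alphat f (bidx q s) t = pvw.1.1 *m ert (rho0 q s) t +
      pvw.1.2 *m (t%:C *: dert (rho0 q s) t) + pvw.2 t,
    fro pvw.1.1 <= Cb * (d * xi q s) /\ fro pvw.1.2 <= Cb * (d * xi q s) &
    forall t, 0 <= t <= pi -> fro (pvw.2 t) <= Cb * (d * xi q s ^+ 2)].
Proof.
have [ck hck] := kap_bounded; have [cK hcK] := K_bounded.
have [Ca Ca0 [Q0 hQ0]] := aa_est n0 alphat m0 hT1 hr hpsd hK hck hcK.
have pc0 : 0 <= pi ^+ 2 * cT :> R by rewrite mulr_ge0 ?sqr_ge0 ?cT_ge0.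
have p20 : 0 <= 2 / pi :> R by rewrite divr_ge0 ?pi_ge0.
exists (2 * Ca + Ca * (pi ^+ 2 * cT)).
  by apply: addr_ge0; apply: mulr_ge0.
exists Q0 => q s qQ d f [fd flip].
have [h1 h2] := hQ0 q s qQ.
have d0 : 0 <= d by apply: le_trans (fd (Jp 0 (Ordinal m0), true)); apply: fro_ge0.
have x0 := @xi_ge0 R m T1 T2 r n0 lam K q s.
pose kap j := kapJ (Jp (n0 + q) j).
pose b0 j : JJT := (Jp (n0 + q) j, false).
pose b1 j : JJT := (Jp (n0 + q) j, true).
pose ks := enum_val s.
pose aq := aa r lam alpha alphat.
have e1 j : r j = r ks -> rho (b1 j) = rho0 q s.
  by move=> rj; apply: (rho_model_block n0 lam hr).
have e0 j : r j = r ks -> rho (b0 j) = rho0 q s + kap j.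
  move=> rj; rewrite /kap /kapJ /b0 /rhoI /lamI /= /rho0 /J1 /J2 /= -rj.
  by ring.
have inG j i : r j = r ks -> Defs.G r n0 (bidx q s) (Jp (n0 + q) j, i).
  by move=> rj; apply/(GbE n0 m0).
have fb1 j : r j = r ks -> f (b1 j) = f (b1 ks).
  move=> rj; apply/eqP; rewrite -subr_eq0; apply/eqP/fro_le0.
  apply: le_trans (flip _ _ _) _; first by exists (bidx q s); split; apply: inG.
  by rewrite /drho !e1 // subrr normr0 mulr0.
have fb0 j : r j = r ks -> fro (f (b0 j) - f (b1 ks)) <= d * `|kap j|.
  move=> rj; apply: le_trans (flip _ _ _) _; first by exists (bidx q s); split; apply: inG.
  by rewrite /drho e0 // e1 // addrAC subrr add0r.
pose rem j t := ert (rho0 q s + kap j) t - ert (rho0 q s) t - (kap j * t)%:C *: dert (rho0 q s) t.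
have ct j : continuous (fun t : R => kap j * t).
  by apply: continuousMr; [apply: continuous_cst|move=> t; apply: cvg_id].
have crem j : mcont (rem j).
  apply: mcontB; first by apply: mcontB; apply: mcont_ert.
  by apply: (mcontZR (f := fun t => kap j * t)) => //; apply: mcont_dert.
have skap : \sum_(j | r j == r ks) `|kap j| <= xi q s by apply: kap_le_xi.
exists (\sum_(j | r j == r ks) (f (b0 j) *m aq (b0 j) - f (b1 j) *m aq (b1 j)),
  \sum_(j | r j == r ks) (kap j)%:C *: (f (b0 j) *m aq (b0 j)),
  fun t => \sum_(j | r j == r ks) f (b0 j) *m aq (b0 j) *m rem j t) => /=.
have bound3 (u : R) : 0 <= u -> Ca * u <= (2 * Ca + Ca * (pi ^+ 2 * cT)) * u.
  move=> u0; rewrite ler_wpM2r //; have := mulr_ge0 Ca0 pc0; lra.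
split.
- apply: mcont_sum => j; apply: mcontM; [exact: mcont_cst|exact: crem].
- move=> t; rewrite /blk (sum_Gseq_block n0 m0) !mulmx_suml -!big_split /=.
  apply: eq_bigr => j /eqP rj; rewrite !(cf_phiI r lam alpha alphat hT1) /= expr0 expr1 scale1r scaleN1r.
  have [bn0 _] := h1 j rj.
  have eb0 : eps r lam (b0 j) t = ert (rho0 q s + kap j) t by rewrite (eps_ert hT1) // e0.
  have eb1 : eps r lam (b1 j) t = ert (rho0 q s) t.
    by rewrite -(e1 j rj); apply: (eps_ert hT1); rewrite e1 // gt_eqF // (rho0_gt0 n0 hr).
  rewrite -/(b0 j) -/(b1 j) eb0 eb1 -/(aq (b0 j)) -/(aq (b1 j)) /rem.
  move: (f (b0 j) *m aq (b0 j)) (f (b1 j) *m aq (b1 j)) (ert (rho0 q s + kap j) t)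
    (ert (rho0 q s) t) (dert (rho0 q s) t) (kap j) => X Y E E0 D k.
  rewrite mulmxBl !mulmxBr rmorphM -!(scalemxAl, scalemxAr) scalerA.
  move: (X *m E) (Y *m E0) (X *m E0) (_ *: (X *m D)) => P1 P2 P3 P4.
  by apply/matrixP => i' j'; rewrite !mxE; ring.
- split.
    (* The given values of [f] are compared with the single model value [f (b1 ks)], at the cost
       [d * |kap j|] each; what is left is that value times the difference of the two weight
       sums. *)
    have -> : \sum_(j | r j == r ks) (f (b0 j) *m aq (b0 j) - f (b1 j) *m aq (b1 j)) =
      \sum_(j | r j == r ks) ((f (b0 j) - f (b1 ks)) *m aq (b0 j)) +
      f (b1 ks) *m (\sum_(j | r j == r ks) aq (b0 j) - (2 / pi)%:C *: A ks).
      rewrite -(aa_model n0 lam alpha hT1 hT2 hr hA halphat q) -sumrB mulmx_sumr -big_split /=.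
      apply: eq_bigr => j /eqP rj; rewrite (fb1 j rj) mulmxBl mulmxBr addrA subrK.
      by [].
    apply: le_trans (froD _ _) _.
    apply: le_trans (_ : d * xi q s * Ca + d * (Ca * xi q s) <= _); last first.
      have := mulr_ge0 (mulr_ge0 Ca0 pc0) (mulr_ge0 d0 x0); lra.
    apply: lerD.
      apply: le_trans (fro_sum _ _ _) _.
      apply: le_trans (_ : \sum_(j | r j == r ks) d * `|kap j| * Ca <= _).
        apply: ler_sum => j /eqP rj; apply: le_trans (froM _ _) _.
        have [_ ac] := h1 j rj.
        by apply: ler_pM; rewrite ?fro_ge0 ?fb0.
      by rewrite -mulr_suml -mulr_sumr ler_wpM2r // ler_wpM2l.
    apply: le_trans (froM _ _) _.
    by apply: ler_pM; rewrite ?fro_ge0 ?fd.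
  apply: le_trans (bound3 _ (mulr_ge0 d0 x0)).
  apply: le_trans (fro_sum _ _ _) _.
  apply: le_trans (_ : \sum_(j | r j == r ks) `|kap j| * (d * Ca) <= _).
    apply: ler_sum => j /eqP rj; rewrite froZR ler_wpM2l //.
    apply: le_trans (froM _ _) _; have [_ ac] := h1 j rj.
    by apply: ler_pM; rewrite ?fro_ge0 ?fd.
  have -> : Ca * (d * xi q s) = xi q s * (d * Ca) by ring.
  by rewrite -mulr_suml ler_wpM2r // mulr_ge0.
move=> t tpi; apply: le_trans (fro_sum _ _ _) _.
(* Of the two factors |kap| one is bounded by xi at once, and the other is kept for the sum over j,
   which is again at most xi. *)
apply: le_trans (_ : \sum_(j | r j == r ks) `|kap j| * (xi q s * (d * Ca * (pi ^+ 2 * cT))) <= _).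
  apply: ler_sum => j /eqP rj; apply: le_trans (froM _ _) _; have [_ ac] := h1 j rj.
  apply: le_trans (_ : d * Ca * (pi ^+ 2 * cT * kap j ^+ 2) <= _).
    apply: ler_pM; rewrite ?fro_ge0 //; last exact: ert_taylor.
    by apply: le_trans (froM _ _) _; apply: ler_pM; rewrite ?fro_ge0 ?fd.
  have kx : `|kap j| <= xi q s.
    apply: le_trans skap; rewrite [leRHS](bigD1 j (introT eqP rj)) /= lerDl.
    exact: sumr_ge0.
  have := ler_wpM2l (normr_ge0 (kap j)) kx; rewrite -[_ * `|_|]expr2 real_normK ?num_real //.
  move=> /(ler_wpM2r (mulr_ge0 (mulr_ge0 d0 Ca0) pc0)).
  set u := `|kap j|; set k2 := kap j ^+ 2.
  have -> : d * Ca * (pi ^+ 2 * cT * k2) = k2 * (d * Ca * (pi ^+ 2 * cT)) by ring.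
  by have -> : u * (xi q s * (d * Ca * (pi ^+ 2 * cT))) = u * xi q s * (d * Ca * (pi ^+ 2 * cT)) by ring.
rewrite -mulr_suml; apply: le_trans (ler_wpM2r _ skap) _.
  exact: mulr_ge0 x0 (mulr_ge0 (mulr_ge0 d0 Ca0) pc0).
have := mulr_ge0 Ca0 (mulr_ge0 d0 (sqr_ge0 (xi q s))); rewrite expr2; lra.
Qed.

Local Notation FN := (FN r n0 lam alpha alphat).
Local Notation blk := (blk r n0 lam alpha alphat).

Lemma FN_sub f N M t : (N <= M)%N -> FN f M t - FN f N t = \sum_(N <= k < M) blk f k t.
Proof.
move=> NM; rewrite /FN -!(big_mkord xpredT (fun k => blk f k t)).
by rewrite (big_cat_nat (leq0n N) NM) /= addrAC subrr add0r.
Qed.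

(** The parts of order 0 and 1 form orthogonal sums and are controlled by the square root of the
    tail of the sum of xi^2; the remainders are added in norm and controlled by the tail itself. [f]
    enters only through the factor [d]. *)
Lemma FN_cauchy e : 0 < e -> exists N0, forall N M, (N0 <= N <= M)%N -> forall d f, Bd d f ->
  nL pi (fun t => FN f M t - FN f N t) <= e * d.
Proof.
move=> e0; have [Cb Cb0 [Q0 hQ0]] := blk_decomp; have [S hS] := xi_sum.
have cT0 := cT_ge0 T1; have sp0 := sqrtr_ge0 (pi : R).
pose c1 : R := 4 * pi ^+ 2 * cT.
have c10 : 0 <= c1 by apply: mulr_ge0 => //; apply: mulr_ge0 => //; exact: sqr_ge0.
pose B : R := nJ%:R * (Cb * (2 * c1 + Num.sqrt pi)).
have B0 : 0 <= B by apply: mulr_ge0 => //; apply: mulr_ge0 => //; apply: addr_ge0 => //; exact: mulr_ge0.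
(* A bound for the square root of the tail: [dl <= 1] absorbs the square coming from the remainders,
   and [B * dl <= e] gives the result. *)
pose dl : R := Num.min 1 (e / (B + 1)).
have B1 : 0 < B + 1 by lra.
have dl0 : 0 < dl by rewrite lt_min ltr01 divr_gt0.
have dl1 : dl <= 1 by rewrite ge_min lexx.
have Bdl : B * dl <= e.
  apply: le_trans (_ : (B + 1) * dl <= _); first by rewrite ler_wpM2r ?(ltW dl0) // lerDl.
  rewrite mulrC -ler_pdivlMr // ge_min lexx orbT.
  by [].
have u0 q : 0 <= \sum_s xi q s ^+ 2 by apply: sumr_ge0 => s _; apply: sqr_ge0.
have [Q1 hQ1] := bounded_sum_cauchy u0 hS (exprn_gt0 2 dl0).
pose Q2 := maxn Q0 Q1.
(* From this index on every block has q >= Q2, whatever its s. *)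
exists (nJ * Q2 + nJ).+1 => N M /andP[N0N NM] d f hf.
have d0 : 0 <= d by case: hf => h _; apply: le_trans (h (Jp 0 (Ordinal m0), true)); apply: fro_ge0.
have msk q (s : 'I_nJ) : (N <= (nJ * q + s).+1)%N -> (Q2 <= q)%N.
  move=> h; have := leq_trans N0N h; rewrite ltnS => h'.
  rewrite leqNgt; apply/negP => qQ; move: h'; rewrite leqNgt => /negP; apply.
  apply: leq_trans (_ : nJ * q + nJ <= _)%N; first by rewrite ltn_add2l.
  by rewrite leq_add2r leq_mul2l (ltnW qQ) orbT.
pose mk (sq : 'I_nJ * 'I_M) := (N <= (nJ * sq.2 + sq.1).+1 < M)%N.
(* Blocks outside the range from N to M are given zero coefficients, so that for every s the sum
   runs over all q < M. *)
pose mx (s : 'I_nJ) (q : 'I_M) : R := if mk (s, q) then xi q s else 0.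
have mx0 s q : 0 <= mx s q by rewrite /mx; case: ifP => // _; apply: xi_ge0.
have mxs s : \sum_q mx s q ^+ 2 <= dl ^+ 2.
  apply: le_trans (_ : \sum_(q < M) (if (Q1 <= q)%N then \sum_s xi q s ^+ 2 else 0) <= _).
    apply: ler_sum => q _; rewrite /mx; case: ifP => [/andP[/msk h _]|_].
      rewrite (leq_trans (leq_maxr _ _) h) [leRHS](bigD1 s) //= lerDl.
      by apply: sumr_ge0 => ? _; apply: sqr_ge0.
    by rewrite expr0n /=; case: ifP.
  have [QM|QM] := leqP Q1 M; last first.
    rewrite big1 ?sqr_ge0 // => q _; rewrite leqNgt (ltn_trans (ltn_ord q) QM).
    by [].
  apply: le_trans (hQ1 Q1 M _); last by rewrite leqnn.
  rewrite -(big_mkord xpredT (fun q => if (Q1 <= q)%N then \sum_s xi q s ^+ 2 else 0)).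
  rewrite (big_cat_nat (leq0n Q1) QM) /= big_nat_cond big1 ?add0r => [|q /andP[/andP[_ h] _]].
    rewrite big_nat_cond [leRHS]big_nat_cond; apply: ler_sum => q /andP[/andP[-> _] _].
    by [].
  by rewrite leqNgt h.
have /choice [pv hpv] : forall sq : 'I_nJ * 'I_M, exists pvw : 'M[C]_m * 'M[C]_m * (R -> 'M[C]_m),
   [/\ mcont pvw.2,
    forall t, (if mk sq then blk f (bidx sq.2 sq.1) t else 0) = pvw.1.1 *m ert (rho0 sq.2 sq.1) t +
      pvw.1.2 *m (t%:C *: dert (rho0 sq.2 sq.1) t) + pvw.2 t,
    fro pvw.1.1 <= Cb * (d * mx sq.1 sq.2) /\ fro pvw.1.2 <= Cb * (d * mx sq.1 sq.2) &
    forall t, 0 <= t <= pi -> fro (pvw.2 t) <= Cb * (d * mx sq.1 sq.2 ^+ 2)].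
  move=> [s q] /=; rewrite /mx; case: ifP => [/andP[/msk h _]|_].
    by apply: hQ0 => //; apply: leq_trans h; apply: leq_maxl.
  exists (0, 0, fun=> 0) => /=; split; first exact: mcont_cst.
  - by move=> t; rewrite !mul0mx !addr0.
  - by rewrite fro0 !mulr0.
  - by move=> t _; rewrite fro0 expr0n /= !mulr0.
pose P s q := (pv (s, q)).1.1; pose V s q := (pv (s, q)).1.2; pose W s q := (pv (s, q)).2.
have splitF t : FN f M t - FN f N t = \sum_s (\sum_(q < M) (P s q *m ert ((n0 + q).+1%:R + r (enum_val s)) t +
     V s q *m (t%:C *: dert ((n0 + q).+1%:R + r (enum_val s)) t)) + \sum_(q < M) W s q t).
  rewrite FN_sub // (sum_masked (fun k => blk f k t) M (nJ_gt0 r m0)) //; last exact: leq_trans N0N.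
  apply: eq_bigr => s _; rewrite -big_split; apply: eq_bigr => q _ /=.
  by have [_ h _ _] := hpv (s, q); rewrite -h.
have ctd rr : mcont (fun t => t%:C *: dert rr t).
  by apply: (mcontZR (f := id)); [move=> t; apply: cvg_id|apply: mcont_dert].
have cPV s : mcont (fun t => \sum_(q < M) (P s q *m ert ((n0 + q).+1%:R + r (enum_val s)) t +
     V s q *m (t%:C *: dert ((n0 + q).+1%:R + r (enum_val s)) t))).
  apply: mcont_sum => q.
  exact: mcontD (mcontM (mcont_cst _) (mcont_ert _ _)) (mcontM (mcont_cst _) (ctd _)).
have cW s q : mcont (W s q) by case: (hpv (s, q)).
have cWs s : mcont (fun t => \sum_(q < M) W s q t) by apply: mcont_sum.
rewrite (nL_ext (fun t _ => splitF t)).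
apply: le_trans (nL_sum _ _ _ (fun s => mcontD (cPV s) (cWs s))) _.
have sqb s (X : 'I_M -> 'M[C]_m) : (forall q, fro (X q) <= Cb * (d * mx s q)) ->
    Num.sqrt (\sum_q fro (X q) ^+ 2) <= Cb * d * dl.
  move=> hX; have c0 : 0 <= Cb * d * dl by rewrite !mulr_ge0 ?(ltW dl0).
  rewrite -[leRHS]ger0_norm // -sqrtr_sqr ler_sqrt ?sqr_ge0 // [leRHS]exprMn.
  apply: le_trans (ler_wpM2l (sqr_ge0 _) (mxs s)); rewrite mulr_sumr; apply: ler_sum => q _.
  rewrite -exprMn -mulrA ler_sqr ?nnegrE ?fro_ge0 //.
  by rewrite mulr_ge0 // mulr_ge0.
have hP s q : fro (P s q) <= Cb * (d * mx s q) by have [_ _ [h _] _] := hpv (s, q); exact: h.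
have hV s q : fro (V s q) <= Cb * (d * mx s q) by have [_ _ [_ h] _] := hpv (s, q); exact: h.
have hW s q t : 0 <= t <= pi -> fro (W s q t) <= Cb * (d * mx s q ^+ 2).
  by have [_ _ _ h] := hpv (s, q); exact: h.
have one s : nL pi (fun t => \sum_(q < M) (P s q *m ert ((n0 + q).+1%:R + r (enum_val s)) t +
     V s q *m (t%:C *: dert ((n0 + q).+1%:R + r (enum_val s)) t)) + \sum_(q < M) W s q t) <=
     c1 * (Cb * d * dl + Cb * d * dl) + Num.sqrt pi * (Cb * (d * dl ^+ 2)).
  apply: le_trans (nLD pi (cPV s) (cWs s)) _; apply: lerD.
    apply: le_trans (nL_shifted_sum _ _ _ _ _) _; rewrite ler_wpM2l //.
    exact: (lerD (sqb s _ (hP s)) (sqb s _ (hV s))).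
  apply: le_trans (nL_sum _ _ _ (cW s)) _.
  apply: le_trans (_ : \sum_(q < M) Num.sqrt pi * (Cb * (d * mx s q ^+ 2)) <= _).
    apply: ler_sum => q _; apply: nL_bound; [exact: cW|exact: pi_ge0| |exact: hW].
    by apply: mulr_ge0 => //; apply: mulr_ge0 => //; apply: sqr_ge0.
  by rewrite -!mulr_sumr !ler_wpM2l.
apply: le_trans (ler_sum _ (fun s _ => one s)) _.
rewrite sumr_const card_ord -[leLHS]mulr_natl.
apply: le_trans (_ : B * dl * d <= _); last by rewrite ler_wpM2r.
have h2 : Num.sqrt pi * (Cb * (d * dl ^+ 2)) <= Num.sqrt pi * (Cb * (d * dl)).
  rewrite !ler_wpM2l // expr2 -[leRHS]mulr1 ler_wpM2l //; exact: ltW.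
have -> : B * dl * d = nJ%:R * (c1 * (Cb * d * dl + Cb * d * dl) + Num.sqrt pi * (Cb * (d * dl))).
  by rewrite /B; ring.
by rewrite ler_wpM2l // lerD2l.
Qed.

End WithK.
End BlockAsymptotics.

(** * The operator of the main equation *)

Section Cauchy.
Context {R : realType}.
Local Notation C := (R[i]).
Local Notation Re := (@complex.Re R).
Local Notation Im := (@complex.Im R).
Local Open Scope classical_set_scope.

Lemma real_cauchy (v : nat -> R) :
  (forall e, 0 < e -> exists N0, forall N M, (N0 <= N <= M)%N -> `|v M - v N| <= e) ->
  cvg (v @ \oo).
Proof.
move=> hv; apply: cauchy_cvg; apply: cauchy_exP => e e0.
have e2 : 0 < e / 2 by apply: divr_gt0.
have [N0 hN0] := hv (e / 2) e2; exists (v N0).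
exists N0 => //= n N0n; rewrite /ball /= distrC.
apply: le_lt_trans (hN0 N0 n _) _; first by rewrite leqnn.
by rewrite ltr_pdivrMr // ltr_pMr // ltr1n.
Qed.

Lemma fro_cauchy_cvg p q (u : nat -> 'M[C]_(p, q)) :
  (forall e, 0 < e -> exists N0, forall N M, (N0 <= N <= M)%N -> fro (u M - u N) <= e) ->
  exists l, mxcvg u l.
Proof.
move=> hu.
have cRe i j : cvg ((fun n => Re (u n i j)) @ \oo).
  apply: real_cauchy => e /hu [N0 h]; exists N0 => N M NM.
  apply: le_trans (h N M NM); apply: le_trans (cmod_le_fro _ i j); rewrite !mxE.
  by rewrite -ReN -ReD; apply: normRe_le.
have cIm i j : cvg ((fun n => Im (u n i j)) @ \oo).
  apply: real_cauchy => e /hu [N0 h]; exists N0 => N M NM.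
  apply: le_trans (h N M NM); apply: le_trans (cmod_le_fro _ i j); rewrite !mxE.
  by rewrite -ImN -ImD; apply: normIm_le.
by exists (mxlim u) => i j; rewrite mxE /=; split.
Qed.

End Cauchy.

Section RtildeOperator.
Context {R : realType}.
Local Notation C := (R[i]).
Local Open Scope classical_set_scope.
Variables (m : nat) (T1 T2 : 'M[C]_m) (r : 'I_m -> R) (n0 : nat).
Variables (lam : J T1 T2 -> R) (alpha alphat : J T1 T2 -> 'M[C]_m).
Hypothesis m0 : (0 < m)%N.
Hypothesis hT1 : orth_proj T1.
Hypothesis hr01 : forall k, 0 <= r k < 1.
Local Notation JJT := (JJ T1 T2).
Local Notation Bd := (Bd (sameG r n0 (T1 := T1) (T2 := T2)) (drho r lam)).
Local Notation kapJ := (kapJ r lam).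
Local Notation FN := (FN r n0 lam alpha alphat).
Local Notation Rpartial := (Rpartial r n0 lam alpha alphat).
Local Notation Rtilde := (Rtilde r n0 lam alpha alphat).
Variable ck : R.
Hypothesis kap_le : forall a : J T1 T2, `|kapJ a| <= ck.
Hypothesis F_cauchy : forall e, 0 < e -> exists N0, forall N M, (N0 <= N <= M)%N ->
  forall d f, Bd d f -> nL pi (fun t => FN f M t - FN f N t) <= e * d.

Lemma Bd_ge0 d (f : JJT -> 'M[C]_m) : Bd d f -> 0 <= d.
Proof. by case=> h _; apply: le_trans (h (Jpos T1 T2 0 (Ordinal m0), true)); apply: fro_ge0. Qed.

Lemma FN_bound : exists2 CF, 0 <= CF & forall N d f, Bd d f -> nL pi (FN f N) <= CF * d.
Proof.
have [N0 hN0] := F_cauchy ltr01.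
have /choice [c hc] : forall k, exists c, 0 <= c /\ forall d f, Bd d f ->
    nL pi (blk r n0 lam alpha alphat f k) <= c * d.
  by move=> k; have [c c0 hc] := blk_bound r n0 lam alpha alphat k; exists c.
have small N d f : Bd d f -> nL pi (FN f N) <= (\sum_(k < N) c k) * d.
  move=> hf; have cb (k : 'I_N) : mcont (blk r n0 lam alpha alphat f k) by exact: mcont_blk.
  apply: le_trans (nL_sum pi (index_enum 'I_N) xpredT cb) _.
  by rewrite mulr_suml; apply: ler_sum => k _; have [_ h] := hc k; apply: h.
have S0 : 0 <= \sum_(k < N0) c k by apply: sumr_ge0 => k _; case: (hc k).
exists (\sum_(k < N0) c k + 1) => [|N d f hf]; first exact: addr_ge0.
have d0 := Bd_ge0 hf.
have [NN0|NN0] := leqP N0 N.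
  rewrite (nL_ext (H := fun t => FN f N0 t + (FN f N t - FN f N0 t))); last by move=> t _; rewrite addrC subrK.
  apply: le_trans (nLD _ _ _) _; first exact: mcont_FN.
    by apply: mcontB; apply: mcont_FN.
  rewrite mulrDl; apply: lerD; first exact: small.
  by apply: hN0; rewrite ?leqnn.
apply: le_trans (small N d f hf) _; rewrite ler_wpM2r //.
rewrite -(subnKC (ltnW NN0)) big_split_ord /= -addrA lerDl.
by apply: addr_ge0 => //; apply: sumr_ge0 => k _; case: (hc (N + k)%N).
Qed.

Variable x : R.
Hypothesis hx : 0 <= x <= pi.

Lemma Rpartial_sub f N M a : Rpartial x f a M - Rpartial x f a N =
  solF r lam x (fun t => FN f M t - FN f N t) a.
Proof.
rewrite !(Rpartial_solF r n0 lam alpha alphat m0) /solF -mintN; last first.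
  by apply: mcontM; [apply: mcont_FN|apply: mcont_eps].
rewrite -mintD; last 2 first.
- by apply: mcontM; [apply: mcont_FN|apply: mcont_eps].
- by apply: mcontN; apply: mcontM; [apply: mcont_FN|apply: mcont_eps].
by apply: mint_ext => t _; rewrite mulmxBl.
Qed.

Lemma Rpartial_cauchy : exists2 c3, 0 <= c3 & forall e, 0 < e -> exists N0, forall N M,
  (N0 <= N <= M)%N -> forall d f, Bd d f ->
  Bd (c3 * (e * d)) (fun a => Rpartial x f a M - Rpartial x f a N).
Proof.
have [c3 c30 h3] := solF_Bd n0 m0 hT1 hr01 kap_le; exists c3 => // e /F_cauchy [N0 h].
exists N0 => N M NM d f hf; have cF : mcont (fun t => FN f M t - FN f N t).
  by apply: mcontB; apply: mcont_FN.
apply: Bd_ext (fun a => esym (Rpartial_sub f N M a)) _.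
apply: BdW (h3 x _ hx cF); first exact: drho_ge0.
rewrite ler_wpM2l //; apply: le_trans (h N M NM d f hf).
exact: nL_le_dom.
Qed.

Lemma Rpartial_cvg d f a : Bd d f -> mxcvg (Rpartial x f a) (Rtilde x f a).
Proof.
move=> hf; have d0 := Bd_ge0 hf; have [c3 c30 h3] := Rpartial_cauchy.
have [e e0|l hl] := @fro_cauchy_cvg R m m (Rpartial x f a).
  have k0 : 0 < c3 * d + 1 by rewrite ltr_wpDl // mulr_ge0.
  have [N0 h] := h3 (e / (c3 * d + 1)) (divr_gt0 e0 k0).
  exists N0 => N M NM; have [h' _] := h N M NM d f hf; apply: le_trans (h' a) _.
  have -> : c3 * (e / (c3 * d + 1) * d) = e * (c3 * d / (c3 * d + 1)) by ring.
  by rewrite -[leRHS]mulr1 ler_wpM2l ?(ltW e0) // ler_pdivrMr // mul1r lerDl.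
by rewrite /Defs.Rtilde (mxcvg_lim hl).
Qed.

(** The Cauchy bound passes to the limit with [N0] independent of [f], so the partial sums converge
    in operator norm. *)
Lemma Rtilde_approx : exists2 c3, 0 <= c3 & forall e, 0 < e -> exists N0, forall N,
  (N0 <= N)%N -> forall d f, Bd d f ->
  Bd (c3 * (e * d)) (fun a => Rtilde x f a - Rpartial x f a N).
Proof.
have [c3 c30 h3] := Rpartial_cauchy; exists c3 => // e /h3 [N0 h].
exists N0 => N NN d f hf.
apply: (Bd_closed (u := fun M a => Rpartial x f a M - Rpartial x f a N)).
  by near=> M; apply: h => //; rewrite NN; near: M; apply: nbhs_infty_ge.
move=> a; apply: mxcvgB; first exact: (Rpartial_cvg _ hf).
by move=> i j; split; apply: cvg_cst.
Unshelve. all: by end_near. Qed.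

Lemma Rtilde_Bd : exists2 CR, 0 <= CR & forall d f, Bd d f -> Bd (CR * d) (Rtilde x f).
Proof.
have [c3 c30 h3] := Rtilde_approx; have [N0 h] := h3 _ ltr01.
have [c4 c40 h4] := solF_Bd n0 m0 hT1 hr01 kap_le.
have [CF CF0 hF] := FN_bound.
exists (c3 + c4 * CF) => [|d f hf]; first by rewrite addr_ge0 ?mulr_ge0.
have h5 := h N0 (leqnn _) d f hf.
have h6 := h4 x (FN f N0) hx (mcont_FN r n0 lam alpha alphat f N0).
have le6 : c4 * nL x (FN f N0) <= c4 * CF * d.
  rewrite -mulrA ler_wpM2l //; apply: le_trans (hF N0 d f hf).
  by apply: nL_le_dom => //; apply: mcont_FN.
have := BdD h5 (BdW (@drho_ge0 _ _ _ _ r lam) le6 h6).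
rewrite mul1r -mulrDl; apply: Bd_ext => a.
by rewrite -(Rpartial_solF r n0 lam alpha alphat m0) subrK.
Qed.

(** In every term the value of [f] stands leftmost, so linearity holds over the ring of matrices and
    not just over scalars; [fredholm] relies on this. *)
Lemma Rtilde_lin (A : 'M[C]_m) c d f g : Bd c f -> Bd d g ->
  Rtilde x (fun a => A *m f a + g a) = (fun a => A *m Rtilde x f a + Rtilde x g a).
Proof.
move=> hf hg; apply/funext => a; apply: mxcvg_lim.
have hf' := Rpartial_cvg a hf; have hg' := Rpartial_cvg a hg.
have -> : Rpartial x (fun a => A *m f a + g a) a = fun N => A *m Rpartial x f a N + Rpartial x g a N.
  apply/funext => N; rewrite !(Rpartial_solF r n0 lam alpha alphat m0) /solF.
  rewrite -mint_mulmxl; last by apply: mcontM; [apply: mcont_FN|apply: mcont_eps].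
  rewrite -mintD; last 2 first.
  - by apply: mcontM; [apply: mcont_cst|apply: mcontM; [apply: mcont_FN|apply: mcont_eps]].
  - by apply: mcontM; [apply: mcont_FN|apply: mcont_eps].
  by apply: mint_ext => t _; rewrite FN_lin mulmxDl mulmxA.
apply/mxcvgP; move/mxcvgP: hf' => hf'; move/mxcvgP: hg' => hg'.
have s : (fun N => fro A * fro (Rpartial x f a N - Rtilde x f a) +
    fro (Rpartial x g a N - Rtilde x g a)) @ \oo --> (fro A * 0 + 0 : R).
  exact: cvgD (cvgM (cvg_cst _) hf') hg'.
rewrite mulr0 addr0 in s; apply: (squeeze0 s); near=> N.
rewrite fro_ge0 opprD addrACA -mulmxBr /=; apply: le_trans (froD _ _) _.
by rewrite lerD2r froM.
Unshelve. all: by end_near. Qed.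

End RtildeOperator.

(** * Injectivity *)

Section ModelBessel.
Context {R : realType}.
Local Notation C := (R[i]).
Local Notation Re := (@complex.Re R).
Local Notation Im := (@complex.Im R).
Local Open Scope classical_set_scope.
Variables (m : nat) (T1 T2 : 'M[C]_m) (r : 'I_m -> R) (n0 : nat).
Variables (A : 'I_m -> 'M[C]_m).
Variables (lam : J T1 T2 -> R) (alpha alphat : J T1 T2 -> 'M[C]_m).
Hypothesis hT1 : orth_proj T1.
Hypothesis hT2 : orth_proj T2.
Hypothesis hr : zeros_of_detW0 T1 T2 r.
Hypothesis hA : is_A T1 T2 r A.
Hypothesis halphat : forall a : J T1 T2, is_model_weight T1 T2 (lamt r a)%:C (alphat a).
Hypothesis hlam : forall a, 0 <= lam a.
Local Notation JT := (J T1 T2).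
Local Notation JJT := (JJ T1 T2).
Local Notation rho := (rhoI r lam).
Local Notation Trho := (Trho T1).
Local Notation ert := (ert T1).
Local Notation aI := (alphaI r lam alpha alphat).

Let hr01 k : 0 <= r k < 1. Proof. by case: hr. Qed.

Local Notation phi := (phiI r lam).

Lemma model_W_A (a : JT) : Wr T1 T2 (rho (a, true)) *m A (J2 a) = 0.
Proof.
by have [_ _ h _] := A_props hT1 hT2 hr hA (J2 a); rewrite (rhoI_model lam hr01) WrDn -scalemxAl h scaler0.
Qed.

Lemma mcont_phiM (b c : JJT) : mcont (fun t => phi b t *m phi c t).
Proof. by apply: mcontM; apply: mcont_phiI. Qed.

Lemma mint_phi_ert (b c : JJT) : Trho (rho b) *m mint pi (fun t => phi b t *m phi c t) *m Trho (rho c) =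
  mint pi (fun t => ert (rho b) t *m ert (rho c) t).
Proof.
rewrite -mint_mulmxl; last exact: mcont_phiM.
rewrite -mint_mulmxr; last by apply: mcontM; [apply: mcont_cst|apply: mcont_phiM].
apply: mint_ext => t _; rewrite mulmxA (Trho_phiI r lam hT1) -mulmxA; congr (_ *m _).
have := congr1 (@adjmx R m m) (Trho_phiI r lam hT1 c t).
rewrite adjmxM (adj_phiI r lam hT1) (adj_ert hT1) => <-; congr (_ *m _).
by rewrite adjmxD adjmxZR (projT_adj hT1) (projS_adj hT1).
Qed.

(** The factors T_rho of the weights are absorbed into phi~, which leaves the Gram matrix of the
    functions [ert] between kernel projections. No inverse of T_rho appears, as T_rho = T1 at rho =
    0. *)
Lemma alphat_gram (a b : JT) :
  alphat a *m mint pi (fun t => phi (a, true) t *m phi (b, true) t) *m alphat b =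
  (cw (rho (a, true)) * cw (rho (b, true)))%:C *:
  (Trho (rho (a, true)) *m (A (J2 a) *m
    mint pi (fun t => ert (rho (a, true)) t *m ert (rho (b, true)) t) *m A (J2 b)) *m
   Trho (rho (b, true))).
Proof.
rewrite -mint_phi_ert !(alphat_E lam hT1 hT2 hr hA halphat).
by rewrite -!(scalemxAl, scalemxAr) scalerA -rmorphM !mulmxA [_ * cw _]mulrC.
Qed.

(** [dirichlet u] is sin (u pi) / u, and by [kernel_orth] this sine annihilates the product of the
    kernel projections. The sum of the frequencies is nonzero because they are nonnegative and
    distinct. *)
Lemma alphat_orth (a b : JT) : lamt r a <> lamt r b ->
  alphat a *m mint pi (fun t => phi (a, true) t *m phi (b, true) t) *m alphat b = 0.
Proof.
move=> ne; rewrite alphat_gram (mint_ertM hT1).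
have ra0 : 0 <= rho (a, true) by apply: rhoI_ge0.
have rb0 : 0 <= rho (b, true) by apply: rhoI_ge0.
have nab : rho (a, true) - rho (b, true) != 0.
  rewrite subr_eq0; apply/eqP => e; apply: ne.
  by rewrite -[LHS]/(lamI r lam (a, true)) -[RHS]/(lamI r lam (b, true)) !lamI_sqr // e.
have pab : rho (a, true) + rho (b, true) != 0.
  by move: nab; apply: contraNN => /eqP e; rewrite subr_eq0; apply/eqP; lra.
have [Aa _ _ _] := A_props hT1 hT2 hr hA (J2 a).
have [h1 h2] := kernel_orth hT1 hT2 Aa (model_W_A a) (model_W_A b).
suff -> : A (J2 a) *m ((1 / 2 * dirichlet (rho (a, true) - rho (b, true)))%:C *: 1%:M +
   (1 / 2 * dirichlet (rho (a, true) + rho (b, true)))%:C *: sigma1 T1) *m A (J2 b) = 0.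
  by rewrite mulmx0 mul0mx scaler0.
rewrite mulmxDr mulmxDl -!(scalemxAl, scalemxAr) mulmx1 !dirichlet_neq0 //.
rewrite ![1 / 2 * (_ / _)]mulrCA ![sin _ * (_ * _)]mulrC !(rmorphM _ (_ * _) (sin _)) /=.
by rewrite -!scalerA h1 h2 !scaler0 addr0.
Qed.

(** For rho nonzero the sum-frequency term vanishes by [kernel_orth], and the other gives pi/2,
    which cancels one factor 2/pi. For rho = 0 both terms survive and add up to pi T1; the weight
    then carries 1/pi, and A commutes with T1. *)
Lemma alphat_idem (a : JT) :
  alphat a *m mint pi (fun t => phi (a, true) t *m phi (a, true) t) *m alphat a = alphat a.
Proof.
rewrite alphat_gram (mint_ertM hT1) subrr dirichlet0.
have [Aa AA WA full] := A_props hT1 hT2 hr hA (J2 a).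
rewrite [RHS](alphat_E lam hT1 hT2 hr hA halphat) /cw.
have p0 : pi != 0 :> R by rewrite gt_eqF // pi_gt0.
case: eqVneq => [e0|ne0].
  rewrite e0 addr0 dirichlet0.
  have rk0 : r (J2 a) = 0.
    move: e0; rewrite (rhoI_model lam hr01) => e0; have /andP[r0 _] := hr01 (J2 a).
    by have : (0 : R) <= (J1 a)%:R by []; lra.
  have QA : Qm T1 T2 *m A (J2 a) = 0.
    move: WA; rewrite rk0 /Wr mul0r sin0 cos0 scale0r sub0r scale1r mulNmx.
    by move=> /eqP; rewrite oppr_eq0 => /eqP.
  (* T1 maps the kernel of W(0) = - Q into itself, because Q T1 = T2^perp Q. *)
  have TA : A (J2 a) *m (T1 *m A (J2 a)) = T1 *m A (J2 a).
    apply: full; rewrite rk0 /Wr mul0r sin0 cos0 scale0r sub0r scale1r mulNmx.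
    have QT : Qm T1 T2 *m T1 = perp T2 *m Qm T1 T2.
      have aux (t1 s1 t2 s2 : 'M[C]_m) : s1 *m t1 = 0 -> t1 *m t1 = t1 -> s2 *m t2 = 0 ->
          s2 *m s2 = s2 -> (t2 *m s1 - s2 *m t1) *m t1 = s2 *m (t2 *m s1 - s2 *m t1).
        move=> h1 h2 h3 h4; rewrite mulmxBl mulmxBr -!mulmxA h1 h2 mulmx0 !mulmxA h3 h4.
        by rewrite mul0mx.
      exact: aux (projST hT1) (projTT hT1) (projST hT2) (projSS hT2).
    by rewrite mulmxA QT -mulmxA QA mulmx0 oppr0.
  have AT : A (J2 a) *m T1 = A (J2 a) *m T1 *m A (J2 a).
    by have := congr1 (@adjmx R m m) TA; rewrite !adjmxM Aa (projT_adj hT1) -!mulmxA => ->.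
  have T0 : Trho 0 = T1 by rewrite /Trho scale0r addr0.
  rewrite T0 -scalerDr.
  have -> : 1%:M + sigma1 T1 = 2%:C *: T1.
    rewrite -(projD T1) /sigma1 addrACA subrr addr0 -mulr2n -scaler_nat; congr (_ *: _).
    by rewrite rmorph_nat.
  rewrite scalerA -!(scalemxAl, scalemxAr) scalerA -!rmorphM.
  have -> : pi^-1 / pi * (1 / 2 * pi * 2) = pi^-1 :> R.
    by move: (pi : R) p0 => y y0; field.
  congr (_ *: _); rewrite !mulmxA.
  have -> : T1 *m A (J2 a) *m T1 *m A (J2 a) = T1 *m A (J2 a) *m T1.
    by rewrite -[RHS]mulmxA [in RHS]AT !mulmxA.
  by rewrite -!mulmxA (projTT hT1).
have [_ hs] := kernel_orth hT1 hT2 Aa (model_W_A a) (model_W_A a).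
have pab : rho (a, true) + rho (a, true) != 0 by apply: contraNneq ne0 => e; apply/eqP; lra.
have -> : A (J2 a) *m ((1 / 2 * pi)%:C *: 1%:M +
    (1 / 2 * dirichlet (rho (a, true) + rho (a, true)))%:C *: sigma1 T1) *m A (J2 a) =
    (1 / 2 * pi)%:C *: A (J2 a).
  rewrite mulmxDr mulmxDl -!(scalemxAl, scalemxAr) mulmx1 AA dirichlet_neq0 //.
  rewrite [1 / 2 * (_ / (_ + _))]mulrCA [sin _ * (_ * _)]mulrC (rmorphM _ (_ * _) (sin _)) /=.
  by rewrite -(scalerA _ _ (A _ *m _ *m _)) hs scaler0 addr0.
rewrite -!(scalemxAl, scalemxAr) scalerA -rmorphM; congr (_%:C *: _).
by move: (pi : R) p0 => y y0; field.
Qed.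

(** Thus a multiple eigenvalue enters Bessel's inequality with its weight only once. *)
Lemma prime_model_distinct (a b : JT) : a <> b -> lamt r a = lamt r b ->
  aI (a, true) = 0 \/ aI (b, true) = 0.
Proof.
move=> ab e; have [lt|lt] : J_lt a b \/ J_lt b a.
  rewrite /J_lt; have [h|h|h] := ltngtP (J1 a) (J1 b); [by left; left|by right; left|].
  have [h'|h'|h'] := ltngtP (J2 a) (J2 b); [by left; right|by right; right|].
  case: ab; apply: val_inj; rewrite [val a]surjective_pairing [val b]surjective_pairing.
  by congr (_, _); [|apply: val_inj].
- by right; rewrite /alphaI /= /prime_of; case: asboolP => // -[]; exists a.
- by left; rewrite /alphaI /= /prime_of; case: asboolP => // -[]; exists b.
Qed.

Lemma aI_model (a : JT) : aI (a, true) = 0 \/ aI (a, true) = alphat a.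
Proof. by rewrite /alphaI /= /prime_of; case: asboolP; [left|right]. Qed.

Lemma alphat_adj (a : JT) : adjmx (alphat a) = alphat a.
Proof.
rewrite (alphat_E lam hT1 hT2 hr hA halphat) adjmxZR !adjmxM.
have [-> _ _ _] := A_props hT1 hT2 hr hA (J2 a).
by rewrite adjmxD adjmxZR (projT_adj hT1) (projS_adj hT1) mulmxA.
Qed.

Lemma model_bessel (s : seq JJT) p (x : R) (F : R -> 'M[C]_(p, m)) : uniq s ->
  (forall b, b \in s -> b.2 = true) -> 0 <= x <= pi -> mcont F ->
  \sum_(b <- s) rdot (mint x (fun t => F t *m phi b t) *m aI b)
                     (mint x (fun t => F t *m phi b t)) <= ip x F F.
Proof.
move=> us s1 hx cF; apply: bessel => //.
- by move=> b; apply: mcont_phiI.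
- by move=> b t; apply: adj_phiI.
- move=> [a i] /s1 /= ->; have [->|->] := aI_model a; first exact: adjmx0.
  exact: alphat_adj.
move=> [a i] [b j] /s1 /= -> /s1 /= ->.
have [[->]|ne] := eqVneq; last first.
  have {}ne : a <> b by move=> e; rewrite e eqxx in ne.
  have [e|ne'] := eqVneq (lamt r a) (lamt r b).
    by have [->|->] := prime_model_distinct ne e; rewrite ?mulmx0 ?mul0mx.
  have [->|->] := aI_model a; first by rewrite !mul0mx.
  have [->|->] := aI_model b; first by rewrite mulmx0.
  by apply: alphat_orth; apply/eqP.
have [->|->] := aI_model b; first by rewrite !mul0mx.
exact: alphat_idem.
Qed.

End ModelBessel.

(** * Approximation by a complete system on a subinterval *)

Section L2Approximation.
Context {R : realType}.
Local Notation C := (R[i]).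
Local Notation Re := (@complex.Re R).
Local Notation Im := (@complex.Im R).
Local Open Scope classical_set_scope.

Lemma continuous_meas (D : set R) (f : R -> R) : continuous f -> measurable_fun D f.
Proof. by move=> cf; apply: measurable_funTS; apply: continuous_measurable_fun. Qed.

(** Completeness over (0, pi) is applied to [F] cut off at x; the error over [0, x] is at most that
    over the whole interval. Adjoints pass between the rows of [F] and the column functions [X]. *)
Lemma approx_on_interval m (I : Type) (X : I -> R -> 'cV[C]_m) (x e : R)
    (F : R -> 'M[C]_(1, m)) :
  complete_in_L2 X -> (forall i, mcont (X i)) -> mcont F -> 0 <= x <= pi -> 0 < e ->
  exists s : seq (C * I),
    nL x (fun t => F t - adjmx (\sum_(a <- s) a.1 *: X a.2 t)) <= e.
Proof.
move=> cX mX mF /andP[x0 xpi] e0.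
pose u (t : R) : 'cV[C]_m := (\1_(`[0, x]%classic) t)%:C *: adjmx (F t).
have mind (D : set R) : measurable_fun D (\1_(`[0, x]%classic) : R -> R).
  by apply: measurable_funTS; apply: measurable_indic.
have cFF := continuous_rdot mF mF.
have u_L2 : in_L2 u.
  split.
    move=> i; have [c1 c2] := mcont_adj mF i ord0; split.
      have -> : (fun t => Re (u t i ord0)) = \1_(`[0, x]%classic) \* (fun t => Re (adjmx (F t) i ord0)).
        by apply/funext => t; rewrite /u mxE ReRM.
      by apply: measurable_funM => //; apply: continuous_meas.
    have -> : (fun t => Im (u t i ord0)) = \1_(`[0, x]%classic) \* (fun t => Im (adjmx (F t) i ord0)).
      by apply/funext => t; rewrite /u mxE ImRM.
    by apply: measurable_funM => //; apply: continuous_meas.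
  have h1 : (fun t => vnorm (u t) ^+ 2) = \1_(`[0, x]%classic) \* (fun t => rdot (F t) (F t)).
    apply/funext => t /=; rewrite vnorm_fro /u froZR exprMn fro_adjmx fro_sqr indicE.
    by case: (t \in _); rewrite ?normr1 ?normr0 ?expr1n ?expr0n.
  apply: le_lt_trans (_ : \int[@lebesgue_measure R]_(t in `[0%R, pi]%classic) (rdot (F t) (F t))%:E < +oo)%E.
    rewrite /sqnorm_L2 (integral_itv_bndoo true false); last first.
      apply/measurable_EFinP; exact: continuous_meas.
    apply: ge0_le_integral => //=.
    - by move=> t _; rewrite lee_fin sqr_ge0.
    - by apply/measurable_EFinP; rewrite h1; apply: measurable_funM => //; apply: continuous_meas.
    - by apply/measurable_EFinP; apply: continuous_meas.
    move=> t _; rewrite lee_fin -[leLHS]/((fun t => vnorm (u t) ^+ 2) t) h1 /= indicE.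
    by case: (t \in _); rewrite ?mul1r ?mul0r // rdot_ge0.
  have /integrableP [_] := @rint_integrable R pi _ cFF.
  apply: le_lt_trans; apply: ge0_le_integral => //=.
  - by move=> t _; rewrite lee_fin rdot_ge0.
  - by apply/measurable_EFinP; apply: continuous_meas.
  - by apply/measurable_EFinP; apply: measurableT_comp => //; apply: continuous_meas.
  - by move=> t _; rewrite lee_fin ler_norm.
have [s hs] := cX u (e ^+ 2) u_L2 (exprn_gt0 2 e0).
exists s; pose S t := \sum_(a <- s) a.1 *: X a.2 t.
have mS : mcont (fun t => adjmx (S t)).
  apply: mcont_adj; apply: mcont_sum => a.
  have -> : (fun t => a.1 *: X a.2 t) = fun t => a.1%:M *m X a.2 t.
    by apply/funext => t; rewrite mul_scalar_mx.
  by apply: mcontM; [apply: mcont_cst|apply: mX].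
have mFS : mcont (fun t => F t - adjmx (S t)) by apply: mcontB.
rewrite -[leRHS]ger0_norm ?(ltW e0) // -sqrtr_sqr ler_sqrt ?sqr_ge0 // /ip /rint /Rintegral.
have cr := continuous_rdot mFS mFS.
rewrite -lee_fin fineK; last by apply: integrable_fin_num => //; apply: rint_integrable.
apply: le_trans (ltW hs); rewrite /sqnorm_L2.
rewrite (integral_itv_bndoo true false); last by apply/measurable_EFinP; apply: continuous_meas.
apply: le_trans (_ : \int[@lebesgue_measure R]_(t in `]0%R, x[%classic)
  (vnorm (u t - S t) ^+ 2)%:E <= _)%E.
  rewrite le_eqVlt; apply/orP; left; apply/eqP; apply: eq_integral => t.
  rewrite inE /= in_itv /= => /andP[t0 tx]; congr EFin.
  rewrite vnorm_fro /u indicE mem_set /= ?in_itv /= ?(ltW t0) ?(ltW tx) // scale1r.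
  by rewrite -fro_sqr -[in RHS]fro_adjmx adjmxB adjmxK.
apply: ge0_subset_integral => //=.
- apply/measurable_EFinP.
  (* [u] may jump at x, so measurability is read off from an indicator times a continuous function
     plus a continuous one. *)
  have -> : (fun t => vnorm (u t - S t) ^+ 2) =
      (\1_(`[0, x]%classic) \* (fun t => rdot (F t) (F t) - 2 * rdot (F t) (adjmx (S t)))) \+
      (fun t => rdot (adjmx (S t)) (adjmx (S t))).
    apply/funext => t /=; rewrite vnorm_fro -fro_adjmx adjmxB fro_sqr /u adjmxZR adjmxK.
    rewrite rdotDl !rdotDr !rdotNr !rdotNl rdotZl !rdotZr rdotZl (rdotC _ (F t)) indicE.
    by case: (t \in _); rewrite /= ?mulr1n ?mulr0n; ring.
  apply: measurable_funD; last by apply: continuous_meas; apply: continuous_rdot.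
  apply: measurable_funM => //; apply: continuous_meas.
  apply: continuousDr => //; apply: continuousNr; apply: continuousMr; first exact: continuous_cst.
  exact: continuous_rdot.
- by move=> t _; rewrite lee_fin sqr_ge0.
- by move=> t; rewrite /= !in_itv /= => /andP[-> /lt_le_trans ->].
Qed.

End L2Approximation.

Section MatrixLimits.
Context {R : realType}.
Local Notation C := (R[i]).
Local Notation Re := (@complex.Re R).
Local Notation Im := (@complex.Im R).
Local Open Scope classical_set_scope.

Lemma mxcvg_mulr p q s (u : nat -> 'M[C]_(p, q)) l (A : 'M[C]_(q, s)) :
  mxcvg u l -> mxcvg (fun n => u n *m A) (l *m A).
Proof.
move=> /mxcvgP h; apply/mxcvgP.
have h2 : (fun n => fro (u n - l) * fro A) @ \oo --> (0 * fro A : R).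
  by apply: cvgM => //; apply: cvg_cst.
rewrite mul0r in h2; apply: (squeeze0 h2); apply: filterE => n.
by rewrite fro_ge0 -mulmxBl /= froM.
Qed.

Lemma mxcvg_mull p q s (u : nat -> 'M[C]_(p, q)) l (A : 'M[C]_(s, p)) :
  mxcvg u l -> mxcvg (fun n => A *m u n) (A *m l).
Proof.
move=> /mxcvgP h; apply/mxcvgP.
have h2 : (fun n => fro A * fro (u n - l)) @ \oo --> (fro A * 0 : R).
  by apply: cvgM => //; apply: cvg_cst.
rewrite mulr0 in h2; apply: (squeeze0 h2); apply: filterE => n.
by rewrite fro_ge0 -mulmxBr /= froM.
Qed.

Lemma mxcvg_uniq p q (u : nat -> 'M[C]_(p, q)) l k : mxcvg u l -> mxcvg u k -> l = k.
Proof. by move=> /mxcvg_lim <- /mxcvg_lim <-. Qed.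

Lemma rdot_cvg p q (u v : nat -> 'M[C]_(p, q)) l k : mxcvg u l -> mxcvg v k ->
  (fun n => rdot (u n) (v n)) @ \oo --> rdot l k.
Proof.
move=> hu hv; under eq_fun do rewrite rdotE.
rewrite rdotE; apply: cvg_sumr => i; apply: cvg_sumr => j.
have [h1 h2] := hu i j; have [h3 h4] := hv i j.
exact: cvgD (cvgM h1 h3) (cvgM h2 h4).
Qed.

Lemma mxcvg_cst p q (A : 'M[C]_(p, q)) : mxcvg (fun=> A) A.
Proof. by move=> i j; split; apply: cvg_cst. Qed.

End MatrixLimits.

(** * The homogeneous equation *)

Section Injectivity.
Context {R : realType}.
Local Notation C := (R[i]).
Local Open Scope classical_set_scope.
Variables (m : nat) (T1 T2 : 'M[C]_m) (r : 'I_m -> R) (n0 : nat).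
Variables (lam : J T1 T2 -> R) (alpha alphat : J T1 T2 -> 'M[C]_m).
Hypothesis m0 : (0 < m)%N.
Hypothesis hT1 : orth_proj T1.
Hypothesis hr01 : forall k, 0 <= r k < 1.
Hypothesis hi : cond_i lam alpha.
Hypothesis hiii : cond_iii lam alpha.
Hypothesis hn0 : G_disjoint r n0 lam.
Local Notation JT := (J T1 T2).
Local Notation JJT := (JJ T1 T2).
Local Notation Bd := (Bd (sameG r n0 (T1 := T1) (T2 := T2)) (drho r lam)).
Local Notation kapJ := (kapJ r lam).
Local Notation FN := (FN r n0 lam alpha alphat).
Local Notation Gseq := (@Gseq R m T1 T2 r n0).
Local Notation Rpartial := (Rpartial r n0 lam alpha alphat).
Local Notation Rtilde := (Rtilde r n0 lam alpha alphat).
Local Notation aI := (alphaI r lam alpha alphat).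
Local Notation cf := (cf r lam alpha alphat).
Local Notation phi := (phiI r lam).
Local Notation TT := (TI r lam).
Local Notation lI := (lamI r lam).
Variable ck : R.
Hypothesis kap_le : forall a : J T1 T2, `|kapJ a| <= ck.
Hypothesis F_cauchy : forall e, 0 < e -> exists N0, forall N M, (N0 <= N <= M)%N ->
  forall d f, Bd d f -> nL pi (fun t => FN f M t - FN f N t) <= e * d.
Hypothesis m_bessel : forall (s : seq JJT) p (x : R) (F : R -> 'M[C]_(p, m)), uniq s ->
  (forall b, b \in s -> b.2 = true) -> 0 <= x <= pi -> mcont F ->
  \sum_(b <- s) rdot (mint x (fun t => F t *m phi b t) *m aI b)
                     (mint x (fun t => F t *m phi b t)) <= ip x F F.
Variable x : R.
Hypothesis hx : 0 <= x <= pi.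
Variables (f : JJT -> 'M[C]_m) (d : R).
Hypothesis hf : Bd d f.
Hypothesis f_eq : forall a, f a + Rtilde x f a = 0.

Fixpoint LN (N : nat) : seq JJT := if N is k.+1 then LN k ++ Gseq k else [::].

Lemma mem_LN N b : b \in LN N -> exists2 k, (k < N)%N & Defs.G r n0 k b.
Proof.
elim: N => [|N IH] //=; rewrite mem_cat => /orP[/IH [k kN h]|/(mem_Gseq r n0 m0) h].
  by exists k => //; apply: ltnW.
by exists N.
Qed.

Lemma LN_mem N k b : (k < N)%N -> Defs.G r n0 k b -> b \in LN N.
Proof.
elim: N => [|N IH] //=; rewrite ltnS leq_eqVlt mem_cat => /orP[/eqP -> h|kN h].
  by apply/orP; right; apply/(mem_Gseq r n0 m0).
by rewrite IH.
Qed.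

(** Distinct blocks share no frequency, hence no index; Bessel's inequality can therefore be applied
    to several blocks at once. *)
Lemma uniq_LN N : uniq (LN N).
Proof.
elim: N => [|N IH] //=; rewrite cat_uniq IH uniq_Gseq andbT /=.
apply/hasPn => b /(mem_Gseq r n0 m0) h; apply/negP => /mem_LN [k kN h'].
by apply: (hn0 _ h' h) => // e; rewrite e ltnn in kN.
Qed.

Lemma FN_LN N t : FN f N t = \sum_(b <- LN N) cf f b *m phi b t.
Proof.
elim: N => [|N IH] /=; first by rewrite /FN big_ord0 big_nil.
by rewrite /FN big_ord_recr /= big_cat -IH.
Qed.

Let g b : 'M[C]_m := f b *m invmx (TT b).
Let gam M b : 'M[C]_m := mint x (fun t => FN f M t *m phi b t).

(** The homogeneous equation reads f = - R~ f, and [gam M b] is the M-th partial sum of R~ f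
    stripped of the invertible factor T. *)
Lemma gam_cvg b : mxcvg (fun M => gam M b) (- g b).
Proof.
have -> : - g b = Rtilde x f b *m invmx (TT b).
  rewrite /g -mulNmx; congr (_ *m _); apply/eqP; rewrite eq_sym -subr_eq0 opprK addrC.
  by rewrite f_eq.
have -> : (fun M => gam M b) = fun M => Rpartial x f b M *m invmx (TT b).
  apply/funext => M; rewrite (Rpartial_solF r n0 lam alpha alphat m0) /solF -mint_mulmxr; last first.
    by apply: mcontM; [apply: mcont_FN|apply: mcont_eps].
  apply: mint_ext => t _; rewrite /eps -!mulmxA mulmxV ?mulmx1 //.
  exact: TI_unit.
exact/mxcvg_mulr/(Rpartial_cvg m0 hT1 hr01 kap_le F_cauchy hx b hf).
Qed.

(* The limit of [gam] only involves the eigenvalue, not the index carrying it. *)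
Lemma g_lamI b c : lI b = lI c -> g b = g c.
Proof.
move=> e; apply: oppr_inj; apply: (mxcvg_uniq (gam_cvg b)).
have -> : (fun M => gam M b) = (fun M => gam M c); last exact: gam_cvg.
by apply/funext => M; apply: mint_ext => t _; rewrite /phiI e.
Qed.

Let sg (b : JJT) : R := (-1) ^+ b.2.

Lemma cf_g b : cf f b = (sg b)%:C *: (g b *m aI b).
Proof. by rewrite /cf /sg rmorphXn rmorphN1. Qed.

Lemma ip_FN M N : ip x (FN f M) (FN f N) = \sum_(b <- LN N) sg b * rdot (gam M b) (g b *m aI b).
Proof.
have mF := mcont_FN r n0 lam alpha alphat f M.
rewrite (ip_ext (fun t _ => erefl (FN f M t)) (fun t _ => FN_LN N t)).
have mcp b : mcont (fun t => cf f b *m phi b t).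
  by apply: mcontM; [apply: mcont_cst|apply: mcont_phiI].
rewrite (ip_sumr _ _ _ mcp mF); apply: eq_bigr => b _.
rewrite ip_mint //; last exact: mcont_phiI.
have -> : mint x (fun t => FN f M t *m adjmx (phi b t)) = gam M b.
  by apply: mint_ext => t _; rewrite (adj_phiI r lam hT1).
by rewrite cf_g (rdotZr (sg b)).
Qed.

Let P N : R := \sum_(b <- LN N | ~~ b.2) rdot (g b *m aI b) (g b).
Let Q N : R := \sum_(b <- LN N | b.2) rdot (g b *m aI b) (g b).

(** For the model indices the sign (-1)^j cancels the sign of the limit - g of [gam], while for the
    given indices the minus survives. *)
Lemma ip_FN_cvg N : (fun M => ip x (FN f M) (FN f N)) @ \oo --> Q N - P N.
Proof.
have -> : Q N - P N = \sum_(b <- LN N) sg b * rdot (- g b) (g b *m aI b).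
  rewrite [RHS](bigID (fun b : JJT => b.2)) /= /Q /P -sumrN; congr (_ + _).
    by apply: eq_bigr => b hb; rewrite /sg hb expr1 mulN1r rdotNl opprK rdotC.
  by apply: eq_bigr => b hb; rewrite /sg (negbTE hb) expr0 mul1r rdotNl rdotC.
under eq_fun do rewrite ip_FN.
apply: cvg_sumr => b; apply: cvgM; first exact: cvg_cst.
by apply: rdot_cvg; [apply: gam_cvg|apply: mxcvg_cst].
Qed.

Lemma Q_le N : forall c, (\forall M \near \oo, ip x (FN f M) (FN f M) <= c) -> Q N <= c.
Proof.
move=> c hc; pose s := [seq b <- LN N | b.2].
have us : uniq s by apply: filter_uniq; apply: uniq_LN.
have s1 b : b \in s -> b.2 = true by rewrite mem_filter => /andP[].
have lim : (fun M => \sum_(b <- s) rdot (gam M b *m aI b) (gam M b)) @ \oo -->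
    \sum_(b <- s) rdot (- g b *m aI b) (- g b).
  by apply: cvg_sumr => b; apply: rdot_cvg; [apply: mxcvg_mulr|]; apply: gam_cvg.
have -> : Q N = \sum_(b <- s) rdot (- g b *m aI b) (- g b).
  by rewrite /s big_filter; apply: eq_bigr => b _; rewrite mulNmx rdotNl rdotNr opprK.
apply: (ler_cvg_to lim (cvg_cst c)).
apply: filterS hc => M; apply: le_trans.
exact: (m_bessel us s1 hx (mcont_FN r n0 lam alpha alphat f M)).
Qed.

Lemma aI_rpsd0 b : ~~ b.2 -> rpsd (aI b).
Proof. by case: b => a [] //= _; apply: aI_rpsd => b; case: hi => h _ _; apply: h. Qed.

(** Let a be the norm of F_N over [0, x]. Pairing F_M with F_N gives Q - P >= a^2 - e d a, and
    Bessel's inequality gives Q <= (a + e d)^2. The terms a^2 cancel, which leaves P <= 3 e d a + (e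
    d)^2. *)
Lemma P_small : forall tau, 0 < tau -> exists N0, forall N, (N0 <= N)%N -> P N <= tau.
Proof.
move=> tau tau0; have d0 := Bd_ge0 m0 hf.
have [CF CF0 hF] := FN_bound m0 F_cauchy.
(* Since a <= CF d and e <= 1, the final bound for P is at most [e * K]; the summand 1 keeps [K]
   positive. *)
pose K := (3 * CF * d + d) * d + 1.
have K0 : 0 < K by rewrite ltr_wpDl // mulr_ge0 // addr_ge0 // !mulr_ge0.
pose e := Num.min 1 (tau / K).
have e0 : 0 < e by rewrite lt_min ltr01 divr_gt0.
have e1 : e <= 1 by rewrite ge_min lexx.
have eK : e * K <= tau by rewrite -ler_pdivlMr // ge_min lexx orbT.
have [N0 hN0] := F_cauchy e0; exists N0 => N NN.
have cF M := mcont_FN r n0 lam alpha alphat f M.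
have sub M : (N <= M)%N -> nL x (fun t => FN f M t - FN f N t) <= e * d.
  move=> NM; apply: le_trans (hN0 N M _ d f hf); last by rewrite NN.
  by apply: nL_le_dom => //; apply: mcontB.
pose a := nL x (FN f N).
have a0 : 0 <= a by apply: nL_ge0.
have aF : a <= CF * d by apply: le_trans (hF N d f hf); apply: nL_le_dom.
have QP : a ^+ 2 - e * d * a <= Q N - P N.
  have l1 : (fun=> a ^+ 2 - e * d * a) @ \oo --> a ^+ 2 - e * d * a by apply: cvg_cst.
  apply: (ler_cvg_to l1 (@ip_FN_cvg N)).
  exists N => // M /= NM.
  have -> : ip x (FN f M) (FN f N) = ip x (fun t => FN f M t - FN f N t) (FN f N) + a ^+ 2.
    by rewrite /a nL_sqr -(ipDl _ (mcontB (cF M) (cF N)) (cF N) (cF N)); apply: ip_ext => t _; rewrite ?subrK.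
  have := ip_le x (mcontB (cF M) (cF N)) (cF N); rewrite -/a ler_norml => /andP[h _].
  have := ler_wpM2r a0 (sub M NM); lra.
have Qa : Q N <= (a + e * d) ^+ 2.
  apply: Q_le; exists N => // M /= NM; rewrite -nL_sqr ler_sqr ?nnegrE ?nL_ge0 ?addr_ge0 ?mulr_ge0 ?(ltW e0) //.
  rewrite (nL_ext (H := fun t => FN f N t + (FN f M t - FN f N t))); last by move=> t _; rewrite addrC subrK.
  apply: le_trans (nLD _ (cF N) (mcontB (cF M) (cF N))) _.
  by rewrite lerD2l sub.
apply: le_trans eK.
have h1 : P N <= 3 * (e * d) * a + (e * d) ^+ 2 by move: Qa QP; rewrite sqrrD; lra.
apply: le_trans h1 _.
have h2 : e * d * a <= e * d * (CF * d) by rewrite ler_wpM2l ?mulr_ge0 ?(ltW e0).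
have h3 : (e * d) ^+ 2 <= e * d * d.
  rewrite exprMn expr2 [d ^+ 2]expr2 -[leRHS]mulrA ler_wpM2r ?mulr_ge0 //.
  by rewrite ler_piMl // ltW.
rewrite /K; have := e0; lra.
Qed.

Lemma g_aI (a : JT) : g (a, false) *m aI (a, false) = 0.
Proof.
apply: rpsd_eq0; first exact: aI_rpsd0.
apply/eqP; rewrite eq_le; have [_ pos] := @aI_rpsd0 (a, false) isT; rewrite pos andbT.
apply/ler_addgt0Pr => tau tau0; rewrite add0r.
have [N0 h] := P_small tau0; have [k Gk] := G_cover r n0 m0 (a, false).
apply: le_trans (h (maxn N0 k.+1) (leq_maxl _ _)).
rewrite /P -big_filter (bigD1_seq (a, false)) ?filter_uniq ?uniq_LN //=; last first.
  by rewrite mem_filter; apply: (@LN_mem _ k); rewrite ?leq_maxr.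
rewrite big_filter_cond lerDl sumr_ge0 // => b /andP[hb _].
by have [_ h'] := aI_rpsd0 hb; apply: h'.
Qed.

(** Removes the prime. At an index that is not first in its group alpha' is 0 and [g_aI] says
    nothing, but [g] and [alpha] agree with those at an earlier index of the same eigenvalue;
    induction runs over the lexicographic rank. *)
Lemma g_alpha (a : JT) : g (a, false) *m alpha a = 0.
Proof.
have [n] := ubnP (J1 a * m + J2 a)%N; elim: n a => // n IH a; rewrite ltnS => an.
have := g_aI a; rewrite /alphaI /= /prime_of; case: asboolP => // -[b [ba e]] _.
have [_ _ h] := hi; rewrite -(h b a e) (@g_lamI _ (b, false)) //; apply: IH.
apply: leq_trans an; case: ba => [lt|[-> lt]]; last by rewrite ltn_add2l.
apply: leq_trans (_ : J1 b * m + m <= _)%N; first by rewrite ltn_add2l.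
by rewrite -mulSnr (leq_trans _ (leq_addr _ _)) // leq_mul2r lt orbT.
Qed.

Lemma range_mul (a : JT) (chi : JT -> 'cV[C]_m) : chi_basis lam alpha chi ->
  exists w, chi a = alpha a *m w.
Proof.
move=> /(_ a) [s [us hs] bs].
have : chi a \in limg (mulop (alpha a)).
  apply: (basis_mem bs); apply: map_f; exact/hs.
by move=> /memv_imgP [w _ ->]; exists w; rewrite lfunE.
Qed.

(** Completeness concerns vector functions, so the matrix function F_N is treated row by row. *)
Let ei (i : 'I_m) : 'M[C]_(1, m) := delta_mx ord0 i.
Let Fi i M t : 'M[C]_(1, m) := ei i *m FN f M t.

Lemma mcont_Fi i M : mcont (Fi i M).
Proof. by apply: mcontM; [apply: mcont_cst|apply: mcont_FN]. Qed.

Lemma ip_eigen_cvg i (a : JT) (v : 'cV[C]_m) :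
  (fun M => ip x (Fi i M) (fun t => adjmx (phi (a, false) t *m (alpha a *m v)))) @ \oo --> (0 : R).
Proof.
have pa : adjmx (alpha a) = alpha a by case: hi => h _ _; case: (h a).
have -> : (fun M => ip x (Fi i M) (fun t => adjmx (phi (a, false) t *m (alpha a *m v)))) =
    fun M => rdot (ei i *m (gam M (a, false) *m alpha a)) (adjmx v).
  apply/funext => M.
  rewrite (ip_ext (H' := fun t => adjmx v *m alpha a *m phi (a, false) t) (fun t _ => erefl (Fi i M t))); last first.
    by move=> t _; rewrite !adjmxM pa (adj_phiI r lam hT1).
  rewrite ip_mint; [|exact: mcont_Fi|exact: mcont_phiI].
  have -> : mint x (fun t => Fi i M t *m adjmx (phi (a, false) t)) = ei i *m gam M (a, false).
    rewrite -mint_mulmxl; last by apply: mcontM; [apply: mcont_FN|apply: mcont_phiI].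
    by apply: mint_ext => t _; rewrite (adj_phiI r lam hT1) mulmxA.
  by rewrite mulmxA [RHS]rdotMr pa.
have -> : (0 : R) = rdot (ei i *m (- g (a, false) *m alpha a)) (adjmx v).
  by rewrite mulNmx g_alpha oppr0 mulmx0 rdot0l.
by apply: rdot_cvg; [apply/mxcvg_mull/mxcvg_mulr/gam_cvg|apply: mxcvg_cst].
Qed.

(** A combination S of the X_nk lies within eta of the row of F_N. Its pairing with the row of F_M
    tends to 0 as M grows, and the two rows differ by at most E, so the squared norm of the row of
    F_N is at most n eta + E (n + eta). As eta is arbitrary, E n remains, which is proportional to
    tau. *)
Lemma Fi_small : exists2 B, 0 <= B & forall tau, 0 < tau -> exists N0, forall N, (N0 <= N)%N ->
  forall i, ip x (Fi i N) (Fi i N) <= B * tau.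
Proof.
have aux (X Y Z W : R) : - Z <= X -> Z <= W -> Y <= X + Y + W by move=> *; lra.
have aux2 (E n eta dl : R) : (n + E) * eta <= dl -> n * eta + E * (n + eta) <= E * n + dl.
  by rewrite mulrDl mulrDr; lra.
have d0 := Bd_ge0 m0 hf; have [CF CF0 hF] := FN_bound m0 F_cauchy.
pose D := \sum_i fro (ei i).
have D_le i : fro (ei i) <= D by rewrite /D (bigD1 i) //= lerDl sumr_ge0 // => j _; apply: fro_ge0.
have D0 : 0 <= D by apply: sumr_ge0 => j _; apply: fro_ge0.
have c0 : 0 <= D * (CF * d) by rewrite mulr_ge0 // mulr_ge0.
exists (D * d * (D * (CF * d))) => [|tau tau0]; first by rewrite mulr_ge0 // mulr_ge0.
have [N0 hN0] := F_cauchy tau0; exists N0 => N NN i.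
have cFN M := mcont_FN r n0 lam alpha alphat f M.
have mFi := mcont_Fi i.
have n_le : nL x (Fi i N) <= D * (CF * d).
  apply: le_trans (nL_mull _ _ (cFN N)) _; apply: ler_pM; rewrite ?fro_ge0 ?nL_ge0 //.
  by apply: le_trans (hF N d f hf); apply: nL_le_dom.
have sub M : (N <= M)%N -> nL x (fun t => Fi i M t - Fi i N t) <= D * (tau * d).
  move=> NM; rewrite (nL_ext (H := fun t => ei i *m (FN f M t - FN f N t))); last first.
    by move=> t _; rewrite mulmxBr.
  apply: le_trans (nL_mull _ _ (mcontB (cFN M) (cFN N))) _.
  apply: ler_pM; rewrite ?fro_ge0 ?nL_ge0 //.
  apply: le_trans (hN0 N M _ d f hf); last by rewrite NN.
  by apply: nL_le_dom => //; apply: mcontB.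
have [chi hchi hcompl] := hiii.
pose E := D * (tau * d).
have E0 : 0 <= E by rewrite mulr_ge0 // mulr_ge0 // ltW.
pose n := D * (CF * d).
apply/ler_addgt0Pr => dl dl0.
(* Chosen so that the contribution [(n + E) * eta] of the approximation error is at most [dl]. *)
pose eta := dl / (E + n + 1).
have k0 : 0 < E + n + 1 by rewrite ltr_wpDl // addr_ge0.
have eta0 : 0 < eta by rewrite divr_gt0.
have mX a : mcont (fun t => phit T1 t (lam a) *m chi a).
  by apply: mcontM; [apply: (mcont_phiI r lam (a, false))|apply: mcont_cst].
have [s hs] := approx_on_interval hcompl mX (mFi N) hx eta0.
pose S t := adjmx (\sum_(a <- s) a.1 *: (phit T1 t (lam a.2) *m chi a.2)).
pose St (a : C * JT) t := adjmx (a.1 *: (phit T1 t (lam a.2) *m chi a.2)).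
have SE t : S t = \sum_(a <- s) St a t by rewrite /S adjmx_sum.
have /choice [w hw] : forall a, exists w, chi a = alpha a *m w by move=> a; apply: range_mul.
have StE a t : St a t = adjmx (phi (a.2, false) t *m (alpha a.2 *m (a.1 *: w a.2))).
  by rewrite /St hw -!scalemxAr.
have mSt a : mcont (St a).
  have -> : St a = fun t => adjmx (phi (a.2, false) t *m (alpha a.2 *m (a.1 *: w a.2))).
    by apply/funext => t; apply: StE.
  by apply: mcont_adj; apply: mcontM; [apply: mcont_phiI|apply: mcont_cst].
have mS : mcont S.
  have -> : S = fun t => \sum_(a <- s) St a t by apply/funext => t; apply: SE.
  exact: mcont_sum.
have lim : (fun M => ip x (Fi i M) S) @ \oo --> (0 : R).
  have -> : (0 : R) = \sum_(a <- s) 0 by rewrite big1.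
  have -> : (fun M => ip x (Fi i M) S) = fun M => \sum_(a <- s) ip x (Fi i M) (St a).
    apply/funext => M; rewrite -(ip_sumr _ _ _ mSt (mFi M)).
    by apply: ip_ext => t _.
  apply: cvg_sumr => a.
  have -> : (fun M => ip x (Fi i M) (St a)) = fun M => ip x (Fi i M)
      (fun t => adjmx (phi (a.2, false) t *m (alpha a.2 *m (a.1 *: w a.2)))).
    by apply/funext => M; apply: ip_ext => t _ //.
  exact: ip_eigen_cvg.
have nS : nL x S <= n + eta.
  rewrite (nL_ext (H := fun t => Fi i N t + - (Fi i N t - S t))); last first.
    by move=> t _; rewrite opprB addrCA subrr addr0.
  apply: le_trans (nLD _ (mFi N) (mcontN (mcontB (mFi N) mS))) _.
  by rewrite (nLN _ (mcontB (mFi N) mS)); apply: lerD.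
have ipS : ip x (Fi i N) S <= E * (n + eta).
  have l2 : (fun M => ip x (Fi i M) S + E * (n + eta)) @ \oo --> 0 + E * (n + eta).
    by apply: cvgD => //; apply: cvg_cst.
  rewrite add0r in l2.
  have l1 : (fun=> ip x (Fi i N) S) @ \oo --> ip x (Fi i N) S by apply: cvg_cst.
  apply: (ler_cvg_to l1 l2); exists N => // M /= NM.
  have e1 : ip x (Fi i M) S = ip x (fun t => Fi i M t - Fi i N t) S + ip x (Fi i N) S.
    by rewrite -(ipDl _ (mcontB (mFi M) (mFi N)) (mFi N) mS); apply: ip_ext => t _; rewrite ?subrK.
  have := ip_le x (mcontB (mFi M) (mFi N)) mS; rewrite ler_norml => /andP[h _].
  have h2 : nL x (fun t => Fi i M t - Fi i N t) * nL x S <= E * (n + eta).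
    exact: (ler_pM (nL_ge0 _ _) (nL_ge0 _ _) (sub M NM) nS).
  exact: (eq_ind_r (fun z => ip x (Fi i N) S <= z + E * (n + eta)) (aux _ _ _ _ h h2) e1).
have e2 : ip x (Fi i N) (Fi i N) = ip x (Fi i N) (fun t => Fi i N t - S t) + ip x (Fi i N) S.
  by rewrite -(ipDr _ (mcontB (mFi N) mS) mS (mFi N)); apply: ip_ext => t _; rewrite ?subrK.
have h3 : ip x (Fi i N) (fun t => Fi i N t - S t) <= n * eta.
  apply: le_trans (ler_norm _) _; apply: le_trans (ip_le x (mFi N) (mcontB (mFi N) mS)) _.
  exact: (ler_pM (nL_ge0 _ _) (nL_ge0 _ _) n_le hs).
rewrite e2; apply: le_trans (lerD h3 ipS) _.
have h4 : (n + E) * eta <= dl.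
  rewrite /eta mulrA ler_pdivrMr // mulrC ler_wpM2l ?(ltW dl0) //.
  by rewrite [n + E]addrC lerDl.
have -> : D * d * (D * (CF * d)) * tau = E * n by rewrite /E /n; ring.
exact: aux2 h4.
Qed.

Lemma FN_vanish : forall e, 0 < e -> exists N0, forall N, (N0 <= N)%N -> nL x (FN f N) <= e.
Proof.
move=> e e0; have [B B0 hB] := Fi_small.
pose D := \sum_i fro (delta_mx i ord0 : 'M[C]_(m, 1)).
have D0 : 0 <= D by apply: sumr_ge0 => j _; apply: fro_ge0.
have D1 : 0 < D + 1 by rewrite ltr_wpDl.
have B1 : 0 < B + 1 by rewrite ltr_wpDl.
pose u := e / (D + 1); have u0 : 0 < u by rewrite divr_gt0.
have tau0 : 0 < u ^+ 2 / (B + 1) by rewrite divr_gt0 // exprn_gt0.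
have [N0 h] := hB _ tau0; exists N0 => N NN.
have mFi i := mcont_Fi i N.
have mdF i : mcont (fun t => (delta_mx i ord0 : 'M[C]_(m, 1)) *m Fi i N t).
  by apply: mcontM; [apply: mcont_cst|].
rewrite (nL_ext (H := fun t => \sum_i (delta_mx i ord0 : 'M[C]_(m, 1)) *m Fi i N t)); last first.
  move=> t _; rewrite -[LHS]mul1mx mx1_sum_delta mulmx_suml; apply: eq_bigr => i _.
  by rewrite /Fi mulmxA mul_delta_mx.
apply: le_trans (nL_sum _ _ _ mdF) _.
apply: le_trans (_ : \sum_i fro (delta_mx i ord0 : 'M[C]_(m, 1)) * u <= _).
  apply: ler_sum => i _; apply: le_trans (nL_mull _ _ (mFi i)) _.
  rewrite ler_wpM2l ?fro_ge0 // -[leRHS]ger0_norm ?(ltW u0) // -sqrtr_sqr ler_sqrt ?sqr_ge0 //.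
  apply: le_trans (h N NN i) _; rewrite mulrA ler_pdivrMr // mulrC.
  by rewrite ler_wpM2l ?sqr_ge0 // lerDl.
rewrite -mulr_suml -/D /u mulrA ler_pdivrMr // mulrC ler_wpM2l ?(ltW e0) //.
by rewrite lerDl.
Qed.

Lemma f_eq0 a : f a = 0.
Proof.
have [c3 c30 h3] := solF_Bd n0 m0 hT1 hr01 kap_le.
suff -> : f a = - Rtilde x f a.
  suff -> : Rtilde x f a = 0 by rewrite oppr0.
  apply: fro_approx0 => e e0.
  have k0 : 0 < e / (c3 + 1) by rewrite divr_gt0 // ltr_wpDl.
  have [N0 h] := FN_vanish k0.
  rewrite -[Rtilde x f a]subr0; apply: (fro_cvg_le (Rpartial_cvg m0 hT1 hr01 kap_le F_cauchy hx a hf)).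
  exists N0 => // N /= NN; rewrite subr0 (Rpartial_solF r n0 lam alpha alphat m0).
  have [h' _] := h3 x (FN f N) hx (mcont_FN r n0 lam alpha alphat f N).
  apply: le_trans (h' a) _; apply: le_trans (ler_wpM2l c30 (h N NN)) _.
  rewrite mulrCA -[leRHS]mulr1 ler_wpM2l ?(ltW e0) // ler_pdivrMr ?mul1r ?lerDl //.
  by rewrite ltr_wpDl.
by apply/eqP; rewrite -subr_eq0 opprK f_eq.
Qed.

End Injectivity.

(** * Solvability of the main equation *)

Section BoundedOperators.
Context {R : realType}.
Local Notation C := (R[i]).
Variables (m : nat) (T1 T2 : 'M[C]_m) (r : 'I_m -> R) (n0 : nat) (lam : J T1 T2 -> R).
Hypothesis m0 : (0 < m)%N.
Local Notation JJT := (JJ T1 T2).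
Local Notation Bd := (Bd (sameG r n0 (T1 := T1) (T2 := T2)) (drho r lam)).
Local Notation frakB := (frakB r n0 lam).
Local Notation bounded_operator := (bounded_operator r n0 lam).

Lemma bounded_operator_Bd (S : (JJT -> 'M[C]_m) -> JJT -> 'M[C]_m) (c : R) :
  (forall d f, Bd d f -> Bd (c * d) (S f)) ->
  (forall (A : 'M[C]_m) d d' f g, Bd d f -> Bd d' g ->
     S (fun a => A *m f a + g a) = (fun a => A *m S f a + S g a)) ->
  bounded_operator S.
Proof.
move=> SB Slin; split.
- by move=> f /(frakB_Bd m0) [d _ /SB]; apply: Bd_frakB.
- move=> z f g /(frakB_Bd m0) [d _ fd] /(frakB_Bd m0) [d' _ gd].
  have -> : z *: f + g = fun a => z%:M *m f a + g a.
    by apply/funext => a; rewrite mul_scalar_mx.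
  by rewrite (Slin _ _ _ _ _ fd gd); apply/funext => a; rewrite mul_scalar_mx.
exists (c * (m ^ 2)%:R) => f /(frakB_Bd m0) [d -> /SB /Bd_normB_le].
by rewrite mulrA -EFinM.
Qed.

End BoundedOperators.

Section MainEquation.
Context {R : realType}.
Local Notation C := (R[i]).
Variables (m : nat) (T1 T2 : 'M[C]_m) (r : 'I_m -> R) (A : 'I_m -> 'M[C]_m).
Variables (alphat : J T1 T2 -> 'M[C]_m) (lam : J T1 T2 -> R) (alpha : J T1 T2 -> 'M[C]_m).
Variable n0 : nat.
Hypothesis m0 : (0 < m)%N.
Hypothesis hT1 : orth_proj T1.
Hypothesis hT2 : orth_proj T2.
Hypothesis hr : zeros_of_detW0 T1 T2 r.
Hypothesis hA : is_A T1 T2 r A.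
Hypothesis halphat : forall a : J T1 T2, is_model_weight T1 T2 (lamt r a)%:C (alphat a).
Hypothesis hlam : forall a, 0 <= lam a.
Hypothesis hi : cond_i lam alpha.
Hypothesis hii : cond_ii r A lam alpha.
Hypothesis hiii : cond_iii lam alpha.
Hypothesis hn0 : G_disjoint r n0 lam.
Variable x : R.
Hypothesis hx : 0 <= x <= pi.
Local Notation JJT := (JJ T1 T2).
Local Notation Bd := (Bd (sameG r n0 (T1 := T1) (T2 := T2)) (drho r lam)).
Local Notation frakB := (frakB r n0 lam).
Local Notation kapJ := (kapJ r lam).
Local Notation FN := (FN r n0 lam alpha alphat).
Local Notation Rtilde := (Rtilde r n0 lam alpha alphat).
Local Notation IRtilde := (IRtilde r n0 lam alpha alphat).
Local Notation aI := (alphaI r lam alpha alphat).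
Local Notation phi := (phiI r lam).
Local Notation TT := (TI r lam).

Let hr01 k : 0 <= r k < 1. Proof. by case: hr. Qed.

Lemma kap_le_ex : exists ck, forall a : J T1 T2, `|kapJ a| <= ck.
Proof. by case: hii => h _; apply: kap_bounded. Qed.

Lemma F_cauchy e : 0 < e -> exists N0, forall N M, (N0 <= N <= M)%N ->
  forall d f, Bd d f -> nL pi (fun t => FN f M t - FN f N t) <= e * d.
Proof.
have [h1 [K [h2 h3]]] := hii; have [hp _ _] := hi.
exact: (FN_cauchy n0 m0 hT1 hT2 hr hA halphat hp h2 h1 h3).
Qed.

Lemma Rtilde_inj d f : Bd d f -> (forall a, f a + Rtilde x f a = 0) -> forall a, f a = 0.
Proof.
move=> hf f_eq; have [ck hck] := kap_le_ex.
apply: (f_eq0 m0 hT1 hr01 hi hiii hn0 hck F_cauchy _ hx hf f_eq).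
move=> s p y F us s1 hy mF.
exact: (model_bessel alpha hT1 hT2 hr hA halphat hlam us s1 hy mF).
Qed.

(** A partial sum of R~ evaluates [f] at the indices of finitely many blocks and multiplies by fixed
    functions, so it is the finite-rank part required by [fredholm]; the rest is small by
    [Rtilde_approx]. *)
Lemma Rtilde_solve : exists2 c0, 0 <= c0 & forall c h, Bd c h ->
  exists2 g, Bd (c0 * c) g & forall a, g a + Rtilde x g a = h a.
Proof.
have [ck hck] := kap_le_ex.
have [c3 c30 h3] := Rtilde_approx m0 hT1 hr01 hck F_cauchy hx.
have [c4 c40 h4] := solF_Bd n0 m0 hT1 hr01 hck.
(* Makes c3 times this at most 1/2, the margin in [fredholm]; c3 may be 0, hence c3 + 1. *)
have e0 : 0 < 1 / (2 * (c3 + 1)) by rewrite divr_gt0 // mulr_gt0 // ltr_wpDl.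
have [N0 hN0] := h3 _ e0.
pose s := LN T1 T2 r n0 N0.
pose H (b : JJT) t := (-1) ^+ b.2 *: (invmx (TT b) *m aI b) *m phi b t.
have mH b : mcont (H b) by apply: mcontM; [apply: mcont_cst|apply: mcont_phiI].
pose kap (i : 'I_(size s)) := solF r lam x (H (tnth (in_tuple s) i)).
pose c5 := \sum_(i < size s) c4 * nL x (H (tnth (in_tuple s) i)).
have kap_bd i : Bd c5 (kap i).
  apply: BdW (h4 x _ hx (mH _)); first exact: drho_ge0.
  rewrite /c5 (bigD1 i) //= lerDl sumr_ge0 // => j _.
  by rewrite mulr_ge0 ?nL_ge0.
have approx c f : Bd c f ->
    Bd (c / 2) (fun a => Rtilde x f a - \sum_i f (tnth (in_tuple s) i) *m kap i a).
  move=> hf; have c0 := Bd_ge0 m0 hf.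
  have h5 := hN0 N0 (leqnn _) c f hf.
  have le5 : c3 * (1 / (2 * (c3 + 1)) * c) <= c / 2.
    have -> : c3 * (1 / (2 * (c3 + 1)) * c) = c / 2 * (c3 / (c3 + 1)).
      by field; rewrite gt_eqF // ltr_wpDl.
    rewrite -[leRHS]mulr1 ler_wpM2l ?divr_ge0 // ler_pdivrMr ?ltr_wpDl //.
    by rewrite mul1r lerDl.
  apply: Bd_ext (BdW (@drho_ge0 _ _ _ _ r lam) le5 h5) => a; congr (_ - _).
  rewrite (Rpartial_solF r n0 lam alpha alphat m0) -(big_tnth _ _ s xpredT (fun b => f b *m solF r lam x (H b) a)).
  rewrite /solF (mint_ext (H := fun t => \sum_(b <- s) f b *m (H b t *m eps r lam a t))).
    rewrite mint_sum; last by move=> b; apply: mcontM; [apply: mcont_cst|apply: mcontM; [apply: mH|apply: mcont_eps]].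
    apply: eq_bigr => b _; rewrite mint_mulmxl //.
    by apply: mcontM; [apply: mH|apply: mcont_eps].
  move=> t _; rewrite FN_LN mulmx_suml; apply: eq_bigr => b _.
  rewrite /H /cf; move: (f b) (invmx _) (aI b) (phi b t) (eps r lam a t) => X Y Z V W.
  by rewrite -!scalemxAl -!scalemxAr !mulmxA.
apply: (fredholm (@drho_ge0 _ _ _ _ r lam) m0 _ _ kap_bd approx).
  by move=> B f g c d hf hg; apply: (Rtilde_lin m0 hT1 hr01 hck F_cauchy hx B hf hg).
by move=> c f; apply: Rtilde_inj.
Qed.

Lemma phitB_Bd : exists c, Bd c (phitB r lam x).
Proof.
have [ck hck] := kap_le_ex; have [c2 c20 h2] := eps_lip m0 hT1 hr01 hck.
have pc : 0 <= pi * cT T1 by rewrite mulr_ge0 ?pi_ge0 ?cT_ge0.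
exists (pi * cT T1 + c2); split=> [a|a b _].
  by apply: le_trans (fro_eps r lam hT1 a hx) _; rewrite lerDl.
apply: le_trans (h2 a b x hx) _; rewrite ler_wpM2r ?normr_ge0 //.
by rewrite lerDr.
Qed.

Lemma Rtilde_wd : Rtilde_well_defined r n0 lam alpha alphat x.
Proof.
have [ck hck] := kap_le_ex; split.
  move=> f a /(frakB_Bd m0) [d _ hf]; exact: (Rpartial_cvg m0 hT1 hr01 hck F_cauchy hx a hf).
have [CR _ hR] := Rtilde_Bd m0 hT1 hr01 hck F_cauchy hx.
apply: (bounded_operator_Bd m0 hR) => B d d' f g hf hg.
exact: (Rtilde_lin m0 hT1 hr01 hck F_cauchy hx B hf hg).
Qed.

Lemma IRtilde_inj d d' f g : Bd d f -> Bd d' g -> IRtilde x f = IRtilde x g -> f = g.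
Proof.
move=> hf hg e; have [ck hck] := kap_le_ex; apply/funext => a; apply/eqP; rewrite -subr_eq0; apply/eqP.
have lin : Rtilde x (fun b => f b - g b) = fun b => Rtilde x f b - Rtilde x g b.
  have -> : (fun b => f b - g b) = fun b => (- 1%:M) *m g b + f b.
    by apply/funext => b; rewrite mulNmx mul1mx addrC.
  rewrite (Rtilde_lin m0 hT1 hr01 hck F_cauchy hx _ hg hf); apply/funext => b.
  by rewrite mulNmx mul1mx addrC.
apply: (Rtilde_inj (BdB hf hg)) => b; rewrite lin addrACA -opprD.
have := congr1 (fun F => F b) e; rewrite /Defs.IRtilde => eb.
by apply/eqP; rewrite subr_eq0; apply/eqP.
Qed.

Lemma IRtilde_bij : has_bounded_inverse r n0 lam (IRtilde x).
Proof.
have [ck hck] := kap_le_ex; have [c0 c00 solve] := Rtilde_solve.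
(* The solution is chosen before the bound [c]; uniqueness then makes it obey the estimate for every
   admissible bound. Functions outside all [Bd] receive an arbitrary value. *)
have /choice [S' hS'] : forall h, exists g, forall c, Bd c h -> Bd (c0 * c) g /\ IRtilde x g = h.
  move=> h; have [[c hc]|no] := pselect (exists c, Bd c h); last first.
    by exists h => c hc; case: no; exists c.
  have [g hg eg] := solve c h hc; have eg' : IRtilde x g = h by apply/funext => a; apply: eg.
  exists g => c' hc'; split=> //.
  have [g' hg' eg''] := solve c' h hc'.
  suff -> : g = g' by [].
  by apply: (IRtilde_inj hg hg'); rewrite eg'; apply/esym/funext => a; apply: eg''.
have S'B d f : Bd d f -> Bd (c0 * d) (S' f) by move=> hf; case: (hS' f d hf).
have S'E d f : Bd d f -> IRtilde x (S' f) = f by move=> hf; case: (hS' f d hf).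
exists S'.
  (* Linearity of the inverse comes from injectivity: both sides are bounded and have the same image
     under I + R~. *)
  apply: (bounded_operator_Bd m0 S'B) => B d d' f g hf hg.
  have hBf := Bd_mulmx B hf.
  have hs := BdD hBf hg.
  have hs' := BdD (Bd_mulmx B (S'B d f hf)) (S'B d' g hg).
  apply: (IRtilde_inj (S'B _ _ hs) hs'); rewrite (S'E _ _ hs).
  apply/funext => a; rewrite /Defs.IRtilde /= (Rtilde_lin m0 hT1 hr01 hck F_cauchy hx B (S'B d f hf) (S'B d' g hg)).
  by rewrite -[in LHS](S'E d f hf) -[in LHS](S'E d' g hg) /Defs.IRtilde /= mulmxDr addrACA.
have [CR _ hR] := Rtilde_Bd m0 hT1 hr01 hck F_cauchy hx.
move=> f /(frakB_Bd m0) [d _ hf]; split; last exact: (S'E _ _ hf).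
have hI : Bd ((m ^ 2)%:R * d + CR * ((m ^ 2)%:R * d)) (IRtilde x f) by apply: BdD => //; apply: hR.
by apply: (IRtilde_inj (S'B _ _ hI) hf); rewrite (S'E _ _ hI).
Qed.

Lemma main_equation_unique : exists! phi : JJT -> 'M[C]_m,
  frakB phi /\ main_equation r n0 lam alpha alphat x phi.
Proof.
have [c0 _ solve] := Rtilde_solve; have [c hc] := phitB_Bd.
have [g hg eg] := solve _ _ hc; exists g; split.
  by split; [exact: Bd_frakB hg|apply/funext => a; apply: eg].
move=> h [/(frakB_Bd m0) [d _ hd] eh]; apply: (IRtilde_inj hg hd).
by rewrite eh; apply/funext => a; apply: eg.
Qed.

End MainEquation.

Theorem theorem5p1 (R : realType) (m : nat) (T1 T2 : 'M[R[i]]_m)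
  (r : 'I_m -> R) (A : 'I_m -> 'M[R[i]]_m) (alphat : J T1 T2 -> 'M[R[i]]_m)
  (lam : J T1 T2 -> R) (alpha : J T1 T2 -> 'M[R[i]]_m) (n0 : nat)
  (hm : (0 < m)%N)
  (hT1 : orth_proj T1) (hT2 : orth_proj T2)
  (hr : zeros_of_detW0 T1 T2 r)
  (hA : is_A T1 T2 r A)
  (halphat : forall a : J T1 T2, is_model_weight T1 T2 (lamt r a)%:C (alphat a))
  (hlam : forall a, 0 <= lam a)
  (hi : cond_i lam alpha)
  (hii : cond_ii r A lam alpha)
  (hiii : cond_iii lam alpha)
  (hn0 : G_disjoint r n0 lam)
  (x : R) (hx : 0 <= x <= pi) :
  Rtilde_well_defined r n0 lam alpha alphat x /\
  has_bounded_inverse r n0 lam (IRtilde r n0 lam alpha alphat x) /\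
  exists! phi : JJ T1 T2 -> 'M[R[i]]_m,
    frakB r n0 lam phi /\ main_equation r n0 lam alpha alphat x phi.
Proof.
split; first exact: Rtilde_wd hm hT1 hT2 hr hA halphat hi hii x hx.
split; first exact: IRtilde_bij hm hT1 hT2 hr hA halphat hlam hi hii hiii hn0 x hx.
exact: main_equation_unique hm hT1 hT2 hr hA halphat hlam hi hii hiii hn0 x hx.
Qed.
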